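(* Let $p(\cdot):\mathbb{R}^n\to[1,\infty]$ be a Lebesgue measurable function satisfying $1<p_-\le p_+<\infty$, where $p_-:=\operatorname*{ess\,inf}_{x\in\mathbb{R}^n}p(x)$ and $p_+:=\operatorname*{ess\,sup}_{x\in\mathbb{R}^n}p(x)$. The Hardy--Littlewood maximal operator $M$ is bounded on $L^{p(\cdot)}(\mathbb{R}^n)$ if and only if there exists $C>0$ such that $$\bigg\|\sum_{Q\in\mathcal{Q}}\bigg(\frac1{|Q|}\int_Q|f(x)|\,dx\bigg)\chi_Q\bigg\|_{p(\cdot)}\le C\,\|f\|_{p(\cdot)}$$ holds for all $f\in L^{p(\cdot)}(\mathbb{R}^n)$ and all families $\mathcal{Q}$ of pairwise disjoint cubes in $\mathbb{R}^n$ selected from the $3^n$ adjacent dyadic grids $$\mathscr{D}^{\mathbf{t}}:=\left\{2^{-k}\big([0,1)^n+\mathbf{m}+(-1)^k\mathbf{t}\big)\ :\ k\in\mathbb{Z},\ \mathbf{m}\in\mathbb{Z}^n\right\},\quad \mathbf{t}\in\left\{0,\tfrac13,\tfrac23\right\}^n$$ (that is, from the union $\bigcup_{\mathbf{t}}\mathscr{D}^{\mathbf{t}}$).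
   Context: $\mathbb{R}^n$ carries the Euclidean distance and Lebesgue measure $|\cdot|$. For measurable $f$, $Mf(x):=\sup_{B\ni x}\frac1{|B|}\int_B|f(y)|\,dy$, the supremum being over all Euclidean balls $B$ containing $x$. $L^{p(\cdot)}(\mathbb{R}^n)$ is the space of complex-valued measurable $f$ with $\|f\|_{p(\cdot)}:=\inf\{\lambda>0:\int_{\mathbb{R}^n}(|f(x)|/\lambda)^{p(x)}dx\le1\}<\infty$ ($\inf\emptyset=\infty$; the same formula, with $\infty^p=\infty$, is used for $[0,\infty]$-valued functions). ''$M$ is bounded on $L^{p(\cdot)}$'' means that there is $C>0$ with $\|Mf\|_{p(\cdot)}\le C\|f\|_{p(\cdot)}$ for all $f\in L^{p(\cdot)}(\mathbb{R}^n)$. $\chi_Q$ is the characteristic function of $Q$. *)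

(* Defs.v *)
From HB Require Import structures.
From mathcomp Require Import all_boot all_order all_algebra.
From mathcomp Require Import all_classical all_reals all_analysis.
From mathcomp Require Import measurable_realfun ess_sup_inf.
From mathcomp Require Import complex.

Set Implicit Arguments.
Unset Strict Implicit.
Unset Printing Implicit Defensive.

Import Order.TTheory GRing.Theory Num.Theory.
Import numFieldNormedType.Exports.

Local Open Scope classical_set_scope.
Local Open Scope ring_scope.

(** Lebesgue measure on R^n = 'rV[R]_n.  [borelV R n] carries the Borel
    sigma-algebra (generated by the coordinate projections), [borel_volume R n]
    is the n-fold product of the Borel-Lebesgue measure of the line, and
    [lebesgueV R n] carries the sigma-algebra of Lebesgue measurable sets, on
    which [volume R n] is the completion of [borel_volume R n]. *)

Definition borelV (R : realType) (n : nat) : Type := 'rV[R]_n.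

Definition coordV (R : realType) (n : nat) (i : 'I_n) (x : borelV R n) :
  measurableTypeR R := (x : 'rV[R]_n) 0 i.

Definition borelV_display : measure_display. Proof. exact. Qed.

Section borelV.
Context (R : realType) (n : nat).

HB.instance Definition _ := Pointed.copy (borelV R n) 'rV[R]_n.

Let borelV_set0 : g_sigma_preimage (@coordV R n) set0.
Proof. exact: sigma_algebra0. Qed.

Let borelV_setC A :
  g_sigma_preimage (@coordV R n) A -> g_sigma_preimage (@coordV R n) (~` A).
Proof. exact: sigma_algebraC. Qed.

Let borelV_bigcup (F : (set (borelV R n))^nat) :
  (forall i, g_sigma_preimage (@coordV R n) (F i)) ->
  g_sigma_preimage (@coordV R n) (\bigcup_i (F i)).
Proof. exact: sigma_algebra_bigcup. Qed.

HB.instance Definition _ := @isMeasurable.Build borelV_display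
  (borelV R n) (g_sigma_preimage (@coordV R n))
  borelV_set0 borelV_setC borelV_bigcup.

Lemma measurable_coordV (i : 'I_n) :
  measurable_fun [set: borelV R n] (@coordV R n i).
Proof.
move=> _ Y mY; rewrite setTI; apply: sub_sigma_algebra => /=.
rewrite -bigcup_seq/=; exists i => /=; first by rewrite mem_index_enum.
by exists Y => //; rewrite setTI.
Qed.

Lemma measurable_fun_coordVP d (T : measurableType d) (f : T -> borelV R n) :
  (forall i, measurable_fun [set: T] (coordV i \o f)) ->
  measurable_fun [set: T] f.
Proof.
move=> mf.
have sub : g_sigma_preimage (fun i => coordV i \o f) `<=` measurable.
  apply: smallest_sub; first exact: sigma_algebra_measurable.
  case: n => [|m] in f mf *; first by rewrite big_ord0.
  rewrite -bigcup_mkord_ord; apply: bigcup_sub => i Ii.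
  by move=> A [B mB <-]; exact: mf.
move=> _ A mA; apply: sub; rewrite g_sigma_preimage_comp.
by exists A.
Qed.

End borelV.

Definition consV (R : realType) (n : nat)
    (z : measurableTypeR R * borelV R n) : borelV R n.+1 :=
  row_mx (z.1%:M : 'rV[R]_1) (z.2 : 'rV[R]_n).

Definition unconsV (R : realType) (n : nat) (v : borelV R n.+1) :
    measurableTypeR R * borelV R n :=
  (coordV ord0 v, @rsubmx R 1 1 n v).

Section consV.
Context (R : realType) (n : nat).

Lemma consVK : cancel (@consV R n) (@unconsV R n).
Proof.
move=> [x y]; rewrite /unconsV /consV /=; congr (_, _).
- transitivity (row_mx (x%:M : 'rV[R]_1) (y : 'rV[R]_n) 0 (lshift n ord0)).
    by rewrite /coordV; congr (row_mx _ _ _ _); exact: val_inj.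
  by rewrite (row_mxEl (x%:M : 'rV[R]_1)) mxE eqxx mulr1n.
- exact: row_mxKr.
Qed.

Lemma measurable_consV : measurable_fun setT (@consV R n).
Proof.
apply: measurable_fun_coordVP => i.
case: (splitP (i : 'I_(1 + n))) => j ij.
- have -> : coordV i \o @consV R n = fst.
    apply/funext => -[x y]; rewrite /coordV /consV /=.
    have -> : i = lshift n j by exact: val_inj.
    by rewrite (row_mxEl (x%:M : 'rV[R]_1)) mxE (ord1 j) eqxx mulr1n.
  exact: measurable_fst.
- have -> : coordV i \o @consV R n = coordV j \o snd.
    apply/funext => -[x y]; rewrite /coordV /consV /=.
    have -> : i = rshift 1 j by exact: val_inj.
    by rewrite (row_mxEr (x%:M : 'rV[R]_1)).
  apply: measurableT_comp; first exact: measurable_coordV.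
  exact: measurable_snd.
Qed.

Lemma measurable_unconsV : measurable_fun setT (@unconsV R n).
Proof.
apply: measurable_fun_pair; first exact: measurable_coordV.
apply: measurable_fun_coordVP => i.
have -> : coordV i \o (fun v : borelV R n.+1 => @rsubmx R 1 1 n v) =
    coordV (rshift 1 i : 'I_n.+1).
  by apply/funext => v; rewrite /coordV /= mxE.
exact: measurable_coordV.
Qed.

Variable mu : {sigma_finite_measure set (borelV R n) -> \bar R}.

Definition consV_measure : set (borelV R n.+1) -> \bar R :=
  pushforward (@lebesgue_measure R \x mu)%E (@consV R n).

Let consV_measure0 : consV_measure set0 = 0%E.
Proof. by rewrite /consV_measure /pushforward preimage_set0 measure0. Qed.

Let consV_measure_ge0 A : (0 <= consV_measure A)%E.
Proof. by rewrite /consV_measure /pushforward measure_ge0. Qed.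

Let consV_measure_sigma_additive : semi_sigma_additive consV_measure.
Proof.
have mpre A : measurable A -> measurable (@consV R n @^-1` A).
  by move=> mA; rewrite -[X in measurable X]setTI; exact: measurable_consV.
move=> F mF tF mUF; rewrite /consV_measure /pushforward preimage_bigcup.
apply: measure_semi_sigma_additive.
- by move=> k; exact: mpre.
- apply/trivIsetP => /= i j _ _ ij; rewrite -preimage_setI.
  by move/trivIsetP : tF => /(_ _ _ _ _ ij) ->//; rewrite preimage_set0.
- by rewrite -preimage_bigcup; exact: mpre.
Qed.

HB.instance Definition _ := isMeasure.Build _ _ _ consV_measure
  consV_measure0 consV_measure_ge0 consV_measure_sigma_additive.

Let consV_measure_sigma_finite : sigma_finite setT consV_measure.
Proof.
have /sigma_finiteP[F [TF ndF Foo]] := sigma_finiteT (@lebesgue_measure R).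
have /sigma_finiteP[G [TG ndG Goo]] := sigma_finiteT mu.
exists (fun k => @unconsV R n @^-1` (F k `*` G k)).
  apply/esym/seteqP; split => // v _.
  have [a _ Fa] : (\bigcup_i F i) (unconsV v).1 by rewrite -TF.
  have [b _ Gb] : (\bigcup_i G i) (unconsV v).2 by rewrite -TG.
  exists (maxn a b) => //; split => /=.
  - by move: Fa; exact/subsetPset/ndF/leq_maxl.
  - by move: Gb; exact/subsetPset/ndG/leq_maxr.
move=> k; have [mFk Fk] := Foo k; have [mGk Gk] := Goo k; split.
  rewrite -[X in measurable X]setTI; apply: measurable_unconsV => //.
  exact: measurableX.
rewrite /consV_measure /pushforward -comp_preimage.
rewrite (_ : _ @^-1` _ = F k `*` G k); last first.
  by rewrite (_ : _ \o _ = id) ?preimage_id//; exact/funext/consVK.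
by rewrite product_measure1E// lte_mul_pinfty// ge0_fin_numE.
Qed.

HB.instance Definition _ := @Measure_isSigmaFinite.Build _ _ _ consV_measure
  consV_measure_sigma_finite.

End consV.

Fixpoint borel_volume (R : realType) (n : nat) :
    {sigma_finite_measure set (borelV R n) -> \bar R} :=
  if n is m.+1 then consV_measure (borel_volume R m)
  else @dirac _ (borelV R 0) (0 : 'rV[R]_0) R.

Definition lebesgueV (R : realType) (n : nat) :=
  caratheodory_type (mu_ext (borel_volume R n)).

Definition volume (R : realType) (n : nat) : set (lebesgueV R n) -> \bar R :=
  @completed_measure_extension _ _ _ (borel_volume R n).

Arguments volume : clear implicits.

HB.instance Definition _ (R : realType) (n : nat) :=
  Measurable.on (lebesgueV R n).
HB.instance Definition _ (R : realType) (n : nat) :=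
  Measure.on (volume R n).

Lemma volume_sigma_finite (R : realType) (n : nat) :
  sigma_finite [set: lebesgueV R n] (volume R n).
Proof. exact/completed_measure_extension_sigma_finite/sigma_finiteT. Qed.

HB.instance Definition _ (R : realType) (n : nat) :=
  @isSigmaFinite.Build _ _ _ (volume R n) (@volume_sigma_finite R n).

(** Variable Lebesgue spaces.  [lpower t q] is t ^ q for t in [0, +oo] and an
    exponent q in [1, +oo]; as usual t ^ +oo is 0 for t <= 1 and +oo for t > 1
    (the value at q = -oo is junk). *)

Definition lpower (R : realType) (t q : \bar R) : \bar R :=
  match q with
  | r%:E => poweR t r
  | +oo%E => if (t <= 1)%E then 0%E else +oo%E
  | -oo%E => 0%E
  end.

Definition modular (R : realType) (n : nat) (p g : 'rV[R]_n -> \bar R) :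
    \bar R :=
  (\int[volume R n]_x lpower (g x) (p x))%E.

Definition vlnorm (R : realType) (n : nat) (p g : 'rV[R]_n -> \bar R) :
    \bar R :=
  ereal_inf [set l%:E | l in
    [set l : R | 0 < l /\ (modular p (fun x => g x / l%:E) <= 1)%E]].

Definition cmodulus (R : realType) (n : nat) (f : 'rV[R]_n -> R[i]) :
    'rV[R]_n -> \bar R :=
  fun x => (Normc.normc (f x))%:E.

(** Lebesgue measurability of a complex-valued function is that of its real and
    imaginary parts. *)

Definition cmeasurable (R : realType) (n : nat) (f : 'rV[R]_n -> R[i]) : Prop :=
  measurable_fun [set: lebesgueV R n] (fun x => complex.Re (f x)) /\
  measurable_fun [set: lebesgueV R n] (fun x => complex.Im (f x)).

Definition vlspace (R : realType) (n : nat) (p : 'rV[R]_n -> \bar R) :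
    set ('rV[R]_n -> R[i]) :=
  [set f | cmeasurable f /\ (vlnorm p (cmodulus f) < +oo)%E].

Definition average (R : realType) (n : nat) (f : 'rV[R]_n -> R[i])
    (B : set 'rV[R]_n) : \bar R :=
  ((volume R n B)^-1 * \int[volume R n]_(y in B) cmodulus f y)%E.

(** Euclidean balls are taken open; the norm of 'rV[R]_n in the library is the
    sup norm, hence the explicit formula. *)

Definition eball (R : realType) (n : nat) (c : 'rV[R]_n) (r : R) :
    set 'rV[R]_n :=
  [set y | Num.sqrt (\sum_i (y 0 i - c 0 i) ^+ 2) < r].

Definition maximal (R : realType) (n : nat) (f : 'rV[R]_n -> R[i])
    (x : 'rV[R]_n) : \bar R :=
  ereal_sup [set average f (eball z.1 z.2) | z in
    [set z : 'rV[R]_n * R | 0 < z.2 /\ eball z.1 z.2 x]].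

Definition maximal_bounded (R : realType) (n : nat) (p : 'rV[R]_n -> \bar R) :
    Prop :=
  exists C : R, 0 < C /\ forall f, vlspace p f ->
    (vlnorm p (maximal f) <= C%:E * vlnorm p (cmodulus f))%E.

(** [dyadic_cube t k m] is 2^-k ([0,1[^n + m + (-1)^k t). *)

Definition dyadic_cube (R : realType) (n : nat) (t : 'rV[R]_n) (k : int)
    (m : 'rV[int]_n) : set 'rV[R]_n :=
  [set (2 : R) ^ (- k) *: (u + map_mx intr m + (-1 : R) ^ k *: t) | u in
    [set u : 'rV[R]_n | forall i, 0 <= u 0 i < 1]].

Definition dyadic_grid (R : realType) (n : nat) (t : 'rV[R]_n) :
    set (set 'rV[R]_n) :=
  [set dyadic_cube t z.1 z.2 | z in [set: int * 'rV[int]_n]].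

Definition adjacent_cubes (R : realType) (n : nat) : set (set 'rV[R]_n) :=
  \bigcup_(t in [set t : 'rV[R]_n |
                 forall i, t 0 i \in [:: 0; 1 / 3; 2 / 3]]) dyadic_grid t.

Arguments adjacent_cubes : clear implicits.

Definition averaging (R : realType) (n : nat) (QQ : set (set 'rV[R]_n))
    (f : 'rV[R]_n -> R[i]) (x : 'rV[R]_n) : \bar R :=
  (\esum_(Q in QQ) (average f Q * (\1_Q x)%:E))%E.

(* Main.v *)
Require Import Defs.
From mathcomp Require Import all_boot all_order all_algebra.
From mathcomp Require Import all_classical all_reals all_analysis.
From mathcomp Require Import measurable_realfun ess_sup_inf.
From mathcomp Require Import complex.
From mathcomp Require Import zify ring lra.

(** One direction is elementary: a cube lies in a ball of comparable volume
    around each of its points, so every averaging operator is dominated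
    pointwise by the maximal operator ([averaging_le_maximal]).

    For the other one, each ball lies in a cube of comparable volume from one
    of finitely many grids ([ball_in_cube]), so it suffices to bound dyadic
    maximal operators. A grid is treated abstractly, as a measure space with
    nested partitions into cells. A disjoint family of cells is a stopping time
    [tau], its averaging operator is a conditional expectation [E_tau], and the
    hypothesis says that [rho f <= 1] implies [rho (E_tau f / C) <= 1] for all
    [tau], where [rho] is the modular. Call the integral of [t ^ p] over a set
    its mass at height [t]. Applied to the largest cells on which the average
    of [f / C] exceeds [t], the hypothesis gives the weak-type inequality: they
    have mass at most [1] at height [t]. The maximal operator needs the sum of
    these masses over all dyadic [t], so a gain is required at most heights.

    Self-improvement. If each family of a chain fills at most half of every
    member of the previous one, then testing the hypothesis on the differences
    shows that mass and averages decay geometrically along the chain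
    ([chain_mass_decay], [rho_chain_decay]). For the chains obtained by
    Calderon-Zygmund selection this yields, as in Gehring's lemma, a reverse
    Hoelder inequality for the weights [t ^ p] ([reverse_hoelder]), and the
    hypothesis for means of an order larger than [1] in place of averages
    ([left_open]).

    Good and bad cells. A cell is good at height [t] if a certain modular
    inequality, with exponent [p / kap] for some [kap > 1], holds on that cell
    alone. Summed over good cells, it bounds their mass at height [t] by the
    integral of [(t / 2 f) ^ (1 - 1 / kap) * (2 f) ^ p] over the set where
    [2 f > t], and this is summable over dyadic [t] ([good_part_mass]). For a
    family of bad cells, the extremal functions of the failing inequalities are
    fed into the improved hypothesis: if the family has mass at most [2], it
    has mass at most [1/2] ([bad_mass]). Hence a cell of mass between [1] and
    [2] is good, and bad cells of individual mass at most [1] have total mass at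
    most [1/2] ([bad_total]). Since goodness interpolates with height [1]
    ([good_powR]), the selected cells are all good for [t >= 1]; for [t < 1] the
    bad ones have individual mass at most [1] even at height [t ^ (1 / kap)], so
    their mass at height [t] is at most a power of [t] ([bad_part_mass]). Both
    contributions are geometric series ([level_sum_bound]).

    Finally, the level sums of the grids, restricted to finitely many heights
    and to generations from [- k] on, dominate the maximal function as [k]
    grows, and Fatou's lemma concludes ([maximal_modular]). *)

Set Implicit Arguments.
Unset Strict Implicit.
Unset Printing Implicit Defensive.

Import Order.TTheory GRing.Theory Num.Theory.
Import numFieldNormedType.Exports.

Local Open Scope classical_set_scope.
Local Open Scope ring_scope.

(** * Cells, stopping times and conditional expectations *)
Module Cells.

Section lower_integral.
Context d (X : measurableType d) (R : realType).
Variable mu : {measure set X -> \bar R}.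

(** The integral of a nonnegative function is a supremum over the simple
    functions below it, so monotonicity needs no measurability; maximal
    functions are integrated in this sense below. *)
Lemma le_ge0_integral (D : set X) (f g : X -> \bar R) :
  (forall x, D x -> (0 <= f x)%E) -> (forall x, D x -> (f x <= g x)%E) ->
  (\int[mu]_(x in D) f x <= \int[mu]_(x in D) g x)%E.
Proof.
move=> f0 fg; have g0 x : D x -> (0 <= g x)%E.
  by move=> Dx; exact: le_trans (f0 _ Dx) (fg _ Dx).
rewrite !ge0_integralE//; apply: le_ereal_sup => _ [h /= hf <-].
exists h => //= x; apply: (le_trans (hf x)); rewrite !patchE.
by case: ifPn => // /set_mem Dx; exact: fg.
Qed.

(** Countable additivity, as the limit of the finite partial sums. *)
Lemma integral_bigcup_le (D : set X) (F : (set X)^nat) (f : X -> \bar R)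
    (c : \bar R) :
  (forall k, measurable (F k)) -> trivIset setT F -> D = \bigcup_k F k ->
  measurable_fun D f -> (forall x, D x -> (0 <= f x)%E) ->
  (forall m, (\int[mu]_(x in \big[setU/set0]_(0 <= k < m) F k) f x <= c)%E) ->
  (\int[mu]_(x in D) f x <= c)%E.
Proof.
move=> mF tF DE mf f0 bd; rewrite DE in mf f0 *.
rewrite ge0_integral_bigcup//; apply: lime_le.
  by apply: is_cvg_nneseries => n _ _; apply: integral_ge0 => x Fx;
    apply: f0; exists n.
apply: nearW => m; rewrite -ge0_integral_bigsetU//.
- exact: iota_uniq.
- by move=> i j _ _ ij; apply: tF.
- apply: measurable_funS mf; first exact: bigcup_measurable.
  by rewrite big_mkord -bigcup_mkord => x [k _ Fx]; exists k.
- by rewrite big_mkord -bigcup_mkord => x [k _ Fx]; apply: f0; exists k.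
Qed.

Lemma integral_addR (D : set X) (f g : X -> R) : measurable D ->
  measurable_fun setT f -> measurable_fun setT g ->
  (forall x, 0 <= f x) -> (forall x, 0 <= g x) ->
  (\int[mu]_(x in D) (f x + g x)%R%:E =
   \int[mu]_(x in D) (f x)%:E + \int[mu]_(x in D) (g x)%:E)%E.
Proof.
move=> mD mf mg f0 g0; rewrite -ge0_integralD//.
- by move=> x _; rewrite lee_fin.
- by apply: measurable_funTS; exact/measurable_EFinP.
- by move=> x _; rewrite lee_fin.
- by apply: measurable_funTS; exact/measurable_EFinP.
Qed.

Lemma integral_scaleR (D : set X) (c : R) (f : X -> R) : measurable D ->
  measurable_fun setT f -> (forall x, 0 <= f x) -> 0 <= c ->
  (\int[mu]_(x in D) (c * f x)%R%:E = c%:E * \int[mu]_(x in D) (f x)%:E)%E.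
Proof.
move=> mD mf f0 c0; rewrite -ge0_integralZl//.
- by apply: measurable_funTS; exact/measurable_EFinP.
- by move=> x _; rewrite lee_fin.
Qed.

End lower_integral.

Section cells.
Context d (X : measurableType d) (R : realType).
Variable mu : {measure set X -> \bar R}.

Definition avg (Q : set X) (f : X -> R) : R :=
  (fine (mu Q))^-1 * \int[mu]_(x in Q) f x.

Section avg_theory.
Variable Q : set X.
Hypotheses (mQ : measurable Q) (Q_gt0 : (0 < mu Q)%E) (Q_fin : (mu Q < +oo)%E).

Lemma fine_gt0Q : 0 < fine (mu Q).
Proof. by apply: fine_gt0; rewrite Q_gt0. Qed.

Lemma fineQ : (fine (mu Q))%:E = mu Q.
Proof. by rewrite fineK// gt0_fin_numE. Qed.

Lemma bounded_integrable (f : X -> R) b : measurable_fun setT f ->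
  (forall x, Q x -> 0 <= f x <= b) -> mu.-integrable Q (EFin \o f).
Proof.
move=> mf fb; apply: measurable_bounded_integrable => //.
  exact: measurable_funTS.
exists b; split; first exact: num_real.
move=> M bM x /= Qx; have /andP[f0 fx] := fb _ Qx.
by rewrite ger0_norm// (le_trans fx)// ltW.
Qed.

Lemma avg_ge0 (f : X -> R) : (forall x, Q x -> 0 <= f x) -> 0 <= avg Q f.
Proof.
move=> f0; apply: mulr_ge0; first by rewrite invr_ge0 fine_ge0.
exact: Rintegral_ge0.
Qed.

Lemma eq_avg (f g : X -> R) : (forall x, Q x -> f x = g x) -> avg Q f = avg Q g.
Proof.
by move=> fg; congr (_ * _); apply: eq_Rintegral => x /set_mem; exact: fg.
Qed.

Lemma le_avg (f g : X -> R) : mu.-integrable Q (EFin \o f) ->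
  mu.-integrable Q (EFin \o g) -> (forall x, Q x -> f x <= g x) ->
  avg Q f <= avg Q g.
Proof.
move=> mf mg fg; rewrite ler_wpM2l ?invr_ge0 ?fine_ge0//.
exact: le_Rintegral.
Qed.

Lemma avg_cst (c : R) : avg Q (fun=> c) = c.
Proof.
rewrite /avg Rintegral_cst// mulrCA mulVf ?mulr1// lt0r_neq0//.
exact: fine_gt0Q.
Qed.

Lemma avgZ (c : R) (f : X -> R) : mu.-integrable Q (EFin \o f) ->
  avg Q (fun x => c * f x) = c * avg Q f.
Proof. by move=> mf; rewrite /avg RintegralZl// mulrCA. Qed.

Lemma avgD (f g : X -> R) : mu.-integrable Q (EFin \o f) ->
  mu.-integrable Q (EFin \o g) ->
  avg Q (fun x => f x + g x) = avg Q f + avg Q g.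
Proof. by move=> mf mg; rewrite /avg RintegralD// mulrDr. Qed.

Lemma integral_avg (f : X -> R) : mu.-integrable Q (EFin \o f) ->
  (\int[mu]_(x in Q) (f x)%:E = (avg Q f)%:E * mu Q)%E.
Proof.
move=> intf; rewrite -fineQ -EFinM /avg mulrAC mulVf ?mul1r; last first.
  by rewrite lt0r_neq0// fine_gt0Q.
by rewrite fineK//; exact: integrable_fin_num.
Qed.

End avg_theory.

Variable lab : nat -> X -> nat.

(** A system of nested partitions is given by labels: the cells of
    generation [i] are the fibres of [lab i]. *)
Definition cell i x : set X := [set y | lab i y = lab i x].

Lemma cell_refl i x : cell i x x. Proof. by []. Qed.

Lemma eq_cell i x y : cell i x y -> cell i y = cell i x.
Proof. by rewrite /cell/= => ->. Qed.

Record cell_partition : Prop := CellPartition {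
  cell_meas : forall i k, measurable (lab i @^-1` [set k]);
  cell_gt0 : forall i x, (0 < mu (cell i x))%E;
  cell_fin : forall i x, (mu (cell i x) < +oo)%E }.

(** A disjoint family of cells is encoded by the map which sends a point of a
    member to the generation of that member, and any other point to [None]. *)
Definition stopping (tau : X -> option nat) :=
  forall x y i, tau x = Some i -> cell i x y -> tau y = Some i.

Definition dom (tau : X -> option nat) : set X := [set x | tau x <> None].

Definition cell_const (tau : X -> option nat) T (phi : X -> T) :=
  forall x y i, tau x = Some i -> cell i x y -> phi y = phi x.

(** The averaging operator of a family of cells. *)
Definition condE (tau : X -> option nat) (f : X -> R) (x : X) : R :=
  if tau x is Some i then avg (cell i x) f else 0.

(** The members of the family, enumerated by (generation, label). *)
Definition piece (tau : X -> option nat) (n : nat) : set X :=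
  if pickle_inv n is Some ik then
    [set x | tau x = Some ik.1 /\ lab ik.1 x = ik.2 :> nat] else set0.

Definition cell_integrable (tau : X -> option nat) (f : X -> R) :=
  forall x i, tau x = Some i -> mu.-integrable (cell i x) (EFin \o f).

Hypothesis labP : cell_partition.

Lemma measurable_cell i x : measurable (cell i x).
Proof. exact: cell_meas labP i (lab i x). Qed.
Local Hint Resolve measurable_cell : core.

Section stopping_theory.
Variable tau : X -> option nat.
Hypothesis tauS : stopping tau.

Lemma pieceP n z : piece tau n z ->
  exists2 i, tau z = Some i & piece tau n = cell i z.
Proof.
rewrite /piece; case: pickle_inv => // -[i k]/= [tz lz].
exists i => //; apply/seteqP; split => y /=.
  by move=> [_ ly]; rewrite /cell/= ly.
by move=> cy; split; [exact: tauS cy|rewrite -lz].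
Qed.

Lemma measurable_piece n : measurable (piece tau n).
Proof.
have [->//|/set0P[z /pieceP[i _ ->]]] := eqVneq (piece tau n) set0.
exact: measurable_cell.
Qed.

Lemma trivIset_piece : trivIset setT (piece tau).
Proof.
move=> m n _ _ [z []]; rewrite /piece.
have := @pickle_invK (nat * nat)%type m.
have := @pickle_invK (nat * nat)%type n.
case: (pickle_inv m) => [[i k]|//]; case: (pickle_inv n) => [[j l]|//] /=.
move=> <- <- [ti <-] [tj <-]; move: tj; rewrite ti => -[->].
by [].
Qed.

Lemma bigcup_piece : dom tau = \bigcup_n piece tau n.
Proof.
apply/seteqP; split => x; last first.
  by move=> [n _ pn]; have [i ti _] := pieceP pn; rewrite /dom/= ti.
rewrite /dom/=; case tx : (tau x) => [i|//] _.
by exists (pickle (i, lab i x)) => //; rewrite /piece pickleK_inv.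
Qed.

Lemma measurable_dom : measurable (dom tau).
Proof.
by rewrite bigcup_piece; apply: bigcup_measurable => n _; exact: measurable_piece.
Qed.

Lemma measurable_cell_const (phi : X -> R) : cell_const tau phi ->
  measurable_fun (dom tau) phi.
Proof.
move=> cphi; rewrite bigcup_piece; apply/measurable_fun_bigcup.
  exact: measurable_piece.
move=> n; have [->|/set0P[z pz]] := eqVneq (piece tau n) set0.
  exact: measurable_fun_set0.
have [i tz ->] := pieceP pz.
apply: (eq_measurable_fun (cst (phi z))) => [y /set_mem cy|]; last first.
  exact: measurable_cst.
by rewrite /= (cphi _ _ _ tz cy).
Qed.

(** There are countably many members, and the function is constant on each. *)
Lemma measurable_cell_const0 (phi : X -> R) : cell_const tau phi ->
  (forall x, tau x = None -> phi x = 0) -> measurable_fun setT phi.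
Proof.
move=> cphi phi0; rewrite (_ : phi = phi \_ (dom tau)).
  apply/(measurable_restrictT _ measurable_dom).
  exact: measurable_cell_const.
apply/funext => x; rewrite patchE; case: ifPn => // /negP xd.
apply: phi0; case tx : (tau x) => [i|//]; exfalso; apply: xd.
by apply/mem_set; rewrite /dom /= tx.
Qed.

Lemma cell_const_condE (f : X -> R) : cell_const tau (condE tau f).
Proof.
by move=> x y i tx cy; rewrite /condE (tauS tx cy) tx (eq_cell cy).
Qed.

Lemma measurable_condE (f : X -> R) : measurable_fun setT (condE tau f).
Proof.
apply: measurable_cell_const0; first exact: cell_const_condE.
by move=> x; rewrite /condE => ->.
Qed.

Lemma condE_ge0 (f : X -> R) x : (forall x, 0 <= f x) -> 0 <= condE tau f x.
Proof. by move=> f0; rewrite /condE; case: tau => // i; exact: avg_ge0. Qed.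

Lemma le_integral_cells (f g : X -> R) :
  measurable_fun setT f -> measurable_fun setT g ->
  (forall x, 0 <= f x) -> (forall x, 0 <= g x) ->
  (forall x i, tau x = Some i ->
    (\int[mu]_(y in cell i x) (f y)%:E <= \int[mu]_(y in cell i x) (g y)%:E)%E) ->
  (\int[mu]_(y in dom tau) (f y)%:E <= \int[mu]_(y in dom tau) (g y)%:E)%E.
Proof.
move=> mf mg f0 g0 fg; rewrite bigcup_piece !ge0_integral_bigcup//.
- apply: lee_nneseries => [n _ _|n _].
    by apply: integral_ge0 => x _; rewrite lee_fin.
  have [->|/set0P[z pz]] := eqVneq (piece tau n) set0.
    by rewrite !integral_set0.
  by have [i tz ->] := pieceP pz; exact: fg.
- exact: measurable_piece.
- by apply: measurable_funTS; exact/measurable_EFinP.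
- by move=> x _; rewrite lee_fin.
- exact: trivIset_piece.
- exact: measurable_piece.
- by apply: measurable_funTS; exact/measurable_EFinP.
- by move=> x _; rewrite lee_fin.
- exact: trivIset_piece.
Qed.

(** The adjointness of conditional expectation: on each member [phi] is a
    constant and can be pulled out; then sum over the members. *)
Lemma integral_condE (phi f : X -> R) : measurable_fun setT f ->
  (forall x, 0 <= f x) -> (forall x, 0 <= phi x) -> cell_const tau phi ->
  cell_integrable tau f ->
  (\int[mu]_(x in dom tau) (phi x * condE tau f x)%:E =
   \int[mu]_(x in dom tau) (phi x * f x)%:E)%E.
Proof.
move=> mf f0 phi0 cphi intf.
have mphi := measurable_cell_const cphi.
rewrite bigcup_piece in mphi *; rewrite !ge0_integral_bigcup//.
- apply: eq_eseriesr => n _.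
  have [->|/set0P[z pz]] := eqVneq (piece tau n) set0.
    by rewrite !integral_set0.
  have [i tz ->] := pieceP pz.
  transitivity (\int[mu]_(x in cell i z) (phi z * avg (cell i z) f)%:E)%E.
    apply: eq_integral => x /set_mem cx.
    by rewrite (cphi _ _ _ tz cx) /condE (tauS tz cx) (eq_cell cx).
  rewrite integral_cst// EFinM -muleA -integral_avg//.
  + rewrite -ge0_integralZl//.
    * apply: eq_integral => x /set_mem cx.
      by rewrite (cphi _ _ _ tz cx) EFinM.
    * by apply: measurable_funTS; exact/measurable_EFinP.
    * by move=> x _; rewrite lee_fin.
    * by rewrite lee_fin.
  + exact: (cell_gt0 labP).
  + exact: (cell_fin labP).
  + exact: intf.
- exact: measurable_piece.
- by apply/measurable_EFinP/measurable_funM => //; exact: measurable_funTS.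
- by move=> x _; rewrite lee_fin mulr_ge0.
- exact: trivIset_piece.
- exact: measurable_piece.
- apply/measurable_EFinP/measurable_funM => //.
  by apply: measurable_funTS; exact: measurable_condE.
- by move=> x _; rewrite lee_fin mulr_ge0// condE_ge0.
- exact: trivIset_piece.
Qed.

Lemma integral_condE1 (f : X -> R) : measurable_fun setT f ->
  (forall x, 0 <= f x) -> cell_integrable tau f ->
  (\int[mu]_(x in dom tau) (condE tau f x)%:E = \int[mu]_(x in dom tau) (f x)%:E)%E.
Proof.
move=> mf f0 intf.
transitivity (\int[mu]_(x in dom tau) (1 * condE tau f x)%R%:E)%E.
  by under [RHS]eq_integral do rewrite mul1r.
rewrite (integral_condE (phi := fun=> 1))//.
by under eq_integral do rewrite mul1r.
Qed.

End stopping_theory.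
End cells.

End Cells.
Export Cells.

(** * The modular and the averaging hypothesis *)
Module Exponent.

Section powR_extra.
Context {R : realType}.
Implicit Types (a b c x y p q : R).

Lemma ge1_powRM c y p q : 1 <= c -> 0 <= y -> p <= q ->
  (c * y) `^ p <= c `^ q * y `^ p.
Proof.
move=> c1 y0 pq; rewrite powRM//; last exact: le_trans c1.
by rewrite ler_wpM2r ?powR_ge0//; apply: ler_powR.
Qed.

Lemma le1_powRM c y p q : 0 <= c <= 1 -> 0 <= y -> 0 < q -> q <= p ->
  (c * y) `^ p <= c `^ q * y `^ p.
Proof.
move=> /andP[c0 c1] y0 q0 qp; rewrite powRM// ler_wpM2r ?powR_ge0//.
move: c0; rewrite le_eqVlt => /predU1P[<-|c0].
  by rewrite !powR0// gt_eqF// (lt_le_trans q0).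
by apply: ger_powR => //; rewrite c0 c1.
Qed.

Lemma le_addr1_powR y p : 1 <= p -> 0 <= y -> y <= 1 + y `^ p.
Proof.
move=> p1 y0; have [y1|y1] := leP y 1.
  by apply: (le_trans y1); rewrite lerDl powR_ge0.
by apply: (@le_trans _ _ (y `^ p)); [exact: le1r_powR (ltW y1) p1|rewrite lerDr].
Qed.

Lemma ler_powRl p x y : 0 <= p -> 0 <= x -> x <= y -> x `^ p <= y `^ p.
Proof.
by move=> p0 x0 xy; apply: ge0_ler_powR => //; rewrite nnegrE// (le_trans x0).
Qed.

Lemma powRV x p : 0 < x -> (x^-1) `^ p = (x `^ p)^-1.
Proof. by move=> x0; rewrite -powR_inv1 ?(ltW x0)// -powRrM mulN1r powRN. Qed.

Lemma powRK x p : 0 <= x -> p != 0 -> (x `^ p) `^ (p^-1) = x.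
Proof. by move=> x0 p0; rewrite -powRrM mulfV// powRr1. Qed.

Lemma powRVK x p : 0 <= x -> p != 0 -> (x `^ (p^-1)) `^ p = x.
Proof. by move=> x0 p0; rewrite -powRrM mulVf// powRr1. Qed.

End powR_extra.

Lemma measurable_fun_powR2 d (X : measurableType d) (R : realType)
    (f g : X -> R) : measurable_fun setT f -> measurable_fun setT g ->
  measurable_fun setT (fun x => f x `^ g x).
Proof.
move=> mf mg; rewrite /powR; apply: measurable_fun_ifT.
- by apply: measurable_fun_eqr.
- apply: (measurableT_comp (f := fun b : bool => (b : nat)%:R : R)) => //.
  by apply: measurable_fun_eqr.
- apply: measurableT_comp => //; apply: measurable_funM => //.
  exact: measurableT_comp.
Qed.

Record bounded_exponent d (X : measurableType d) (R : realType) (p : X -> R)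
    (pm pP : R) : Prop := BoundedExponent {
  be_meas : measurable_fun setT p;
  be_gt1 : 1 < pm;
  be_ge : forall x, pm <= p x;
  be_le : forall x, p x <= pP }.

Section modular.
Context d (X : measurableType d) (R : realType).
Variable mu : {measure set X -> \bar R}.
Variables (p : X -> R) (pm pP : R).
Hypothesis pA : bounded_exponent p pm pP.
Let mp := be_meas pA.
Let pm_gt1 := be_gt1 pA.
Let pm_le := be_ge pA.
Let p_le := be_le pA.

Implicit Types (f g : X -> R) (c : R).

Definition rho (g : X -> R) : \bar R := (\int[mu]_x (g x `^ p x)%R%:E)%E.

Lemma p_gt1 x : 1 < p x. Proof. exact: lt_le_trans (pm_le x). Qed.

Lemma p_gt0 x : 0 < p x. Proof. exact: lt_trans ltr01 (p_gt1 x). Qed.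

Lemma pP_gt1 : X -> 1 < pP.
Proof. by move=> x; exact: lt_le_trans (p_gt1 x) (p_le x). Qed.

Lemma measurable_rho g : measurable_fun setT g ->
  measurable_fun setT (fun x => (g x `^ p x)%R%:E).
Proof. by move=> mg; apply/measurable_EFinP; exact: measurable_fun_powR2. Qed.

Lemma le_rho f g : (forall x, 0 <= f x) -> (forall x, f x <= g x) ->
  (rho f <= rho g)%E.
Proof.
move=> f0 fg; apply: le_ge0_integral => x _; rewrite lee_fin ?powR_ge0//.
by apply: ler_powRl => //; exact/ltW/p_gt0.
Qed.

Lemma rhoZ_ge1 c g : 1 <= c -> measurable_fun setT g -> (forall x, 0 <= g x) ->
  (rho (fun x => c * g x)%R <= (c `^ pP)%R%:E * rho g)%E.
Proof.
move=> c1 mg g0; rewrite -ge0_integralZl//; last 3 first.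
- exact: measurable_rho.
- by move=> x _; rewrite lee_fin powR_ge0.
- by rewrite lee_fin powR_ge0.
apply: le_ge0_integral => x _; first by rewrite lee_fin powR_ge0.
by rewrite -EFinM lee_fin ge1_powRM.
Qed.

Lemma rhoZ_le1 c g : 0 <= c <= 1 -> measurable_fun setT g ->
  (forall x, 0 <= g x) ->
  (rho (fun x => c * g x)%R <= (c `^ pm)%R%:E * rho g)%E.
Proof.
move=> c1 mg g0; rewrite -ge0_integralZl//; last 3 first.
- exact: measurable_rho.
- by move=> x _; rewrite lee_fin powR_ge0.
- by rewrite lee_fin powR_ge0.
apply: le_ge0_integral => x _; first by rewrite lee_fin powR_ge0.
by rewrite -EFinM lee_fin le1_powRM// (lt_trans _ pm_gt1).
Qed.

(** For large constants the modular is controlled by the power [pP] of the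
    constant, and the next lemma shows that a bound [L] on the modular bounds
    the norm by [L ^ (1/pm)] only. *)
Lemma rho_le_of_scaled c g : 1 <= c -> measurable_fun setT g ->
  (forall x, 0 <= g x) -> (rho (fun x => g x / c)%R <= 1)%E ->
  (rho g <= (c `^ pP)%R%:E)%E.
Proof.
move=> c1 mg g0 h; have c0 : 0 < c by exact: lt_le_trans c1.
rewrite (_ : g = fun x => c * (g x / c)); last first.
  by apply/funext => x; rewrite mulrC divfK// gt_eqF.
apply: (le_trans (rhoZ_ge1 _ _ _)) => //.
- by apply: measurable_funM.
- by move=> x; rewrite divr_ge0// ltW.
- by rewrite -[leRHS]mule1 lee_wpmul2l// lee_fin powR_ge0.
Qed.

(** That [L ^ (1/pm)] grows more slowly than [L] is where [pm > 1] enters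
    the argument, see [rho_chain_step]. *)
Lemma rho_scaled_le1 (L : R) g : 1 <= L -> measurable_fun setT g ->
  (forall x, 0 <= g x) -> (rho g <= L%:E)%E ->
  (rho (fun x => g x / (L `^ pm^-1))%R <= 1)%E.
Proof.
move=> L1 mg g0 h; have L0 : 0 < L by exact: lt_le_trans L1.
have Lp0 : 0 < L `^ pm^-1 by rewrite powR_gt0.
have pm0 : 0 < pm by exact: lt_trans pm_gt1.
rewrite (_ : (fun _ => _) = fun x => (L `^ pm^-1)^-1 * g x); last first.
  by apply/funext => x; rewrite mulrC.
apply: (le_trans (rhoZ_le1 _ _ _)) => //.
  rewrite invr_ge0 powR_ge0 invf_le1//=.
  by rewrite -(powRr0 L) ler_powR// invr_ge0 ltW.
rewrite powRV// powRVK ?(ltW L0) ?gt_eqF//.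
apply: (@le_trans _ _ (L^-1%R%:E * L%:E)%E).
  by apply: lee_wpmul2l => //; rewrite lee_fin invr_ge0 ltW.
by rewrite -EFinM mulVf// gt_eqF.
Qed.

(** On a set of finite measure, use [t <= 1 + t ^ p]. *)
Lemma rho_integrable (Q : set X) g : measurable Q -> (mu Q < +oo)%E ->
  measurable_fun setT g -> (forall x, 0 <= g x) -> (rho g < +oo)%E ->
  mu.-integrable Q (EFin \o g).
Proof.
move=> mQ Qoo mg g0 rg; apply/integrableP; split.
  by apply: measurable_funTS; exact/measurable_EFinP.
apply: (@le_lt_trans _ _ (\int[mu]_(x in Q) (1 + (g x `^ p x)%R%:E))%E).
  apply: le_ge0_integral => x _; first by [].
  rewrite /= ger0_norm// -EFinD lee_fin le_addr1_powR//.
  exact/ltW/p_gt1.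
rewrite ge0_integralD//; last 2 first.
- by move=> x _; rewrite lee_fin powR_ge0.
- by apply: measurable_funTS; exact: measurable_rho.
rewrite integral_cst// mul1e lte_add_pinfty//.
apply: le_lt_trans rg; apply: ge0_subset_integral => //.
- exact: measurable_rho.
- by move=> x _; rewrite lee_fin powR_ge0.
Qed.

Variable lab : nat -> X -> nat.
Hypothesis labP : cell_partition mu lab.
Local Notation condE := (condE mu lab).
Local Notation avg := (avg mu).
Let mcell := measurable_cell labP.
Local Hint Resolve mcell : core.

Lemma rho_cell_integrable tau g : measurable_fun setT g ->
  (forall x, 0 <= g x) -> (rho g < +oo)%E -> cell_integrable mu lab tau g.
Proof.
by move=> mg g0 rg x i _; apply: rho_integrable => //; exact: (cell_fin labP).
Qed.

Lemma rho_cell_integrable1 i x g : measurable_fun setT g ->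
  (forall x, 0 <= g x) -> (rho g < +oo)%E ->
  mu.-integrable (cell lab i x) (EFin \o g).
Proof.
move=> mg g0 rg; apply: (rho_integrable (mcell i x) _ mg g0 rg).
exact: (cell_fin labP).
Qed.

Lemma condEZ tau c g x : cell_integrable mu lab tau g ->
  condE tau (fun x => c * g x) x = c * condE tau g x.
Proof.
move=> ig; rewrite /Cells.condE; case tx : (tau x) => [i|]; last by rewrite mulr0.
by rewrite avgZ//; exact: ig.
Qed.

(** Uniform boundedness of the averaging operators, stated on the unit ball,
    where norm and modular agree. *)
Record averages_bounded (C : R) : Prop := AveragesBounded {
  ab_ge1 : 1 <= C;
  ab_le1 : forall tau (f : X -> R), stopping lab tau ->
    measurable_fun setT f -> (forall x, 0 <= f x) -> (rho f <= 1)%E ->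
    (rho (fun x => condE tau f x / C)%R <= 1)%E }.

Section bounded.
Variable C : R.
Hypothesis bdd : averages_bounded C.
Let C_ge1 := ab_ge1 bdd.

Lemma averages_norm tau f c : stopping lab tau -> measurable_fun setT f ->
  (forall x, 0 <= f x) -> 0 < c -> (rho f < +oo)%E ->
  (rho (fun x => f x / c)%R <= 1)%E ->
  (rho (fun x => condE tau f x / (C * c))%R <= 1)%E.
Proof.
move=> tS mf f0 c0 fo fc.
have mfc : measurable_fun setT (fun x => f x / c) by exact: measurable_funM.
have fc0 x : 0 <= f x / c by rewrite divr_ge0// ltW.
have := ab_le1 bdd tS mfc fc0 fc.
suff -> : (fun x => condE tau (fun y => f y / c) x / C) =
  (fun x => condE tau f x / (C * c)) by [].
apply/funext => x; rewrite (_ : (fun x => f x / c) = fun x => c^-1 * f x).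
  by rewrite condEZ ?invfM; [ring|exact: rho_cell_integrable].
by apply/funext => y; rewrite mulrC.
Qed.

(** [(2 C) f] still has modular at most [1], so [2 E_tau f] has too; removing
    the factor [2] halves the modular because [p >= 1]. *)
Lemma averages_small tau f : stopping lab tau -> measurable_fun setT f ->
  (forall x, 0 <= f x) -> (rho f <= (((2 * C) `^ pP)^-1)%R%:E)%E ->
  (rho (condE tau f) <= 2^-1%R%:E)%E.
Proof.
move=> tS mf f0 rf.
have C0 : 0 < C by exact: lt_le_trans C_ge1.
have fo : (rho f < +oo)%E by apply: le_lt_trans rf _; rewrite ltry.
have h : (rho (fun x => condE tau f x / (C * (2 * C)^-1))%R <= 1)%E.
  apply: averages_norm => //; first by rewrite invr_gt0 mulr_gt0.
  rewrite (_ : (fun _ => _) = fun x => (2 * C) * f x); last first.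
    by apply/funext => x; rewrite invrK mulrC.
  have C2 : 1 <= 2 * C by move: C_ge1; lra.
  apply: (le_trans (rhoZ_ge1 C2 _ _)) => //.
  apply: (@le_trans _ _ (((2 * C) `^ pP)%R%:E * ((2 * C) `^ pP)^-1%R%:E)%E).
    by apply: lee_wpmul2l => //; rewrite lee_fin powR_ge0.
  by rewrite -EFinM mulfV// gt_eqF// powR_gt0// mulr_gt0.
rewrite (_ : condE tau f = fun x => 2^-1 * (condE tau f x / (C * (2 * C)^-1))).
  apply: (le_trans (rhoZ_le1 _ _ _)) => //.
  - by rewrite invr_ge0 ler0n invf_le1 ?ler1n.
  - apply: measurable_funM => //; exact: measurable_condE.
  - by move=> x; rewrite divr_ge0 ?condE_ge0// mulr_ge0 ?invr_ge0 ?mulr_ge0// ltW.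
  apply: (@le_trans _ _ ((2^-1 `^ pm)%R%:E * 1)%E).
    by apply: lee_wpmul2l => //; rewrite lee_fin powR_ge0.
  rewrite mule1 lee_fin; apply: ge1r_powR; last exact: ltW.
  by rewrite invr_gt0 ltr0n invf_le1 ?ler1n.
apply/funext => x; field; exact: lt0r_neq0.
Qed.

End bounded.
End modular.

End Exponent.
Export Exponent.

(** * Sparse chains of families of cells *)

Section indic.
Context d (X : measurableType d) (R : realType).
Variable mu : {measure set X -> \bar R}.

Lemma integral_mul_indic (D Q : set X) (g : X -> R) :
  (\int[mu]_(x in D) (\1_Q x * g x)%R%:E = \int[mu]_(x in D `&` Q) (g x)%:E)%E.
Proof.
rewrite integral_mkcondr; apply: eq_integral => x _.
by rewrite patchE indicE; case: ifP => _; rewrite (mul1r, mul0r).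
Qed.

Lemma measurable_mul_indic (D : set X) (f : X -> R) : measurable D ->
  measurable_fun setT f -> measurable_fun setT (fun x => f x * \1_D x).
Proof. by move=> mD mf; apply: measurable_funM. Qed.

Lemma indic_ge0 (D : set X) x : 0 <= (\1_D x : R).
Proof. by rewrite indicE ler0n. Qed.

Lemma indic_le1 (D : set X) x : (\1_D x : R) <= 1.
Proof. by rewrite indicE lern1 leq_b1. Qed.

Lemma indic_in (D : set X) x : D x -> (\1_D x : R) = 1.
Proof. by move=> Dx; rewrite indicE mem_set. Qed.

Lemma indic_out (D : set X) x : ~ D x -> (\1_D x : R) = 0.
Proof. by move=> Dx; rewrite indicE memNset. Qed.

End indic.

Section chain.
Context d (X : measurableType d) (R : realType).
Variable mu : {measure set X -> \bar R}.
Variables (p : X -> R) (pm pP : R).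
Hypothesis pA : bounded_exponent p pm pP.
Let mp := be_meas pA.
Let pm_gt1 := be_gt1 pA.
Let pm_le := be_ge pA.
Let p_le := be_le pA.
Variable lab : nat -> X -> nat.
Hypothesis labP : cell_partition mu lab.
Local Notation condE := (condE mu lab).
Local Notation avg := (avg mu).
Local Notation cell := (cell lab).
Local Notation rho := (rho mu p).
Let mcell := measurable_cell labP.
Let cgt0 := cell_gt0 labP.
Let cfin := cell_fin labP.
Local Hint Resolve mcell cgt0 cfin : core.
Implicit Types (f g : X -> R) (T : nat -> X -> option nat).

(** Nested families, each filling at most half of every member of the
    previous one. *)
Record sparse_chain T : Prop := SparseChain {
  chain_stop : forall j, stopping lab (T j);
  chain_nest1 : forall j x i, T j.+1 x = Some i ->
    exists2 k, T j x = Some k & cell i x `<=` cell k x;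
  chain_half : forall j x, condE (T j) (\1_(dom (T j.+1))) x <= 2^-1 }.

Lemma chain_nest T j k x i : sparse_chain T -> (j <= k)%N -> T k x = Some i ->
  exists2 l, T j x = Some l & cell i x `<=` cell l x.
Proof.
move=> TP; elim: k i => [|k IH] i.
  by rewrite leqn0 => /eqP-> Ti; exists i.
rewrite leq_eqVlt => /predU1P[-> Ti|]; first by exists i.
rewrite ltnS => jk /(chain_nest1 TP)[m Tm im].
by have [l Tl ml] := IH _ jk Tm; exists l => //; exact: subset_trans ml.
Qed.

Lemma chain_dom T j k : sparse_chain T -> (j <= k)%N ->
  dom (T k) `<=` dom (T j).
Proof.
move=> TP jk x; rewrite /dom/=; case Tk : (T k x) => [i|//] _.
by have [l ->] := chain_nest TP jk Tk.
Qed.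

Lemma chain_shift T m : sparse_chain T -> sparse_chain (fun j => T (m + j)%N).
Proof.
move=> TP; split => [j|j x i|j x].
- exact: chain_stop.
- by rewrite addnS; exact: chain_nest1.
- by rewrite addnS; exact: chain_half.
Qed.

Lemma chain_mdom T j : sparse_chain T -> measurable (dom (T j)).
Proof. by move=> TP; apply: (measurable_dom labP); exact: chain_stop. Qed.

Definition shell T j := dom (T j) `\` dom (T j.+1).

Lemma measurable_shell T j : sparse_chain T -> measurable (shell T j).
Proof. by move=> TP; apply: measurableD; exact: chain_mdom. Qed.

Lemma indic_integrable Q (D : set X) : measurable Q -> (mu Q < +oo)%E ->
  measurable D -> mu.-integrable Q (EFin \o (\1_D : X -> R)).
Proof.
move=> mQ Qoo mD; apply: (bounded_integrable mQ Qoo (b := 1)) => //.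
by move=> x _; rewrite indic_ge0 indic_le1.
Qed.

Lemma chain_shell_half T j x : sparse_chain T -> dom (T j) x ->
  2^-1 <= condE (T j) (\1_(shell T j)) x.
Proof.
move=> TP; rewrite /dom/=; case Tx : (T j x) => [i|//] _.
have := chain_half TP j x; rewrite /Cells.condE Tx => h.
have mD := chain_mdom j.+1 TP; have mS := measurable_shell j TP.
have : avg (cell i x) (fun y => \1_(shell T j) y + \1_(dom (T j.+1)) y) = 1.
  rewrite -[RHS](avg_cst (mcell i x) (cgt0 i x) (cfin i x)).
  apply: eq_avg => y cy; have Dy : dom (T j) y.
    by rewrite /dom/= (chain_stop TP Tx cy).
  have [Dy'|Dy'] := pselect (dom (T j.+1) y).
    by rewrite (indic_in _ Dy') indic_out ?add0r// => -[].
  by rewrite (indic_out _ Dy') indic_in ?addr0.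
rewrite avgD//; last 2 first.
- exact: indic_integrable.
- exact: indic_integrable.
move: h; lra.
Qed.

Lemma integral_condE_on (tau : X -> option nat) (Q : set X) (phi f : X -> R) :
  stopping lab tau -> measurable_fun setT f -> (forall x, 0 <= f x) ->
  (forall x, 0 <= phi x) -> cell_const lab tau phi ->
  cell_const lab tau (\1_Q : X -> R) ->
  cell_integrable mu lab tau f ->
  (\int[mu]_(x in dom tau `&` Q) (phi x * condE tau f x)%R%:E =
   \int[mu]_(x in dom tau `&` Q) (phi x * f x)%R%:E)%E.
Proof.
move=> tS mf f0 phi0 cphi cQ intf.
rewrite -!integral_mul_indic.
under eq_integral do rewrite mulrA.
under [RHS]eq_integral do rewrite mulrA.
apply: (integral_condE labP tS (phi := fun x => \1_Q x * phi x)) => //.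
- by move=> x; rewrite mulr_ge0// indic_ge0.
- by move=> x y i tx cy; rewrite (cQ _ _ _ tx cy) (cphi _ _ _ tx cy).
Qed.

Definition finer (tau sigma : X -> option nat) := forall x i, tau x = Some i ->
  exists2 k, sigma x = Some k & cell i x `<=` cell k x.

(** Cells of the finer family are contained in, or disjoint from, each cell of
    the coarser one. *)
Lemma finer_cell_const tau sigma x k : stopping lab sigma -> finer tau sigma ->
  sigma x = Some k -> cell_const lab tau (\1_(cell k x) : X -> R).
Proof.
move=> sS fts sx y z i ty cz; have [l sy sub] := fts _ _ ty.
have cz' := sub _ cz; have [cy|ncy] := pselect (cell k x y).
  have lk : l = k by move: (sS _ _ _ sx cy); rewrite sy => -[].
  by rewrite !indic_in// -(eq_cell cy) -lk.
rewrite !indic_out// => cxz; apply: ncy.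
have lk : l = k.
  by move: (sS _ _ _ sx cxz); rewrite (sS _ _ _ sy cz') => -[].
by subst l; move: cz' cxz; rewrite /Cells.cell/= => <-.
Qed.

Lemma chain_cell_const T j x i : sparse_chain T -> T 0%N x = Some i ->
  cell_const lab (T j) (\1_(cell i x) : X -> R).
Proof.
move=> TP; apply: finer_cell_const; first exact: chain_stop.
by move=> y k; exact: chain_nest.
Qed.

Lemma integral_cell_dom (Q D : set X) g : (forall x, ~ D x -> g x = 0) ->
  (\int[mu]_(x in Q) (g x)%:E = \int[mu]_(x in D `&` Q) (g x)%:E)%E.
Proof.
move=> g0; rewrite setIC integral_mkcondr; apply: eq_integral => x _.
rewrite patchE; case: ifPn => // /negP xD.
by rewrite g0// => Dx; apply: xD; exact: mem_set.
Qed.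

Lemma condE_out tau f x : ~ dom tau x -> condE tau f x = 0.
Proof. by rewrite /Cells.condE/dom/=; case: tau => // i []. Qed.

Lemma avg_of_integral Q f g : measurable Q -> (0 < mu Q)%E -> (mu Q < +oo)%E ->
  mu.-integrable Q (EFin \o f) -> mu.-integrable Q (EFin \o g) ->
  (\int[mu]_(x in Q) (f x)%:E <= \int[mu]_(x in Q) (g x)%:E)%E ->
  avg Q f <= avg Q g.
Proof.
move=> mQ Q0 Qoo intf intg.
by rewrite !integral_avg// lee_pmul2r ?lee_fin// ?gt0_fin_numE.
Qed.

Lemma rho_indic (D : set X) f : measurable D ->
  (rho (fun x => \1_D x * f x)%R = \int[mu]_(x in D) (f x `^ p x)%R%:E)%E.
Proof.
move=> mD; rewrite /Exponent.rho [RHS]integral_mkcond; apply: eq_integral => x _.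
rewrite patchE indicE; case: ifP => _; rewrite ?mul1r// mul0r powR0//.
by rewrite gt_eqF// (p_gt0 pA).
Qed.

Variable C : R.
Hypothesis bdd : averages_bounded mu p lab C.
Let C_ge1 := ab_ge1 bdd.

(** The number [4 C] combines the height [2 v] of the test function in
    [chain_mass_step] with the [2 C] of [averages_small]. *)
Definition decay_gap : R := ((4 * C) `^ pP)^-1.

(** The shell fills at least half of each member, so averaging [2 v] times its
    indicator returns at least [v] on all of [dom (T j)]. If the shell has mass
    below the gap, [averages_small] makes the whole mass at most [1/2];
    otherwise the next family has lost at least the gap. *)
Lemma chain_mass_step T j v : sparse_chain T -> 0 < v ->
  (\int[mu]_(x in dom (T j)) (v `^ p x)%R%:E <= 1)%E ->
  (\int[mu]_(x in dom (T j.+1)) (v `^ p x)%R%:E <= (1 - decay_gap)%R%:E)%E.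
Proof.
move=> TP v0 mass1.
have pP1 := pP_gt1 pA point.
have mD := chain_mdom j.+1 TP; have mDj := chain_mdom j TP.
have mS := measurable_shell j TP.
have v0' := ltW v0.
have mvp : measurable_fun setT (fun x => (v `^ p x)%:E).
  by apply/measurable_EFinP; exact: measurable_fun_powR2.
have gap_half : decay_gap <= 2^-1.
  rewrite /decay_gap lef_pV2 ?posrE ?powR_gt0//; last by move: C_ge1; lra.
  apply: (@le_trans _ _ (4 * C)); first by move: C_ge1; lra.
  by apply: le1r_powR; [move: C_ge1; lra|exact: ltW].
have gap0 : 0 < decay_gap.
  by rewrite invr_gt0 powR_gt0//; move: C_ge1; lra.
have DE : dom (T j) = shell T j `|` dom (T j.+1).
  by rewrite /shell setUC setDUK//; exact: chain_dom.
have split_mass : (\int[mu]_(x in dom (T j)) (v `^ p x)%R%:E =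
    \int[mu]_(x in shell T j) (v `^ p x)%R%:E +
    \int[mu]_(x in dom (T j.+1)) (v `^ p x)%R%:E)%E.
  rewrite {1}DE ge0_integral_setU//.
  - by apply: measurable_funTS.
  - by move=> x _; rewrite lee_fin powR_ge0.
  - by rewrite disj_set2E /shell setDE -setIA setICl setI0.
have [small|big] := leP (\int[mu]_(x in shell T j) (v `^ p x)%R%:E)%E decay_gap%:E.
  pose f x := \1_(shell T j) x * (2 * v).
  have mf : measurable_fun setT f by exact: measurable_funM.
  have f0 x : 0 <= f x by rewrite mulr_ge0 ?indic_ge0// mulr_ge0.
  have rf : (rho f <= (((2 * C) `^ pP)^-1)%R%:E)%E.
    rewrite (rho_indic (fun=> 2 * v))//.
    apply: (@le_trans _ _ (\int[mu]_(x in shell T j)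
        ((2 `^ pP)%R%:E * (v `^ p x)%R%:E))%E).
      apply: le_ge0_integral => x _; first by rewrite lee_fin powR_ge0.
      by rewrite -EFinM lee_fin ge1_powRM// ler1n.
    rewrite ge0_integralZl//; last 2 first.
    - by apply: measurable_funTS.
    - by move=> x _; rewrite lee_fin powR_ge0.
    apply: (le_trans (lee_wpmul2l _ small)); first by rewrite lee_fin powR_ge0.
    rewrite -EFinM lee_fin /decay_gap.
    rewrite (_ : 4 * C = 2 * (2 * C)); last by ring.
    rewrite (powRM _ (x := 2))//; last by move: C_ge1; lra.
    rewrite invfM mulrA mulfV ?mul1r// gt_eqF// powR_gt0//.
  have tS : stopping lab (T j) by exact: chain_stop.
  have := averages_small pA labP bdd
    tS mf f0 rf.
  move=> h; have {}h : (\int[mu]_(x in dom (T j)) (v `^ p x)%R%:E <= (2^-1)%R%:E)%E.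
    rewrite -(rho_indic (fun=> v) mDj); apply: le_trans h.
    apply: (le_rho mu pA) => x; first by rewrite mulr_ge0 ?indic_ge0.
    have [Dx|Dx] := pselect (dom (T j) x); last first.
      rewrite indic_out// mul0r; apply: condE_ge0 => //.
    rewrite indic_in// mul1r.
    rewrite (_ : f = fun x => (2 * v) * \1_(shell T j) x); last first.
      by apply/funext => y; rewrite /f mulrC.
    rewrite (condEZ labP); last by move=> y i _; exact: indic_integrable.
    have := chain_shell_half TP Dx; set e := Cells.condE _ _ _ _ _ => he.
    by rewrite mulrAC; rewrite ler_peMl//; lra.
  apply: (@le_trans _ _ ((2^-1 : R)%:E)); last by rewrite lee_fin; lra.
  apply: le_trans h; rewrite split_mass leeDr//.
  by apply: integral_ge0 => x _; rewrite lee_fin powR_ge0.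
move: mass1; rewrite split_mass => mass1.
rewrite EFinB leeBrDl//; apply: le_trans mass1.
by rewrite leeD2r// ltW.
Qed.

End chain.

(** * Decay of averages along a sparse chain *)

Section chain_decay.
Context d (X : measurableType d) (R : realType).
Variable mu : {measure set X -> \bar R}.
Variables (p : X -> R) (pm pP : R).
Hypothesis pA : bounded_exponent p pm pP.
Let mp := be_meas pA.
Let pm_gt1 := be_gt1 pA.
Let pm_le := be_ge pA.
Let p_le := be_le pA.
Variable lab : nat -> X -> nat.
Hypothesis labP : cell_partition mu lab.
Local Notation condE := (condE mu lab).
Local Notation avg := (avg mu).
Local Notation cell := (cell lab).
Local Notation rho := (rho mu p).
Local Notation sparse_chain := (sparse_chain mu lab).
Let mcell := measurable_cell labP.
Let cgt0 := cell_gt0 labP.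
Let cfin := cell_fin labP.
Local Hint Resolve mcell cgt0 cfin : core.
Implicit Types (f g : X -> R) (T : nat -> X -> option nat).
Variable C : R.
Hypothesis bdd : averages_bounded mu p lab C.
Let C_ge1 := ab_ge1 bdd.

(** The fraction of the mass lost in each step pays for raising the height by
    the factor [lam]. *)
Lemma chain_mass_decay T t lam j : sparse_chain T -> 0 < t -> 1 <= lam ->
  lam `^ pP * (1 - decay_gap pP C) <= 1 ->
  (\int[mu]_(x in dom (T 0%N)) (t `^ p x)%R%:E <= 1)%E ->
  (\int[mu]_(x in dom (T j)) ((lam ^+ j * t) `^ p x)%R%:E <= 1)%E.
Proof.
move=> TP t0 lam1 hlam mass; have lam0 : 0 < lam by exact: lt_le_trans lam1.
elim: j => [|j IH]; first by under eq_integral do rewrite expr0 mul1r.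
have v0 : 0 < lam ^+ j * t by rewrite mulr_gt0// exprn_gt0.
have mD := chain_mdom labP j.+1 TP.
have := chain_mass_step pA labP bdd TP v0 IH.
move=> h; apply: (@le_trans _ _ (\int[mu]_(x in dom (T j.+1))
  ((lam `^ pP)%R%:E * ((lam ^+ j * t) `^ p x)%R%:E))%E).
  apply: le_ge0_integral => x _; first by rewrite lee_fin powR_ge0.
  by rewrite exprS -mulrA -EFinM lee_fin ge1_powRM// ltW.
rewrite ge0_integralZl//; last 3 first.
- by apply: measurable_funTS; apply/measurable_EFinP; exact: measurable_fun_powR2.
- by move=> x _; rewrite lee_fin powR_ge0.
- by rewrite lee_fin powR_ge0.
apply: (@le_trans _ _ ((lam `^ pP)%R%:E * (1 - decay_gap pP C)%R%:E)%E).
  by apply: lee_wpmul2l => //; rewrite lee_fin powR_ge0.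
by rewrite -EFinM lee_fin.
Qed.

Lemma rho_condE_fin tau f : stopping lab tau -> measurable_fun setT f ->
  (forall x, 0 <= f x) -> (rho f <= 1)%E ->
  (rho (condE tau f) <= (C `^ pP)%R%:E)%E.
Proof.
move=> tS mf f0 rf; apply: (rho_le_of_scaled pA C_ge1).
- exact: (measurable_condE labP).
- by move=> x; exact: condE_ge0.
- exact: (ab_le1 bdd).
Qed.

Lemma fin_le1 (a : \bar R) : (a <= 1)%E -> (a < +oo)%E.
Proof. by move=> /le_lt_trans; apply; rewrite ltry. Qed.

Lemma rho_mul_indic (D : set X) f : (forall x, 0 <= f x) ->
  (rho (fun x => f x * \1_D x)%R <= rho f)%E.
Proof.
move=> f0; apply: (le_rho mu pA) => x.
  by rewrite mulr_ge0// indic_ge0.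
by rewrite ler_piMr// indic_le1.
Qed.

(** The tower property of conditional expectations. *)
Lemma avg_tower T j f x i : sparse_chain T -> measurable_fun setT f ->
  (forall x, 0 <= f x) -> (rho f <= 1)%E -> T 0%N x = Some i ->
  avg (cell i x) (condE (T j) f) = avg (cell i x) (fun y => f y * \1_(dom (T j)) y).
Proof.
move=> TP mf f0 rf Tx; have mD := chain_mdom labP j TP.
have tS : stopping lab (T j) by exact: (chain_stop TP).
congr (_ * fine _).
rewrite (@integral_cell_dom _ _ _ mu _ (dom (T j)) (condE (T j) f)); last first.
  exact: condE_out.
rewrite (@integral_cell_dom _ _ _ mu _ (dom (T j)) (fun y => f y * _)); last first.
  by move=> y Dy; rewrite indic_out// mulr0.
transitivity (\int[mu]_(y in dom (T j) `&` cell i x) (1 * condE (T j) f y)%R%:E)%E.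
  by under [RHS]eq_integral do rewrite mul1r.
rewrite (integral_condE_on labP (phi := cst 1) (Q := cell i x))//.
- by apply: eq_integral => y /set_mem[Dy _]; rewrite /= mul1r indic_in// mulr1.
- exact: (chain_cell_const TP Tx).
- exact: (rho_cell_integrable pA labP mf f0 (fin_le1 rf)).
Qed.

Lemma condE_tower T j f x : sparse_chain T -> measurable_fun setT f ->
  (forall x, 0 <= f x) -> (rho f <= 1)%E ->
  condE (T 0%N) (condE (T j) f) x = condE (T 0%N) (fun y => f y * \1_(dom (T j)) y) x.
Proof.
move=> TP mf f0 rf; rewrite /Cells.condE; case Tx : (T 0%N x) => [i|//].
exact: avg_tower.
Qed.

(** [E_j f] is constant on the members of the [j]-th family, and the shell
    fills at least half of each. *)
Lemma avg_shell T j f x i : sparse_chain T -> measurable_fun setT f ->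
  (forall x, 0 <= f x) -> (rho f <= 1)%E -> T 0%N x = Some i ->
  2^-1 * avg (cell i x) (fun y => f y * \1_(dom (T j)) y) <=
  avg (cell i x) (fun y => \1_(shell T j) y * condE (T j) f y).
Proof.
move=> TP mf f0 rf Tx; rewrite -avg_tower//.
have tS : stopping lab (T j) by exact: (chain_stop TP).
have mE : measurable_fun setT (condE (T j) f) by exact: (measurable_condE labP).
have E0 y : 0 <= condE (T j) f y by exact: condE_ge0.
have mS := measurable_shell labP j TP.
have rE : (rho (condE (T j) f) < +oo)%E.
  by apply: le_lt_trans (rho_condE_fin _ _ _ _) _; rewrite ?ltry.
have iE : mu.-integrable (cell i x) (EFin \o condE (T j) f).
  exact: (rho_cell_integrable1 pA labP i x mE E0 rE).
have mSE : measurable_fun setT (fun y => \1_(shell T j) y * condE (T j) f y).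
  exact: measurable_funM.
rewrite -avgZ//; apply: (avg_of_integral (mu := mu)) => //.
- by have := integrableZl (mcell i x) 2^-1 iE; apply: eq_integrable.
- apply: (rho_cell_integrable1 pA labP i x mSE).
    by move=> y; rewrite mulr_ge0// indic_ge0.
  apply: le_lt_trans rE; apply: (le_rho mu pA) => y.
    by rewrite mulr_ge0// indic_ge0.
  by rewrite ler_piMl// indic_le1.
rewrite (@integral_cell_dom _ _ _ mu _ (dom (T j)) (fun y => 2^-1 * _)); last first.
  by move=> y Dy; rewrite condE_out// mulr0.
rewrite (@integral_cell_dom _ _ _ mu _ (dom (T j)) (fun y => \1_(shell T j) y * _)); last first.
  by move=> y Dy; rewrite condE_out// mulr0.
under [leRHS]eq_integral do rewrite mulrC.
rewrite -(integral_condE_on labP (phi := condE (T j) f) (Q := cell i x)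
  (f := \1_(shell T j)) tS)//.
- apply: le_ge0_integral => y [Dy _]; first by rewrite lee_fin mulr_ge0.
  by rewrite lee_fin mulrC ler_wpM2l//; exact: (chain_shell_half labP TP).
- exact: (cell_const_condE _ tS).
- exact: (chain_cell_const TP Tx).
- by move=> y k _; exact: indic_integrable.
Qed.

(** The average of [f] over the member of the last of the first [J] families
    that still contains the point. *)
Definition shell_sum T f (J : nat) (x : X) : R :=
  \sum_(j < J) \1_(shell T j) x * condE (T j) f x.

Lemma shell_sum_ge0 T f J x : (forall x, 0 <= f x) -> 0 <= shell_sum T f J x.
Proof.
by move=> f0; apply: sumr_ge0 => j _; rewrite mulr_ge0 ?indic_ge0 ?condE_ge0.
Qed.

Lemma shell_sum_dom T f J x : sparse_chain T -> dom (T J) x ->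
  shell_sum T f J x = 0.
Proof.
move=> TP Dx; apply: big1 => j _; rewrite indic_out ?mul0r// => -[_]; apply.
by apply: (chain_dom TP) Dx => //; exact: ltn_ord.
Qed.

Lemma measurable_shell_sum T f J : sparse_chain T ->
  measurable_fun setT (shell_sum T f J).
Proof.
move=> TP; apply: measurable_sum => j; apply: measurable_funM.
  by apply: measurable_indic; exact: (measurable_shell labP).
by apply: (measurable_condE labP); exact: (chain_stop TP).
Qed.

(** The shells are disjoint, so the modulars add. *)
Lemma rho_shell_sum T f J : sparse_chain T -> measurable_fun setT f ->
  (forall x, 0 <= f x) -> (rho f <= 1)%E ->
  (rho (shell_sum T f J) <= (J%:R * C `^ pP)%R%:E)%E.
Proof.
move=> TP mf f0 rf; elim: J => [|J IH].
  rewrite mul0r /Exponent.rho integral0_eq// => x _.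
  by rewrite /shell_sum big_ord0 powR0// gt_eqF// (p_gt0 pA).
have tS : stopping lab (T J) by exact: (chain_stop TP).
have mE : measurable_fun setT (condE (T J) f) by exact: (measurable_condE labP).
apply: (@le_trans _ _ (rho (shell_sum T f J) + rho (condE (T J) f)))%E.
  rewrite /Exponent.rho -ge0_integralD//; last 4 first.
  - by move=> x _; rewrite lee_fin powR_ge0.
  - by apply: (measurable_rho pA); exact: measurable_shell_sum.
  - by move=> x _; rewrite lee_fin powR_ge0.
  - exact: (measurable_rho pA).
  apply: le_ge0_integral => x _; first by rewrite lee_fin powR_ge0.
  rewrite -EFinD lee_fin /shell_sum big_ord_recr/=.
  have p0 := p_gt0 pA x.
  have [Dx|Dx] := pselect (dom (T J) x).
    have := shell_sum_dom f TP Dx; rewrite /shell_sum => ->.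
    rewrite !add0r powR0 ?gt_eqF// add0r; apply: ler_powRl; rewrite ?(ltW p0)//.
      by rewrite mulr_ge0 ?indic_ge0 ?condE_ge0.
    by rewrite ler_piMl ?indic_le1 ?condE_ge0.
  by rewrite (condE_out _ _ _ Dx) mulr0 addr0 lerDl powR_ge0.
rewrite -natr1 mulrDl mul1r EFinD leeD//.
exact: rho_condE_fin.
Qed.

Lemma integrable_shell_sum i x K T f : sparse_chain T -> measurable_fun setT f ->
  (forall x, 0 <= f x) -> (rho f <= 1)%E ->
  mu.-integrable (cell i x) (EFin \o shell_sum T f K).
Proof.
move=> TP mf f0 rf; apply: (rho_cell_integrable1 pA labP i x).
- exact: measurable_shell_sum.
- by move=> y; exact: shell_sum_ge0.
- by apply: le_lt_trans (rho_shell_sum K TP mf f0 rf) _; rewrite ltry.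
Qed.

Variable J : nat.
Hypothesis J_gt0 : (0 < J)%N.
Hypothesis J_large : 8 * C * (J%:R * C `^ pP) `^ pm^-1 <= J%:R.

(** Inside a member of the first family each of the [J] shells contributes at
    least half of the average of [f] over [dom (T J)], by [avg_shell], so the
    average of the shell sum is at least [J/2] times that. But the shell sum has
    modular [O(J)], hence norm [O(J ^ (1/pm))], which for large [J] is much
    smaller than [J]. *)
Lemma rho_chain_step T f : sparse_chain T -> measurable_fun setT f ->
  (forall x, 0 <= f x) -> (rho f <= 1)%E ->
  (rho (fun x => 4 * condE (T 0%N) (fun y => f y * \1_(dom (T J)) y) x)%R <= 1)%E.
Proof.
move=> TP mf f0 rf; have hL := J_large; set L := J%:R * C `^ pP in hL.
have J1 : 1 <= J%:R :> R by rewrite ler1n.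
have pP1 := pP_gt1 pA point.
have L1 : 1 <= L.
  by rewrite -[1]mulr1 ler_pM// -(powRr0 C) ler_powR// ltW// (lt_trans _ pP1).
have mh := measurable_shell_sum f J TP.
have h0 x := shell_sum_ge0 T J x f0.
have rh := rho_shell_sum J TP mf f0 rf.
have L0 : 0 < L `^ pm^-1 by rewrite powR_gt0// (lt_le_trans ltr01).
have tS : stopping lab (T 0%N) by exact: (chain_stop TP).
have rho_h : (rho (shell_sum T f J) < +oo)%E by apply: le_lt_trans rh _; rewrite ltry.
have := averages_norm pA labP bdd tS mh h0 L0 rho_h
  (rho_scaled_le1 pA L1 mh h0 rh).
apply: le_trans; apply: (le_rho mu pA) => x.
  rewrite mulr_ge0//; apply: condE_ge0 => y.
  by rewrite mulr_ge0// indic_ge0.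
rewrite /Cells.condE; case Tx : (T 0%N x) => [i|]; last by rewrite mulr0 mul0r.
have mD j := chain_mdom labP j TP.
have mS j := measurable_shell labP j TP.
have ifD j : mu.-integrable (cell i x) (EFin \o (fun y => f y * \1_(dom (T j)) y)).
  apply: (rho_cell_integrable1 pA labP i x).
  - by apply: measurable_mul_indic; [exact: mD|exact: mf].
  - by move=> y; rewrite mulr_ge0// indic_ge0.
  - by apply: le_lt_trans (rho_mul_indic _ f0) _; exact: fin_le1.
have iS K := integrable_shell_sum i x K TP mf f0 rf.
pose u j := avg (cell i x) (fun y => f y * \1_(dom (T j)) y).
(* the averages over [dom (T j)] decrease with [j], so each shell yields [u J / 2] *)
have key K : (K <= J)%N -> K%:R * (2^-1 * u J) <= avg (cell i x) (shell_sum T f K).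
  elim: K => [_|K IH KJ].
    by rewrite mul0r; apply: avg_ge0 => y _; exact: shell_sum_ge0.
  rewrite (@eq_avg _ _ _ mu _ (shell_sum T f K.+1)
    (fun y => shell_sum T f K y + \1_(shell T K) y * condE (T K) f y)); last first.
    by move=> y _; rewrite /shell_sum big_ord_recr.
  rewrite avgD//; last first.
    have mE : measurable_fun setT (condE (T K) f).
      by apply: (measurable_condE labP); exact: (chain_stop TP).
    apply: (rho_cell_integrable1 pA labP i x).
    - by apply: measurable_funM; [exact: measurable_indic|exact: mE].
    - by move=> y; rewrite mulr_ge0 ?indic_ge0 ?condE_ge0.
    - apply: (@le_lt_trans _ _ (rho (condE (T K) f))).
        apply: (le_rho mu pA) => y.
          by rewrite mulr_ge0 ?indic_ge0 ?condE_ge0.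
        by rewrite ler_piMl ?indic_le1 ?condE_ge0.
      apply: le_lt_trans (rho_condE_fin _ mf f0 rf) _; last by rewrite ltry.
      exact: (chain_stop TP).
  rewrite -natr1 mulrDl mul1r lerD//; first by apply: IH; exact: ltnW.
  apply: le_trans (avg_shell K TP mf f0 rf Tx).
  rewrite ler_wpM2l//; apply: le_avg => // y _.
  rewrite ler_wpM2l//; have [Dy|Dy] := pselect (dom (T J) y).
    by rewrite (indic_in _ Dy) indic_in//; apply: (chain_dom TP) Dy => //; exact: ltnW.
  by rewrite (indic_out _ Dy) indic_ge0.
have := key J (leqnn J); rewrite -/(u J) => hJ.
have C0 : 0 < C by exact: lt_le_trans C_ge1.
rewrite ler_pdivlMr ?mulr_gt0//.
have u0 : 0 <= u J.
  by apply: avg_ge0 => y _; rewrite mulr_ge0// indic_ge0.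
apply: le_trans hJ.
apply: (@le_trans _ _ ((8 * C * L `^ pm^-1) * (2^-1 * u J))).
  by rewrite le_eqVlt; apply/orP; left; apply/eqP; field.
by rewrite ler_wpM2r// mulr_ge0.
Qed.

(** By the tower property [rho_chain_step] can be iterated: the part of [f] on
    a much later family may be replaced by its averages over the family [J]. *)
Lemma rho_chain_decay m T f : sparse_chain T -> measurable_fun setT f ->
  (forall x, 0 <= f x) -> (rho f <= 1)%E ->
  (rho (fun x => 4 ^+ m.+1 * condE (T 0%N)
     (fun y => f y * \1_(dom (T (m.+1 * J)%N)) y) x)%R <= 1)%E.
Proof.
elim: m T => [|m IH] T TP mf f0 rf.
  by rewrite expr1 mul1n; exact: rho_chain_step.
have TP' := chain_shift J TP.
pose F y := f y * \1_(dom (T (m.+2 * J)%N)) y.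
have mF : measurable_fun setT F.
  by apply: measurable_mul_indic => //; exact: (chain_mdom labP _ TP).
have F0 y : 0 <= F y by rewrite mulr_ge0// indic_ge0.
have rF : (rho F <= 1)%E by apply: le_trans rf; exact: rho_mul_indic.
pose g x := 4 ^+ m.+1 * condE (T J) F x.
have tJ : stopping lab (T J) by exact: (chain_stop TP).
have mg : measurable_fun setT g.
  by apply: measurable_funM => //; exact: measurable_condE.
have g0 x : 0 <= g x by rewrite mulr_ge0 ?exprn_ge0 ?condE_ge0.
have rg : (rho g <= 1)%E.
  have := IH _ TP' mf f0 rf; rewrite addn0 /g /F.
  by rewrite [in X in (X <= _)%E -> _](_ : (J + m.+1 * J = m.+2 * J)%N) ?mulSn.
rewrite (_ : (fun x => _) = fun x => 4 * condE (T 0%N)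
    (fun y => g y * \1_(dom (T J)) y) x).
  exact: (rho_chain_step TP mg g0 rg).
apply/funext => x.
rewrite exprS -mulrA; congr (_ * _).
rewrite (_ : (fun y => g y * _) = fun y => 4 ^+ m.+1 * condE (T J) F y); last first.
  apply/funext => y; have [Dy|Dy] := pselect (dom (T J) y).
    by rewrite indic_in// mulr1.
  by rewrite indic_out// mulr0 condE_out// mulr0.
have rE : (rho (condE (T J) F) < +oo)%E.
  by apply: le_lt_trans (rho_condE_fin tJ mF F0 rF) _; rewrite ltry.
rewrite (condEZ labP); last first.
  apply: (rho_cell_integrable pA labP _ _ rE).
    exact: measurable_condE.
  by move=> y; exact: condE_ge0.
congr (_ * _); rewrite condE_tower//; congr (condE _ _ x); apply/funext => y.
rewrite /F; have [Dy|Dy] := pselect (dom (T (m.+2 * J)%N) y).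
  rewrite !indic_in ?mulr1//; apply: (chain_dom TP) Dy => //.
  by rewrite mulSn leq_addr.
by rewrite (indic_out _ Dy) mulr0 mul0r.
Qed.

End chain_decay.

(** * Gehring chains *)

Section first_index.
Implicit Types (P Q : nat -> Prop).

Definition first P : option nat :=
  if pselect (exists n, `[< P n >]) is left e then Some (ex_minn e) else None.

Lemma first_some P n : first P = Some n -> P n /\ forall m, (m < n)%N -> ~ P m.
Proof.
rewrite /first; case: pselect => // e [<-]; case: ex_minnP => k /asboolP Pk min.
by split=> // m mk /asboolP /min; rewrite leqNgt mk.
Qed.

Lemma first_none P n : first P = None -> ~ P n.
Proof.
by rewrite /first; case: pselect => // ne _ Pn; apply: ne; exists n; exact/asboolP.
Qed.

Lemma first_le P n : P n -> exists2 m, first P = Some m & (m <= n)%N.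
Proof.
move=> Pn; case e : (first P) => [m|]; last by have := first_none (n := n) e.
exists m => //; rewrite leqNgt; apply/negP => nm.
by have [_ /(_ _ nm)] := first_some e.
Qed.

Lemma first_eqP P n : P n -> (forall m, (m < n)%N -> ~ P m) -> first P = Some n.
Proof.
move=> Pn minP; have [m e mn] := first_le Pn.
have [Pm _] := first_some e; move: mn; rewrite leq_eqVlt => /predU1P[<-//|].
by move=> /minP.
Qed.

End first_index.

Section dyadic.
Context d (X : measurableType d) (R : realType).
Variable mu : {measure set X -> \bar R}.

(** [dy_diff] is Lebesgue differentiation along the cells, in the one-sided form
    in which Gehring chains use it. *)
Record dyadic (lab : nat -> X -> nat) (N : R) : Prop := Dyadic {
  dy_cells : cell_partition mu lab;
  dy_refine : forall i x y, lab i.+1 x = lab i.+1 y -> lab i x = lab i y;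
  dy_doubling : forall i x, (mu (cell lab i x) <= N%:E * mu (cell lab i.+1 x))%E;
  dy_diff : forall (f : X -> R) b, measurable_fun setT f ->
    (forall x, 0 <= f x <= b) ->
    {ae mu, forall x, forall i0 c,
      (forall i, (i0 <= i)%N -> avg mu (cell lab i x) f <= c) -> f x <= c} }.

Variables (lab : nat -> X -> nat) (N : R).
Hypothesis labD : dyadic lab N.
Let labP := dy_cells labD.
Local Notation condE := (condE mu lab).
Local Notation avg := (avg mu).
Local Notation cell := (cell lab).
Local Notation sparse_chain := (sparse_chain mu lab).
Let mcell := measurable_cell labP.
Let cgt0 := cell_gt0 labP.
Let cfin := cell_fin labP.
Local Hint Resolve mcell cgt0 cfin : core.
Implicit Types (f g w : X -> R) (T : nat -> X -> option nat).

Lemma cell_sub i j x : (i <= j)%N -> cell j x `<=` cell i x.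
Proof.
elim: j => [|j IH]; first by rewrite leqn0 => /eqP->.
rewrite leq_eqVlt => /predU1P[->//|]; rewrite ltnS => ij y cy.
by apply: (IH ij); apply: (dy_refine labD); exact: cy.
Qed.

Lemma N_ge1 : 1 <= N.
Proof.
have := dy_doubling labD 0 point.
have sub := @cell_sub 0 1 point isT.
have le : (mu (cell 1 point) <= mu (cell 0 point))%E.
  by apply: le_measure => //; rewrite inE.
move=> /(le_trans le); rewrite -[leLHS]mul1e lee_pmul2r ?lee_fin//.
by rewrite gt0_fin_numE.
Qed.

(** Up to the generation of the chosen cell, all points of that cell have the
    same cells. *)
Lemma stopping_first (P : nat -> X -> Prop) :
  (forall i x y, cell i x y -> P i y <-> P i x) ->
  stopping lab (fun x => first (P^~ x)).
Proof.
move=> PE x y i /first_some[Pi Pm] cy; apply: first_eqP; first exact/(PE _ _ _ cy).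
move=> m mi /(PE m x y) Pmx; apply: (Pm m mi); apply: Pmx.
by apply: cell_sub cy; exact: ltnW.
Qed.

Lemma bounded_cell_integrable f b i x : measurable_fun setT f ->
  (forall x, 0 <= f x <= b) -> mu.-integrable (cell i x) (EFin \o f).
Proof.
move=> mf fb; apply: (bounded_integrable (mcell i x) (cfin i x) mf) => y _.
exact: fb.
Qed.

Lemma bounded_all_integrable f b tau : measurable_fun setT f ->
  (forall x, 0 <= f x <= b) -> cell_integrable mu lab tau f.
Proof. by move=> mf fb x i _; apply: bounded_cell_integrable fb. Qed.

Lemma avg_ae_le i x f g b : measurable_fun setT f -> measurable_fun setT g ->
  (forall x, 0 <= f x <= b) -> (forall x, 0 <= g x <= b) ->
  {ae mu, forall y, cell i x y -> f y <= g y} ->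
  avg (cell i x) f <= avg (cell i x) g.
Proof.
move=> mf mg fb gb fg; apply: (avg_of_integral (mu := mu)) => //.
- exact: bounded_cell_integrable fb.
- exact: bounded_cell_integrable gb.
apply: ae_ge0_le_integral => //.
- by move=> y _; rewrite lee_fin; case/andP: (fb y).
- by apply: measurable_funTS; exact/measurable_EFinP.
- by move=> y _; rewrite lee_fin; case/andP: (gb y).
- by apply: measurable_funTS; exact/measurable_EFinP.
Qed.

Lemma avg_finer tau sigma f b x k : stopping lab tau -> stopping lab sigma ->
  finer lab tau sigma -> measurable_fun setT f -> (forall x, 0 <= f x <= b) ->
  sigma x = Some k ->
  (\int[mu]_(y in dom tau `&` cell k x) (condE tau f y)%:E =
   \int[mu]_(y in dom tau `&` cell k x) (f y)%:E)%E.
Proof.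
move=> tS sS fts mf fb sx.
transitivity (\int[mu]_(y in dom tau `&` cell k x) (1 * condE tau f y)%R%:E)%E.
  by under [RHS]eq_integral do rewrite mul1r.
rewrite (integral_condE_on labP (phi := cst 1) (Q := cell k x))//.
- by under eq_integral do rewrite mul1r.
- by move=> y; case/andP: (fb y).
- exact: finer_cell_const sS fts sx.
- exact: bounded_all_integrable fb.
Qed.

Lemma avg_le_cell i j x f b : (i <= j)%N -> measurable_fun setT f ->
  (forall x, 0 <= f x <= b) ->
  avg (cell j x) f * fine (mu (cell j x)) <= avg (cell i x) f * fine (mu (cell i x)).
Proof.
move=> ij mf fb.
have if_ k := bounded_cell_integrable k x mf fb.
rewrite -lee_fin !EFinM !fineQ// -!integral_avg//.
apply: ge0_subset_integral => //.
- by apply: measurable_funTS; exact/measurable_EFinP.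
- by move=> y _; rewrite lee_fin; case/andP: (fb y).
- exact: cell_sub.
Qed.

Lemma avg_doubling i x f b : measurable_fun setT f ->
  (forall x, 0 <= f x <= b) -> avg (cell i.+1 x) f <= N * avg (cell i x) f.
Proof.
move=> mf fb; have := avg_le_cell x (leqnSn i) mf fb.
have m1 : 0 < fine (mu (cell i.+1 x)) by exact: fine_gt0Q.
have a0 : 0 <= avg (cell i x) f by apply: avg_ge0 => y _; case/andP: (fb y).
have dbl : fine (mu (cell i x)) <= N * fine (mu (cell i.+1 x)).
  by rewrite -lee_fin EFinM !fineQ//; exact: dy_doubling.
rewrite -ler_pdivlMr// => /le_trans; apply.
by rewrite ler_pdivrMr// [leRHS]mulrAC [leLHS]mulrC ler_wpM2r.
Qed.

Section gehring_chain.
Variables (tau : X -> option nat) (w : X -> R) (b : R).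
Hypotheses (tS : stopping lab tau) (mw : measurable_fun setT w)
  (wb : forall x, 0 <= w x <= b).
Local Notation a := (2 * N).

(** [a = 2 N] exceeds the doubling constant by a factor [2], which is what makes
    the chain below sparse. *)
Definition high j i x := exists2 i0, tau x = Some i0 &
  (i0 <= i)%N /\ a ^+ j * avg (cell i0 x) w < avg (cell i x) w.

(** Calderon-Zygmund selection: the next families consist of the largest cells
    inside the members of [tau] on which [w] has a high average. *)
Definition gehring j x : option nat :=
  if j is j'.+1 then first (fun i => high j i x) else tau x.

Let w0 x : 0 <= w x. Proof. by case/andP: (wb x). Qed.
Let iw i x := bounded_cell_integrable i x mw wb.
Let a_ge1 : 1 <= a. Proof. by have := N_ge1; lra. Qed.
Let aw0 i x : 0 <= avg (cell i x) w. Proof. exact: avg_ge0. Qed.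

Lemma high_cell j i x y : cell i x y -> high j i y <-> high j i x.
Proof.
have key u v : cell i u v -> high j i u -> high j i v.
  move=> cv [i0 tu [i0i h]]; have cv0 : cell i0 u v by exact: cell_sub cv.
  exists i0; first exact: tS cv0.
  by split => //; rewrite (eq_cell cv0) (eq_cell cv).
by move=> cy; split; apply: key => //; rewrite /Cells.cell/= cy.
Qed.

Lemma gehring_stop j : stopping lab (gehring j).
Proof.
case: j => [|j]; first exact: tS.
by apply: (stopping_first (P := fun i x => high j.+1 i x)) => i x y; exact: high_cell.
Qed.

Lemma gehring_nest j : finer lab (gehring j.+1) (gehring j).
Proof.
move=> x i /first_some[[i0 tx [i0i h]] _]; case: j h => [|j] h.
  by exists i0 => //; exact: cell_sub.
(* a cell that is high for a later family is high for this one *)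
have hj : high j.+1 i x.
  exists i0 => //; split => //; apply: le_lt_trans h.
  by rewrite ler_wpM2r// [leRHS]exprS ler_peMl// exprn_ge0// (le_trans ler01).
by have [m e mi] := first_le (P := fun i => high j.+1 i x) hj; exists m => //; exact: cell_sub.
Qed.

(** The parent of a largest high cell is not high; apply doubling. *)
Lemma gehring_upper j x k i0 : gehring j x = Some k -> tau x = Some i0 ->
  avg (cell k x) w <= N * (a ^+ j * avg (cell i0 x) w).
Proof.
case: j => [|j].
  by rewrite /= => -> [->]; rewrite mul1r ler_peMl// N_ge1.
move=> /first_some[[i1 tx [i1k h]] hmin] tx'.
move: tx; rewrite tx' => -[?]; subst i1.
have ik : (i0 < k)%N.
  rewrite ltn_neqAle i1k andbT; apply: contraTneq h => <-.
  by rewrite -leNgt ler_peMl// exprn_ege1.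
case: k i1k h hmin ik => // k i0k h hmin; rewrite ltnS => ik.
apply: (le_trans (avg_doubling _ _ mw wb)).
rewrite ler_wpM2l//; first exact: le_trans N_ge1.
rewrite leNgt; apply/negP => hk; apply: (hmin k) => //.
by exists i0.
Qed.

Lemma gehring_lower j y l i0 : gehring j.+1 y = Some l -> tau y = Some i0 ->
  a ^+ j.+1 * avg (cell i0 y) w < avg (cell l y) w.
Proof. by move=> /first_some[[i1 -> [_ h]] _] [<-]. Qed.

Lemma gehring_dom j x k : gehring j x = Some k -> exists2 i0, tau x = Some i0 & (i0 <= k)%N.
Proof.
case: j => [|j]; first by move=> tx; exists k.
by move=> /first_some[[i0 tx [ik _]] _]; exists i0.
Qed.

(** On a cell of the [j]-th family the average of [w] is at most [N a ^ j]
    times its average over the member of [tau], while on the cells of the next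
    one it exceeds [a ^ j.+1] times that; so these fill at most the fraction
    [N / a = 1/2]. *)
Lemma gehring_half j x : condE (gehring j) (\1_(dom (gehring j.+1))) x <= 2^-1.
Proof.
rewrite {1}/Cells.condE; case gx : (gehring j x) => [k|]; last by rewrite invr_ge0.
have [i0 tx ik] := gehring_dom gx.
set D := dom _; set Q := cell k x; set m := avg (cell i0 x) w.
have mD : measurable D by apply: (measurable_dom labP); exact: (@gehring_stop j.+1).
have mf : measurable_fun setT (\1_D : X -> R) by exact: measurable_indic.
have mQ : measurable Q by exact: mcell.
have Q0 : (0 < mu Q)%E by exact: cgt0.
have Qoo : (mu Q < +oo)%E by exact: cfin.
have iD : mu.-integrable Q (EFin \o (\1_D : X -> R)).
  exact: (indic_integrable (mcell k x) (cfin k x) mD).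
have same y : Q y -> tau y = Some i0 /\ cell i0 y = cell i0 x.
  move=> Qy; have c0 : cell i0 x y by exact: cell_sub Qy.
  by split; [exact: tS c0|rewrite (eq_cell c0)].
(* a member on which [w] vanishes contains no high cell *)
have [m0|m0] := leP m 0.
  rewrite (@eq_avg _ _ _ mu _ _ (fun=> 0)) ?avg_cst ?invr_ge0//.
  move=> y Qy; apply: indic_out => Dy.
  case gy : (gehring j.+1 y) => [l|]; last by apply: Dy.
  have [ty cE] := same y Qy; have := gehring_lower gy ty.
  have [i1 ty' il] := gehring_dom gy; move: ty'; rewrite ty => -[?]; subst i1.
  have := avg_le_cell y il mw wb; rewrite cE -/m => h1 h2.
  have me : m = 0 by apply/eqP; rewrite eq_le m0 /m aw0.
  have l0 : 0 < fine (mu (cell l y)) by exact: fine_gt0Q.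
  by move: h1 h2; rewrite me mul0r mulr0 pmulr_lle0// => h1; rewrite ltNge h1.
have a0 : 0 < a by exact: lt_le_trans ltr01 a_ge1.
have am0 : 0 < a ^+ j.+1 * m by rewrite (mulr_gt0 (exprn_gt0 _ a0) m0).
have gS := @gehring_stop j.+1; have gSj := @gehring_stop j.
have step : a ^+ j.+1 * m * avg Q \1_D <= avg Q w.
  rewrite -avgZ//; apply: (avg_of_integral (mu := mu)) => //.
    by have := integrableZl (mcell k x) (a ^+ j.+1 * m) iD; apply: eq_integrable.
    exact: iw.
  rewrite (@integral_cell_dom _ _ _ mu _ D
    (fun y => a ^+ j.+1 * m * \1_D y)); last by move=> y Dy; rewrite indic_out ?mulr0.
  apply: (@le_trans _ _ (\int[mu]_(y in D `&` Q) (condE (gehring j.+1) w y)%:E)%E).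
    apply: le_ge0_integral => y [Dy Qy].
      by rewrite lee_fin mulr_ge0 ?indic_ge0// ltW.
    rewrite lee_fin indic_in// mulr1 /Cells.condE.
    case gy : (gehring j.+1 y) => [l|]; last by exfalso; apply: Dy.
    have [ty cE] := same y Qy; rewrite /m -cE; apply: ltW; exact: gehring_lower.
  rewrite (avg_finer gS gSj (@gehring_nest j) mw wb gx).
  apply: ge0_subset_integral => //.
  - exact: measurableI.
  - by apply: measurable_funTS; exact/measurable_EFinP.
  - by move=> y _; rewrite lee_fin.
have up := gehring_upper gx tx; rewrite -/Q -/m in up.
have aj0 : 0 < a ^+ j := exprn_gt0 _ a0.
have N0 : 0 < N by exact: lt_le_trans N_ge1.
have pos : 0 < N * (a ^+ j * m) by rewrite mulr_gt0// mulr_gt0.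
have := le_trans step up; rewrite exprS.
rewrite (_ : _ * avg Q _ = N * (a ^+ j * m) * (2 * avg Q \1_D)); last by ring.
by rewrite -[leRHS]mulr1 ler_pM2l//; lra.
Qed.

Lemma gehring_sparse : sparse_chain gehring.
Proof. by split; [exact: gehring_stop|exact: gehring_nest|exact: gehring_half]. Qed.

(** Where no cell is high, differentiation bounds [w] itself. *)
Lemma gehring_ae : {ae mu, forall x, forall i0 j, tau x = Some i0 ->
  gehring j.+1 x = None -> w x <= a ^+ j.+1 * avg (cell i0 x) w}.
Proof.
have := dy_diff labD mw wb; apply: filterS => x h i0 j tx gx.
apply: (h i0) => i ii; rewrite leNgt; apply/negP => hi.
by apply: (first_none (n := i) gx); exists i0.
Qed.

Variables (J m : nat) (del : R).
Hypotheses (J_gt0 : (0 < J)%N) (m_gt0 : (0 < m)%N) (del_ge0 : 0 <= del).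
Hypothesis w_bound : forall x, dom tau x -> w x <= (a ^+ J) ^+ m * condE tau w x.

(** A majorant of the power [del] of [w / E_tau w]; only every [J]-th family
    of the chain is used, for the sake of [rho_chain_decay]. *)
Definition layers x : R :=
  \sum_(j < m) ((a ^+ J) ^+ j.+1) `^ del * \1_(dom (gehring (j * J)%N)) x.

Lemma layers_ge0 x : 0 <= layers x.
Proof. by apply: sumr_ge0 => j _; rewrite mulr_ge0 ?powR_ge0 ?indic_ge0. Qed.

Lemma measurable_layers : measurable_fun setT layers.
Proof.
apply: measurable_sum => j; apply: measurable_funM => //.
by apply: measurable_indic; exact: (chain_mdom labP _ gehring_sparse).
Qed.

Lemma layers_le x : layers x <= \sum_(j < m) ((a ^+ J) ^+ j.+1) `^ del.
Proof.
by apply: ler_sum => j _; rewrite ler_piMr ?powR_ge0// indic_le1.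
Qed.

(** The last family of the chain that contains the point determines the size
    of [w] there up to the factor [a ^ J]. *)
Lemma pow_le_layers : {ae mu, forall x, dom tau x ->
  w x `^ del <= condE tau w x `^ del * layers x}.
Proof.
have := gehring_ae; apply: filterS => x h Dx.
have := w_bound Dx.
move: (Dx); rewrite /dom/=; case tx : (tau x) => [i0|//] _.
have cE : condE tau w x = avg (cell i0 x) w by rewrite /Cells.condE tx.
(* descend from the a priori bound until the point belongs to the family *)
have sel k : (0 < k)%N -> w x <= (a ^+ J) ^+ k * condE tau w x ->
    exists j, [/\ (j < k)%N, dom (gehring (j * J)%N) x &
      w x <= (a ^+ J) ^+ j.+1 * condE tau w x].
  elim: k => // k IH _ wk.
  have [Dk|Dk] := pselect (dom (gehring (k * J)%N) x); first by exists k.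
  case: k IH wk Dk => [|k] IH wk Dk; first by exfalso; apply: Dk; rewrite mul0n.
  have [|j [jk Dj wj]] := IH isT; last by exists j; split => //; exact: ltnW.
  rewrite cE -exprM mulnC.
  have kJ : (k.+1 * J = (k.+1 * J).-1.+1)%N by rewrite prednK// muln_gt0.
  rewrite kJ; apply: h => //; rewrite -kJ.
  by move: Dk; rewrite /dom/=; case: (gehring _ _) => // l []; done.
move=> wm; have [j [jm Dj wj]] := sel m m_gt0 wm.
have E0 : 0 <= condE tau w x by exact: condE_ge0.
have aJ0 k : 0 <= (a ^+ J) ^+ k by rewrite !exprn_ge0// (le_trans ler01).
apply: (@le_trans _ _ (((a ^+ J) ^+ j.+1 * condE tau w x) `^ del)).
  exact: ler_powRl.
rewrite powRM// mulrC ler_wpM2l ?powR_ge0//.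
rewrite /layers (bigD1 (Ordinal jm))//= indic_in// mulr1 lerDl.
by apply: sumr_ge0 => i _; rewrite mulr_ge0 ?powR_ge0 ?indic_ge0.
Qed.

Let c_bound := \sum_(j < m) ((a ^+ J) ^+ j.+1) `^ del.

Lemma layers_bound : exists B, forall x, 0 <= w x * layers x <= B.
Proof.
exists (b * c_bound) => x; rewrite mulr_ge0 ?layers_ge0//=.
by apply: ler_pM; rewrite ?layers_ge0// ?layers_le//; case/andP: (wb x).
Qed.

(** The integrability of a higher power of [w] is reduced to the sizes of [w]
    on the families of a sparse chain, which the averaging hypothesis controls. *)
Lemma gehring_condE x : condE tau (fun y => w y * w y `^ del) x <=
  condE tau w x `^ del * condE tau (fun y => w y * layers y) x.
Proof.
have [B lB] := layers_bound.
have mwl : measurable_fun setT (fun y => w y * layers y).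
  by apply: measurable_funM => //; exact: measurable_layers.
rewrite /Cells.condE; case tx : (tau x) => [i|]; last by rewrite mulr0.
have iwl := bounded_cell_integrable i x mwl lB.
rewrite -avgZ//; set E := avg (cell i x) w.
have E0 : 0 <= E `^ del by rewrite powR_ge0.
(* any common bound of both sides serves; this is the larger of two obvious ones *)
apply: (avg_ae_le (b := Num.max (b * b `^ del) (E `^ del * B))).
- by apply: measurable_funM => //; exact: measurable_fun_powR2.
- exact: measurable_funM.
- move=> y; rewrite mulr_ge0 ?powR_ge0//= le_max; apply/orP; left.
  have /andP[_ wyb] := wb y.
  by apply: ler_pM; rewrite ?powR_ge0// ler_powRl.
- move=> y; have /andP[l0 lb] := lB y; rewrite mulr_ge0//= le_max.
  by apply/orP; right; rewrite ler_wpM2l.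
have := pow_le_layers; apply: filterS => y h cy.
have ty : tau y = Some i by exact: tS cy.
have Dy : dom tau y by rewrite /dom/= ty.
have := h Dy; rewrite /Cells.condE ty (eq_cell cy) -/E => hy.
by rewrite mulrCA ler_wpM2l.
Qed.

End gehring_chain.
End dyadic.

(** * Reverse Hoelder inequality and left-openness *)

Section real_extra.
Context {R : realType}.
Implicit Types (a b c x y p q : R).

Lemma powR_midpoint p x y : 1 <= p -> 0 <= x -> 0 <= y ->
  (2^-1 * x + 2^-1 * y) `^ p <= 2^-1 * x `^ p + 2^-1 * y `^ p.
Proof.
move=> p1 x0 y0; rewrite {2 4}(_ : 2^-1 = 1 - 2^-1); last first.
  by rewrite {2}(splitr 1) div1r addrK.
by apply: (convex_powR p1 (Itv01 _ _)) => //=;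
  rewrite ?inE/= ?in_itv/= ?x0 ?y0// ?invr_ge0// invf_le1 ?ler1n.
Qed.

Lemma powR_exprn a p n : 0 <= a -> (a ^+ n) `^ p = (a `^ p) ^+ n.
Proof. by move=> a0; rewrite -(powR_mulrn n a0) -(powR_mulrn n (powR_ge0 a p)) powRAC. Qed.

(** The exponent serves as the length of a Gehring chain, which has to be
    positive. *)
Lemma expr_unbounded a c : 2 <= a -> exists2 m, (0 < m)%N & c <= a ^+ m.
Proof.
move=> a2; have [c1|c1] := leP c 1.
  by exists 1%N => //; rewrite expr1 (le_trans c1)// (le_trans _ a2)// ler1n.
have := truncnS_gt c; set m := (Num.truncn c).+1 => cm.
exists m => //; apply: (le_trans (ltW cm)); apply: (@le_trans _ _ (2 ^+ m)).
  by rewrite -natrX ler_nat ltnW// ltn_expl.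
by apply: lerXn2r => //; rewrite nnegrE// (le_trans _ a2).
Qed.

(** Both [e] and [V] are at most [e + V]. *)
Lemma powR_holder_max (e V n del : R) : 0 <= e -> 0 <= V -> 0 <= n -> 0 <= del ->
  n <= e `^ del * V -> n `^ (1 + del)^-1 <= e + V.
Proof.
move=> e0 V0 n0 d0 h; have d1 : 0 < 1 + del by rewrite ltr_pwDl.
have s0 : 0 <= e + V by rewrite addr_ge0.
rewrite -[leRHS](powRK s0 (lt0r_neq0 d1)); apply: ler_powRl => //.
  by rewrite invr_ge0 ltW.
apply: (le_trans h); rewrite powRD; last first.
  by apply/implyP => /eqP h'; move: d1; rewrite h' ltxx.
rewrite powRr1// mulrC ler_pM ?powR_ge0// ?lerDr//.
by apply: ler_powRl => //; rewrite lerDl.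
Qed.

Lemma sum_geometric_le (q : R) m : 0 <= q < 1 -> \sum_(j < m) q ^+ j.+1 <= (1 - q)^-1.
Proof.
move=> /andP[q0 q1]; have q1' : 0 < 1 - q by rewrite subr_gt0.
rewrite -[leRHS]mul1r ler_pdivlMr//.
elim: m => [|m IH]; first by rewrite big_ord0 mul0r.
suff -> : (\sum_(j < m.+1) q ^+ j.+1) * (1 - q) = q - q ^+ m.+2.
  by rewrite lerBlDr (le_trans (ltW q1))// lerDl exprn_ge0.
elim: {IH} m => [|m IH]; first by rewrite big_ord1 expr1 expr2; ring.
by rewrite big_ord_recr/= mulrDl IH [in RHS]exprS (exprS q m.+1); ring.
Qed.

End real_extra.

Section self_improvement.
Context d (X : measurableType d) (R : realType).
Variable mu : {measure set X -> \bar R}.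
Variables (p : X -> R) (pm pP : R).
Hypothesis pA : bounded_exponent p pm pP.
Let mp := be_meas pA.
Let pm_gt1 := be_gt1 pA.
Let pm_le := be_ge pA.
Let p_le := be_le pA.
Variables (lab : nat -> X -> nat) (N : R).
Hypothesis labD : dyadic mu lab N.
Let labP := dy_cells labD.
Variable C : R.
Hypothesis bdd : averages_bounded mu p lab C.
Let C_ge1 := ab_ge1 bdd.
Local Notation condE := (condE mu lab).
Local Notation avg := (avg mu).
Local Notation cell := (cell lab).
Local Notation rho := (rho mu p).
Local Notation sparse_chain := (sparse_chain mu lab).
Let mcell := measurable_cell labP.
Let cgt0 := cell_gt0 labP.
Let cfin := cell_fin labP.
Local Hint Resolve mcell cgt0 cfin : core.
Implicit Types (f g w : X -> R) (T : nat -> X -> option nat).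
Local Notation a := (2 * N).

Let p_gt0' x : 0 < p x. Proof. exact: (p_gt0 pA). Qed.
Let a_ge2 : 2 <= a. Proof. by have := N_ge1 labD; lra. Qed.

Lemma powR_p_bounds t x : 0 < t ->
  Num.min 1 t `^ pP <= t `^ p x <= Num.max 1 t `^ pP.
Proof.
move=> t0; have p0 := p_gt0' x; apply/andP; split.
  have m0 : 0 < Num.min 1 t by rewrite lt_min ltr01 t0.
  apply: (@le_trans _ _ (Num.min 1 t `^ p x)).
    by apply: ger_powR => //; rewrite m0 ge_min lexx.
  by apply: ler_powRl; rewrite ?(ltW p0) ?(ltW m0)// ge_min lexx orbT.
apply: (@le_trans _ _ (Num.max 1 t `^ p x)).
  by apply: ler_powRl; rewrite ?(ltW p0) ?(ltW t0)// le_max lexx orbT.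
by apply: ler_powR => //; rewrite le_max lexx.
Qed.

Section reverse_hoelder.
Variables (lam q del : R).
Hypotheses (lam_ge1 : 1 <= lam) (lam_gap : lam `^ pP * (1 - decay_gap pP C) <= 1)
  (q01 : 0 <= q < 1) (del_ge0 : 0 <= del) (del_small : a `^ del <= lam * q).

Definition rh_const := 2 + 2 `^ pP * lam / (1 - q).

(** Raising the height by [lam ^ j] multiplies the mass by at least [lam ^ j],
    since [p >= 1], and by [chain_mass_decay] the mass at the raised height stays
    bounded; starting from height [t / 2] replaces the initial bound [2] by [1]. *)
Lemma mass_geometric T t j : sparse_chain T -> 0 < t ->
  (\int[mu]_(x in dom (T 0%N)) (t `^ p x)%R%:E <= 2%:E)%E ->
  (\int[mu]_(x in dom (T j)) (t `^ p x)%R%:E <= (2 `^ pP / lam ^+ j)%R%:E)%E.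
Proof.
move=> TP t0 mass; have lam0 : 0 < lam by exact: lt_le_trans lam_ge1.
have mD k := chain_mdom labP k TP.
have mtp s k : measurable_fun (dom (T k)) (fun x => (s `^ p x)%:E).
  by apply: measurable_funTS; apply/measurable_EFinP; exact: measurable_fun_powR2.
have half : (\int[mu]_(x in dom (T 0%N)) ((2^-1 * t) `^ p x)%R%:E <= 1)%E.
  apply: (@le_trans _ _ (\int[mu]_(x in dom (T 0%N)) (2^-1%R%:E * (t `^ p x)%R%:E))%E).
    apply: le_ge0_integral => x _; first by rewrite lee_fin powR_ge0.
    rewrite -EFinM lee_fin; apply: le_trans (le1_powRM (q := 1) _ _ _ _) _.
    - by rewrite invr_ge0 ler0n invf_le1 ?ler1n.
    - exact: ltW.
    - exact: ltr01.
    - exact/ltW/(p_gt1 pA).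
    - by rewrite powRr1// invr_ge0.
  rewrite ge0_integralZl//; last by move=> x _; rewrite lee_fin powR_ge0.
  apply: (@le_trans _ _ (2^-1%:E * 2%:E)%E); first by rewrite lee_wpmul2l// lee_fin invr_ge0.
  by rewrite -EFinM mulVf.
have t20 : 0 < 2^-1 * t by rewrite mulr_gt0.
have := chain_mass_decay pA labP bdd j TP t20 lam_ge1 lam_gap half => dec.
apply: (@le_trans _ _ (\int[mu]_(x in dom (T j))
   ((2 `^ pP / lam ^+ j)%R%:E * ((lam ^+ j * (2^-1 * t)) `^ p x)%R%:E))%E).
  apply: le_ge0_integral => x _; first by rewrite lee_fin powR_ge0.
  rewrite -EFinM lee_fin.
  have lj0 : 0 < lam ^+ j by rewrite exprn_gt0.
  rewrite {1}(_ : t = 2 * ((lam ^+ j)^-1 * (lam ^+ j * (2^-1 * t)))); last first.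
    by field; rewrite gt_eqF.
  apply: le_trans (ge1_powRM _ _ (p_le x)) _; first by rewrite ler1n.
    by rewrite !mulr_ge0 ?invr_ge0// ltW.
  rewrite -mulrA ler_wpM2l ?powR_ge0//.
  apply: le_trans (le1_powRM (q := 1) _ _ _ _) _.
  - by rewrite invr_ge0 ltW//= invf_le1// exprn_ege1.
  - by rewrite !mulr_ge0 ?invr_ge0// ltW.
  - exact: ltr01.
  - exact/ltW/(p_gt1 pA).
  - by rewrite powRr1// invr_ge0 ltW.
rewrite ge0_integralZl//; last 2 first.
- by move=> x _; rewrite lee_fin powR_ge0.
- by rewrite lee_fin divr_ge0 ?powR_ge0// exprn_ge0// ltW.
rewrite -[leRHS]mule1 lee_wpmul2l// lee_fin divr_ge0 ?powR_ge0//.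
by rewrite exprn_ge0// ltW.
Qed.

(** Take the Gehring chain of the weight [t ^ p]. Its layers grow like
    [a ^ (del j)], but their mass decays like [lam ^ (- j)] by [mass_geometric],
    which is faster when [del] is small. *)
Lemma reverse_hoelder tau t : stopping lab tau -> 0 < t ->
  (\int[mu]_(x in dom tau) (t `^ p x)%R%:E <= 2%:E)%E ->
  (\int[mu]_(x in dom tau)
    (condE tau (fun y => t `^ p y * (t `^ p y) `^ del) x `^ (1 + del)^-1)%R%:E
   <= rh_const%:E)%E.
Proof.
move=> tS t0 mass; pose w x := t `^ p x.
have mw : measurable_fun setT w by exact: measurable_fun_powR2.
pose b := Num.max 1 t `^ pP; pose lo := Num.min 1 t `^ pP.
have wb x : 0 <= w x <= b.
  by rewrite powR_ge0/=; have /andP[] := powR_p_bounds x t0.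
have w0 x : 0 <= w x by case/andP: (wb x).
have lo0 : 0 < lo by rewrite powR_gt0// lt_min ltr01 t0.
have wlo x : lo <= w x by have /andP[] := powR_p_bounds x t0.
have iw i x := bounded_cell_integrable labD i x mw wb.
have iwt : cell_integrable mu lab tau w := bounded_all_integrable labD mw wb.
have [m m0 hm] := expr_unbounded (b / lo) a_ge2.
have wbound x : dom tau x -> w x <= (a ^+ 1) ^+ m * condE tau w x.
  rewrite /dom/= /Cells.condE; case tx : (tau x) => [i|//] _.
  have lo_le : lo <= avg (cell i x) w.
    rewrite -{1}(avg_cst (mcell i x) (cgt0 i x) (cfin i x) lo).
    apply: le_avg => //; apply: (bounded_cell_integrable (b := lo) labD) => // y.
    by rewrite ltW/=.
  have /andP[_ /le_trans] := wb x; apply; rewrite expr1.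
  move: hm; rewrite ler_pdivrMr// => /le_trans; apply.
  by rewrite ler_wpM2l// exprn_ge0// (le_trans _ a_ge2).
have geh := gehring_condE labD tS mw wb (ltnSn 0) m0 del_ge0 wbound.
pose S := layers mu lab N tau w 1 m del.
have S0 x : 0 <= S x by exact: layers_ge0.
have mS : measurable_fun setT S by exact: (measurable_layers labD tS mw wb 1 m del).
have [B wSB] := layers_bound mu lab N tau wb 1 m del.
have mwS : measurable_fun setT (fun x => w x * S x) by exact: measurable_funM.
have iwS : cell_integrable mu lab tau (fun x => w x * S x).
  exact: (bounded_all_integrable labD mwS wSB).
pose T := gehring mu lab N tau w.
have TP : sparse_chain T := gehring_sparse labD tS mw wb.
have mD := measurable_dom labP tS.
have mE f : measurable_fun (dom tau) (EFin \o condE tau f).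
  by apply: measurable_funTS; apply/measurable_EFinP; exact: (measurable_condE labP).
apply: (@le_trans _ _ (\int[mu]_(x in dom tau)
  ((condE tau w x)%:E + (condE tau (fun x => w x * S x) x)%:E))%E).
  apply: le_ge0_integral => x _; first by rewrite lee_fin powR_ge0.
  rewrite -EFinD lee_fin; apply: (powR_holder_max (del := del)) => //.
  - by apply: condE_ge0.
  - by apply: condE_ge0 => y; rewrite mulr_ge0.
  - by apply: condE_ge0 => y; rewrite mulr_ge0// powR_ge0.
rewrite ge0_integralD//; last 4 first.
- by move=> x _; rewrite lee_fin; exact: condE_ge0.
- exact: mE.
- by move=> x _; rewrite lee_fin; apply: condE_ge0 => y; rewrite mulr_ge0.
- exact: mE.
rewrite !(integral_condE1 labP tS)//; last by move=> x; rewrite mulr_ge0.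
rewrite /rh_const EFinD leeD//.
pose c j := ((a ^+ 1) ^+ j.+1) `^ del.
apply: (@le_trans _ _ (\int[mu]_(x in dom tau)
   (\sum_(j < m) ((c j)%:E * (\1_(dom (T (j * 1)%N)) x * w x)%R%:E)))%E).
  apply: le_ge0_integral => x _; first by rewrite lee_fin mulr_ge0.
  rewrite /S /layers mulr_sumr -sumEFin lee_sum// => j _.
  by rewrite -EFinM lee_fin mulrCA [w x * _]mulrC.
rewrite ge0_integral_sum//; last 2 first.
- move=> j; apply: emeasurable_funM => //.
  apply: measurable_funTS; apply/measurable_EFinP/measurable_funM => //.
  by apply: measurable_indic; exact: (chain_mdom labP _ TP).
- by move=> j x _; rewrite mule_ge0 ?lee_fin ?powR_ge0// mulr_ge0// indic_ge0.
have lam0 : 0 < lam by exact: lt_le_trans lam_ge1.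
have [q0 q1] := andP q01.
apply: (@le_trans _ _ (\sum_(j < m) (2 `^ pP * lam * q ^+ j.+1)%R%:E)%E).
  apply: lee_sum => j _; rewrite ge0_integralZl//; last 3 first.
  - apply: measurable_funTS; apply/measurable_EFinP/measurable_funM => //.
    by apply: measurable_indic; exact: (chain_mdom labP _ TP).
  - by move=> x _; rewrite lee_fin mulr_ge0// indic_ge0.
  - by rewrite lee_fin powR_ge0.
  rewrite integral_mul_indic muln1.
  have Tj := mass_geometric j TP t0 mass.
  apply: (@le_trans _ _ ((c j)%:E * (2 `^ pP / lam ^+ j)%R%:E)%E).
    apply: lee_wpmul2l; first by rewrite lee_fin powR_ge0.
    apply: le_trans Tj; apply: ge0_subset_integral => //.
    - apply: measurableI => //; exact: (chain_mdom labP j TP).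
    - exact: (chain_mdom labP j TP).
    - by apply: measurable_funTS; exact/measurable_EFinP.
    - by move=> x _; rewrite lee_fin.
  rewrite -EFinM lee_fin /c expr1 powR_exprn; last by rewrite (le_trans _ a_ge2).
  apply: (@le_trans _ _ ((lam * q) ^+ j.+1 * (2 `^ pP / lam ^+ j))).
    rewrite ler_wpM2r ?divr_ge0 ?powR_ge0 ?exprn_ge0 ?(ltW lam0)//.
    by apply: lerXn2r; rewrite ?nnegrE ?powR_ge0// mulr_ge0// ltW.
  rewrite le_eqVlt; apply/orP; left; apply/eqP.
  by rewrite exprMn exprS; field; rewrite gt_eqF// exprn_gt0.
rewrite sumEFin lee_fin -mulr_sumr ler_wpM2l ?mulr_ge0 ?powR_ge0 ?(ltW lam0)//.
exact: sum_geometric_le.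
Qed.

End reverse_hoelder.

Lemma rho_midpoint f g : measurable_fun setT f -> measurable_fun setT g ->
  (forall x, 0 <= f x) -> (forall x, 0 <= g x) ->
  (rho f <= 1)%E -> (rho g <= 1)%E ->
  (rho (fun x => 2^-1 * f x + 2^-1 * g x)%R <= 1)%E.
Proof.
move=> mf mg f0 g0 rf rg.
have h20 : 0 <= 2^-1 :> R by rewrite invr_ge0.
apply: (@le_trans _ _ (\int[mu]_x (2^-1%:E * (f x `^ p x)%R%:E +
    2^-1%:E * (g x `^ p x)%R%:E)))%E.
  apply: le_ge0_integral => x _; first by rewrite lee_fin powR_ge0.
  by rewrite -!EFinM -EFinD lee_fin powR_midpoint//; exact/ltW/(p_gt1 pA).
rewrite ge0_integralD//; last 4 first.
- by move=> x _; rewrite -EFinM lee_fin mulr_ge0 ?powR_ge0.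
- by apply: emeasurable_funM => //; exact: (measurable_rho pA).
- by move=> x _; rewrite -EFinM lee_fin mulr_ge0 ?powR_ge0.
- by apply: emeasurable_funM => //; exact: (measurable_rho pA).
have halfE g' : measurable_fun setT g' ->
    (\int[mu]_x (2^-1%:E * (g' x `^ p x)%R%:E) = 2^-1%:E * rho g')%E.
  move=> mg'; rewrite ge0_integralZl//; first exact: (measurable_rho pA).
  by move=> x _; rewrite lee_fin powR_ge0.
rewrite !halfE//.
apply: (@le_trans _ _ (2^-1%:E * 1 + 2^-1%:E * 1)%E).
  have h0 : (0 <= (2^-1 : R)%:E)%E by rewrite lee_fin.
  exact: leeD (lee_wpmul2l h0 rf) (lee_wpmul2l h0 rg).
by rewrite !mule1 -EFinD lee_fin; lra.
Qed.

Lemma rho_dyadic_sum (g : nat -> X -> R) m :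
  (forall j, measurable_fun setT (g j)) -> (forall j x, 0 <= g j x) ->
  (forall j, (rho (g j) <= 1)%E) ->
  (rho (fun x => \sum_(j < m) 2^-1 ^+ j.+1 * g j x)%R <= 1)%E.
Proof.
elim: m g => [|m IH] g mg g0 rg.
  rewrite /Exponent.rho integral0_eq// => x _.
  by rewrite big_ord0 powR0// gt_eqF.
pose h x := \sum_(j < m) 2^-1 ^+ j.+1 * g j.+1 x.
rewrite (_ : (fun x => _) = fun x => 2^-1 * g 0%N x + 2^-1 * h x).
  apply: rho_midpoint => //.
  - apply: measurable_sum => j; apply: measurable_funM => //.
  - move=> x; apply: sumr_ge0 => j _.
    by rewrite mulr_ge0// exprn_ge0// invr_ge0.
  - apply: (IH (fun j => g j.+1)) => [j|j x|j]; [exact: mg|exact: g0|exact: rg].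
apply/funext => x; rewrite big_ord_recl expr1 /h mulr_sumr; congr (_ + _).
by apply: eq_bigr => j _; rewrite mulrA -exprS.
Qed.

Section left_open.
Variables (J : nat) (del : R).
Hypotheses (J_gt0 : (0 < J)%N)
  (J_large : 8 * C * (J%:R * C `^ pP) `^ pm^-1 <= J%:R)
  (del_ge0 : 0 <= del) (del_small : (a ^+ J) `^ del <= 2).

Lemma rho_chain_decay0 T f j : sparse_chain T -> measurable_fun setT f ->
  (forall x, 0 <= f x) -> (rho f <= 1)%E ->
  (rho (fun x => 4 ^+ j / C * condE (T 0%N)
     (fun y => f y * \1_(dom (T (j * J)%N)) y) x)%R <= 1)%E.
Proof.
move=> TP mf f0 rf; have C0 : 0 < C by exact: lt_le_trans C_ge1.
have tS k : stopping lab (T k) := @chain_stop _ _ _ _ _ _ TP k.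
have mD k := chain_mdom labP k TP.
have mfD k : measurable_fun setT (fun y => f y * \1_(dom (T k)) y).
  exact: measurable_mul_indic.
have fD0 k y : 0 <= f y * \1_(dom (T k)) y by rewrite mulr_ge0// indic_ge0.
case: j => [|j].
  rewrite mul0n expr0.
  have r1 : (rho (fun y => f y * \1_(dom (T 0%N)) y)%R <= 1)%E.
    by apply: le_trans rf; exact: (rho_mul_indic _ pA).
  have := ab_le1 bdd (tS 0%N) (mfD 0%N) (fD0 0%N) r1.
  by under [X in rho X]funext do rewrite mulrC -div1r.
apply: le_trans (rho_chain_decay pA labP bdd J_gt0 J_large j TP mf f0 rf).
have E0 x : 0 <= condE (T 0%N) (fun y => f y * \1_(dom (T (j.+1 * J)%N)) y) x.
  by apply: condE_ge0; exact: fD0.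
apply: (le_rho mu pA) => x.
  by rewrite mulr_ge0// divr_ge0 ?exprn_ge0// ltW.
by rewrite ler_wpM2r// ler_piMr ?exprn_ge0// invf_le1.
Qed.

(** The averaging hypothesis improves itself from the average of [f] to its
    mean of order [1 + del]. Along the Gehring chain of [f] the layers grow at
    most like [2 ^ j], while by [rho_chain_decay] the parts of [f] on them have
    averages that decay like [4 ^ (- j)] in norm. *)
Lemma left_open tau f b m : stopping lab tau -> measurable_fun setT f ->
  (forall x, 0 <= f x <= b) -> (rho f <= 1)%E -> (0 < m)%N ->
  (forall x, dom tau x -> f x <= (a ^+ J) ^+ m * condE tau f x) ->
  (rho (fun x => condE tau (fun y => f y * f y `^ del) x `^ (1 + del)^-1
     / (8 * C))%R <= 1)%E.
Proof.
move=> tS mf fb rf m0 fbound.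
have C0 : 0 < C by exact: lt_le_trans C_ge1.
have f0 x : 0 <= f x by case/andP: (fb x).
have geh := gehring_condE labD tS mf fb J_gt0 m0 del_ge0 fbound.
pose S := layers mu lab N tau f J m del.
have S0 x : 0 <= S x by exact: layers_ge0.
have mS : measurable_fun setT S := measurable_layers labD tS mf fb J m del.
have [B fSB] := layers_bound mu lab N tau fb J m del.
have mfS : measurable_fun setT (fun x => f x * S x) by exact: measurable_funM.
pose T := gehring mu lab N tau f.
have TP : sparse_chain T := gehring_sparse labD tS mf fb.
have mD k := chain_mdom labP k TP.
pose g j x := 4 ^+ j / C * condE tau (fun y => f y * \1_(dom (T (j * J)%N)) y) x.
have g0 j x : 0 <= g j x.
  rewrite mulr_ge0 ?divr_ge0 ?exprn_ge0 ?(ltW C0)//.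
  by apply: condE_ge0 => y; rewrite mulr_ge0// indic_ge0.
have mg j : measurable_fun setT (g j).
  by apply: measurable_funM => //; exact: (measurable_condE labP).
have rg j : (rho (g j) <= 1)%E by exact: (rho_chain_decay0 j TP).
pose G x := \sum_(j < m) 2^-1 ^+ j.+1 * g j x.
have G0 x : 0 <= G x.
  by apply: sumr_ge0 => j _; rewrite mulr_ge0// exprn_ge0// invr_ge0.
have mG : measurable_fun setT G.
  by apply: measurable_sum => j; exact: measurable_funM.
have rG : (rho G <= 1)%E by exact: rho_dyadic_sum.
(* growth [2 ^ j.+1] of the layers against the weights [2 ^ - j.+1] and [4 ^ j] in [G] *)
have V_le x : condE tau (fun y => f y * S y) x <= (4 * C) * G x.
  rewrite /Cells.condE; case tx : (tau x) => [i|]; last by rewrite mulr_ge0// mulr_ge0// ltW.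
  pose u j := avg (cell i x) (fun y => f y * \1_(dom (T (j * J)%N)) y).
  have iu j : mu.-integrable (cell i x)
      (EFin \o (fun y => f y * \1_(dom (T (j * J)%N)) y)).
    apply: (bounded_cell_integrable (b := b) labD).
      exact: measurable_mul_indic.
    move=> y; have /andP[_ fyb] := fb y.
    by rewrite mulr_ge0 ?indic_ge0//= (le_trans _ fyb)// ler_piMr// indic_le1.
  have u0 j : 0 <= u j by apply: avg_ge0 => y _; rewrite mulr_ge0// indic_ge0.
  have VE : avg (cell i x) (fun y => f y * S y) =
      \sum_(j < m) ((a ^+ J) ^+ j.+1) `^ del * u j.
    rewrite /S /layers; elim: (m) => [|k IH].
      rewrite big_ord0 -[RHS](avg_cst (mcell i x) (cgt0 i x) (cfin i x)).
      by apply: eq_avg => y _; rewrite big_ord0 mulr0.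
    rewrite big_ord_recr/= -IH -avgZ// -avgD//.
    - by apply: eq_avg => y _; rewrite big_ord_recr/= mulrDr; congr (_ + _); ring.
    - have [B' fSB'] := layers_bound mu lab N tau fb J k del.
      apply: (bounded_cell_integrable (b := B') labD) => //.
      by apply: measurable_funM => //; exact: (measurable_layers labD tS mf fb J k del).
    - by have := integrableZl (mcell i x) (((a ^+ J) ^+ k.+1) `^ del) (iu k);
        apply: eq_integrable.
  rewrite VE /G mulr_sumr; apply: ler_sum => j _.
  rewrite /g /Cells.condE tx -/(u j).
  rewrite (_ : 4 * C * _ = 2 ^+ j.+1 * u j); last first.
    rewrite (_ : 4 ^+ j = 2 ^+ j * 2 ^+ j); last by rewrite -exprMn; congr (_ ^+ _); ring.
    by rewrite exprVn exprS; field; rewrite gt_eqF// gt_eqF// exprn_gt0.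
  rewrite ler_wpM2r// powR_exprn; last by rewrite exprn_ge0// (le_trans _ a_ge2).
  by apply: lerXn2r => //; rewrite nnegrE ?powR_ge0// ler0n.
have rE : (rho (fun x => condE tau f x / C)%R <= 1)%E by exact: (ab_le1 bdd).
apply: le_trans (rho_midpoint _ mG _ G0 rE rG).
- apply: (le_rho mu pA) => x; first by rewrite divr_ge0 ?powR_ge0// mulr_ge0// ltW.
  rewrite ler_pdivrMr ?mulr_gt0//.
  apply: (@le_trans _ _ (condE tau f x + condE tau (fun y => f y * S y) x)).
    apply: (powR_holder_max (del := del)) => //.
    + exact: condE_ge0.
    + by apply: condE_ge0 => y; rewrite mulr_ge0.
    + by apply: condE_ge0 => y; rewrite mulr_ge0// powR_ge0.
  have e0 : 0 <= condE tau f x by exact: condE_ge0.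
  rewrite (_ : _ * (8 * C) = 4 * condE tau f x + 4 * C * G x); last first.
    by field; rewrite gt_eqF.
  by apply: lerD => //; rewrite ler_peMl// ler1n.
- by apply: measurable_funM => //; exact: (measurable_condE labP).
- by move=> x; rewrite divr_ge0 ?condE_ge0// ltW.
Qed.

End left_open.
End self_improvement.

(** * Good cells *)
Module GoodCells.

Section real_extra2.
Context {R : realType}.
Implicit Types (a b c e h l x y z p q r th : R).

(** Concavity: Young's inequality for [z ^ th] and [1]. *)
Lemma powR_tangent th z : 0 <= th <= 1 -> 0 <= z -> z `^ th <= th * z + (1 - th).
Proof.
move=> /andP[th0 th1] z0.
move: th0; rewrite le_eqVlt => /predU1P[<-|th0]; first by rewrite powRr0; lra.
move: th1; rewrite le_eqVlt => /predU1P[->|th1]; first by rewrite powRr1//; lra.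
have th1' : 0 < 1 - th by rewrite subr_gt0.
have := @conjugate_powR R (z `^ th) 1 th^-1 (1 - th)^-1 (powR_ge0 _ _) ler01.
rewrite !invr_gt0 !invrK powRK// ?gt_eqF// powR1 mulr1 mul1r.
by move=> /(_ th0 th1'); rewrite subrKC mulrC; exact.
Qed.

(** One of the two terms dominates the product, according to which of [b] and
    [a ^ (r - 1)] is larger. *)
Lemma young_max a b r : 0 <= a -> 0 <= b -> 1 < r ->
  a * b <= a `^ r + b * b `^ (r - 1)^-1.
Proof.
move=> a0 b0 r1; have r0 : 0 < r - 1 by rewrite subr_gt0.
have [ba|ab] := leP b (a `^ (r - 1)).
  apply: ler_wpDr; first by rewrite mulr_ge0 ?powR_ge0.
  rewrite -(mulr_powRB1 a0) ?(lt_trans ltr01)//.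
  by rewrite ler_wpM2l.
apply: ler_wpDl; first exact: powR_ge0.
rewrite mulrC ler_wpM2l// -[leLHS](powRK a0 (lt0r_neq0 r0)).
by apply: ler_powRl; rewrite ?powR_ge0 ?invr_ge0 ?ltW.
Qed.

Lemma powR_bounds l h y e e2 : 0 < l -> l <= y <= h -> 0 <= e <= e2 ->
  Num.min 1 l `^ e2 <= y `^ e <= Num.max 1 h `^ e2.
Proof.
move=> l0 /andP[ly yh] /andP[e0 ee].
have y0 : 0 < y by exact: lt_le_trans ly.
have m0 : 0 < Num.min 1 l by rewrite lt_min ltr01 l0.
apply/andP; split.
  apply: (@le_trans _ _ (Num.min 1 l `^ e)).
    by apply: ger_powR => //; rewrite m0 ge_min lexx.
  by apply: ler_powRl; rewrite ?(ltW m0)// ge_min ly orbT.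
apply: (@le_trans _ _ (Num.max 1 h `^ e)).
  by apply: ler_powRl; rewrite ?(ltW y0)// le_max yh orbT.
by apply: ler_powR => //; rewrite le_max lexx.
Qed.

Lemma powR_min_gt0 l e : 0 < l -> 0 < Num.min 1 l `^ e.
Proof. by move=> l0; rewrite powR_gt0// lt_min ltr01. Qed.

End real_extra2.

Section good.
Context d (X : measurableType d) (R : realType).
Variable mu : {measure set X -> \bar R}.
Variables (p : X -> R) (pm pP : R).
Hypothesis pA : bounded_exponent p pm pP.
Let mp := be_meas pA.
Let pm_gt1 := be_gt1 pA.
Let pm_le := be_ge pA.
Let p_le := be_le pA.
Local Notation avg := (avg mu).
Variables (kap K : R).
Hypotheses (kap_gt1 : 1 < kap) (kap_lt : kap < pm) (K_ge1 : 1 <= K).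

Implicit Types (f F : X -> R) (t th l h : R).

Let kap0 : 0 < kap. Proof. exact: lt_trans kap_gt1. Qed.
Let K0 : 0 < K. Proof. exact: lt_le_trans K_ge1. Qed.

Lemma ppi_gt0 x : 0 < p x - kap.
Proof. by rewrite subr_gt0 (lt_le_trans kap_lt). Qed.

Lemma ppi_bounds x : 0 <= p x - kap <= pP.
Proof.
rewrite ltW ?ppi_gt0//= lerBlDr (le_trans (p_le x))// lerDl ltW//.
Qed.

Lemma ppi_inv_bounds x : 0 <= kap / (p x - kap) <= kap / (pm - kap).
Proof.
have h0 : 0 < pm - kap by rewrite subr_gt0.
rewrite divr_ge0 ?(ltW kap0) ?(ltW (ppi_gt0 x))//= ler_wpM2l ?(ltW kap0)//.
by rewrite lef_pV2 ?posrE ?ppi_gt0// lerB.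
Qed.

Lemma measurable_ppi : measurable_fun setT (fun x => p x - kap).
Proof. exact: measurable_funB. Qed.

Lemma measurable_ppi_inv : measurable_fun setT (fun x => kap / (p x - kap)).
Proof.
apply: measurable_funM => //.
rewrite (_ : (fun x => _) = fun x => (p x - kap) `^ (-1)).
  by apply: measurable_fun_powR2 => //; exact: measurable_ppi.
by apply/funext => x; rewrite powR_inv1// ltW// ppi_gt0.
Qed.

Variable Q : set X.
Hypotheses (mQ : measurable Q) (Q_gt0 : (0 < mu Q)%E) (Q_fin : (mu Q < +oo)%E).

Definition lowpow t := avg Q (fun y => t `^ (p y - kap)).

(** Goodness is what a modular inequality on the single set [Q] at height [t]
    amounts to, expressed through its extremal test function; the exponent
    [p - kap] leaves room for the factor that is summed over heights later. *)
Definition good t := avg Q (fun y => (lowpow t / K) `^ (kap / (p y - kap))) <= t `^ kap.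

Lemma avg_bounds f l h : measurable_fun setT f -> 0 < l ->
  (forall x, Q x -> l <= f x <= h) -> l <= avg Q f <= h.
Proof.
move=> mf l0 fb; have cst_int c : 0 <= c -> mu.-integrable Q (EFin \o cst c).
  by move=> c0; apply: (bounded_integrable mQ Q_fin (b := c)) => // x _; rewrite c0/=.
have [x0 Qx0] : Q !=set0.
  apply/set0P/eqP => Q0; move: Q_gt0; rewrite Q0 measure0 ltxx//.
have fi : mu.-integrable Q (EFin \o f).
  apply: (bounded_integrable mQ Q_fin mf) => x Qx.
  by have /andP[lf fh] := fb x Qx; rewrite (le_trans (ltW l0) lf); exact: fh.
have lh : l <= h by have /andP[a b] := fb _ Qx0; exact: le_trans b.
have h0 : 0 <= h by exact: le_trans (ltW l0) lh.
apply/andP; split.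
  rewrite -[leLHS](avg_cst mQ Q_gt0 Q_fin); apply: le_avg => //.
    exact: (cst_int l (ltW l0)).
  by move=> x Qx; have /andP[] := fb x Qx.
rewrite -[leRHS](avg_cst mQ Q_gt0 Q_fin); apply: le_avg => //.
  exact: (cst_int h h0).
by move=> x Qx; have /andP[] := fb x Qx.
Qed.

Lemma lowpow_bounds t : 0 < t ->
  Num.min 1 t `^ pP <= lowpow t <= Num.max 1 t `^ pP.
Proof.
move=> t0; apply: avg_bounds.
- by apply: measurable_fun_powR2 => //; exact: measurable_ppi.
- exact: powR_min_gt0.
- by move=> x _; apply: powR_bounds => //; rewrite ?lexx// ppi_bounds.
Qed.

Lemma lowpow_gt0 t : 0 < t -> 0 < lowpow t.
Proof.
move=> t0; have /andP[le _] := lowpow_bounds t0.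
by apply: lt_le_trans le; exact: powR_min_gt0.
Qed.

(** Integrate the tangent line of [z ^ th] at the average of [f]. *)
Lemma avg_jensen f l h th : 0 <= th <= 1 -> measurable_fun setT f -> 0 < l ->
  (forall x, Q x -> l <= f x <= h) -> avg Q (fun x => f x `^ th) <= avg Q f `^ th.
Proof.
move=> th01 mf l0 fb; have [th0 th1] := andP th01.
have /andP[lm mh] := avg_bounds mf l0 fb.
set m := avg Q f in lm mh *; have m0 : 0 < m by exact: lt_le_trans lm.
have f0 x : Q x -> 0 <= f x by move=> /fb/andP[/(le_trans (ltW l0))].
have fi : mu.-integrable Q (EFin \o f).
  by apply: (bounded_integrable mQ Q_fin mf) => x Qx; rewrite f0//; have /andP[_] := fb x Qx; exact.
have h0 : 0 < h by exact: lt_le_trans mh.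
have fth x : Q x -> 0 <= f x `^ th <= h `^ th.
  move=> Qx; rewrite powR_ge0/=; have /andP[_ fh] := fb x Qx.
  by apply: ler_powRl => //; exact: f0.
have fthi : mu.-integrable Q (EFin \o (fun x => f x `^ th)).
  by apply: (bounded_integrable mQ Q_fin) => [|x Qx]; [exact: measurable_fun_powR2|exact: fth].
pose g x := m `^ th * (th / m) * f x + m `^ th * (1 - th).
have gi1 : mu.-integrable Q (EFin \o (fun x => m `^ th * (th / m) * f x)).
  by have := integrableZl mQ (m `^ th * (th / m)) fi; apply: eq_integrable.
have gi2 : mu.-integrable Q (EFin \o (fun=> m `^ th * (1 - th))).
  apply: (bounded_integrable mQ Q_fin (b := m `^ th * (1 - th))) => // x _.
  by rewrite lexx andbT mulr_ge0 ?powR_ge0// subr_ge0.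
apply: (@le_trans _ _ (avg Q g)).
  apply: le_avg => //.
    by have := integrableD mQ gi1 gi2; apply: eq_integrable => // x _; rewrite /= EFinD.
  move=> x Qx; rewrite {1}(_ : f x = m * (f x / m)); last by field; rewrite gt_eqF.
  rewrite powRM ?(ltW m0)//; last by rewrite divr_ge0 ?f0// ltW.
  rewrite /g -mulrA -mulrDr ler_wpM2l ?powR_ge0//.
  apply: (le_trans (powR_tangent th01 _)); first by rewrite divr_ge0 ?f0// ltW.
  by rewrite le_eqVlt; apply/orP; left; apply/eqP; field; rewrite gt_eqF.
rewrite avgD// avgZ// avg_cst// -/m.
by rewrite le_eqVlt; apply/orP; left; apply/eqP; field; rewrite gt_eqF.
Qed.

(** Goodness interpolates with the height [1], where it always holds: Jensen's
    inequality is applied to both averages in the definition, and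
    [K ^ th <= K] because [K >= 1]. *)
Lemma good_powR t th : 0 < t -> 0 <= th <= 1 -> good t -> good (t `^ th).
Proof.
move=> t0 th01 gt; have [th0 th1] := andP th01.
have tth0 : 0 < t `^ th by rewrite powR_gt0.
have A0 := lowpow_gt0 t0; have A0' := lowpow_gt0 tth0.
have AA : lowpow (t `^ th) <= lowpow t `^ th.
  rewrite /lowpow; under eq_avg do rewrite powRAC.
  apply: (avg_jensen th01 (l := Num.min 1 t `^ pP) (h := Num.max 1 t `^ pP)).
  - by apply: measurable_fun_powR2 => //; exact: measurable_ppi.
  - exact: powR_min_gt0.
  - by move=> x _; apply: powR_bounds => //; rewrite ?lexx// ppi_bounds.
pose G y := (lowpow t / K) `^ (kap / (p y - kap)).
have l0 : 0 < lowpow t / K := divr_gt0 A0 K0.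
have mG : measurable_fun setT G.
  by apply: measurable_fun_powR2 => //; exact: measurable_ppi_inv.
have Gb x : Num.min 1 (lowpow t / K) `^ (kap / (pm - kap)) <= G x <=
    Num.max 1 (lowpow t / K) `^ (kap / (pm - kap)).
  by apply: powR_bounds => //; rewrite ?lexx// ppi_inv_bounds.
have Gth : avg Q (fun x => G x `^ th) <= avg Q G `^ th.
  by apply: (avg_jensen th01 mG _ (fun x _ => Gb x)); exact: powR_min_gt0.
rewrite /good powRAC.
apply: (@le_trans _ _ (avg Q G `^ th)); last first.
  apply: ler_powRl; [exact: th0| |exact: gt].
  by apply: avg_ge0 => y _; exact: powR_ge0.
apply: le_trans Gth; apply: le_avg => //.
- apply: (bounded_integrable mQ Q_fin
    (b := Num.max 1 (lowpow (t `^ th) / K) `^ (kap / (pm - kap)))).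
    by apply: measurable_fun_powR2 => //; exact: measurable_ppi_inv.
  move=> x _; rewrite powR_ge0/=.
  have := @powR_bounds R (lowpow (t `^ th) / K) (lowpow (t `^ th) / K)
    (lowpow (t `^ th) / K) _ _ _ _ (ppi_inv_bounds x).
  by rewrite divr_gt0// lexx => /(_ isT isT)/andP[].
- apply: (bounded_integrable mQ Q_fin
    (b := (Num.max 1 (lowpow t / K) `^ (kap / (pm - kap))) `^ th)).
    by apply: measurable_fun_powR2.
  by move=> x _; rewrite powR_ge0/= ler_powRl ?powR_ge0//; have /andP[] := Gb x.
move=> y _; rewrite /G powRAC; apply: ler_powRl.
- by have /andP[] := ppi_inv_bounds y.
- by apply: divr_ge0; exact: ltW.
rewrite powRM ?invr_ge0 ?(ltW K0) ?(ltW A0)// powRV//.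
apply: ler_pM; [exact: ltW|by rewrite invr_ge0 ltW|exact: AA|].
rewrite lef_pV2 ?posrE ?powR_gt0//.
exact: ler1_powR.
Qed.

Definition good_const := 2 * K * 2 `^ (pP / kap).

(** Pointwise Young inequality between [F] and a multiple of
    [lowpow t / K]. By goodness, the second term it produces has average at most
    half of the left-hand side, and is absorbed there. *)
Lemma good_mass t (F : X -> R) : 0 < t -> good t -> measurable_fun setT F ->
  (forall x, 0 <= F x) -> mu.-integrable Q (EFin \o F) -> t <= avg Q F ->
  (\int[mu]_(x in Q) (t `^ p x)%R%:E <= good_const%:E *
   \int[mu]_(x in Q) (F x `^ (p x / kap) * t `^ (p x - p x / kap))%R%:E)%E.
Proof.
move=> t0 gt mF F0 Fi tF; have A0 := lowpow_gt0 t0.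
pose c := (2 `^ (pP / kap))^-1 : R.
have c0 : 0 < c by rewrite invr_gt0 powR_gt0.
(* the powers of [c] in the error term are at most [1/2], which makes it absorbable *)
pose Lam := c * (lowpow t / K).
have lK0 : 0 < lowpow t / K by rewrite divr_gt0.
have Lam0 : 0 < Lam by rewrite mulr_gt0.
pose H x := F x `^ (p x / kap) * t `^ (p x - p x / kap).
have mH : measurable_fun setT H.
  have mpk : measurable_fun setT (fun x => p x / kap) by exact: measurable_funM.
  apply: measurable_funM; first exact: measurable_fun_powR2.
  by apply: measurable_fun_powR2 => //; exact: measurable_funB.
have H0 x : 0 <= H x by rewrite mulr_ge0 ?powR_ge0.
pose G y := (lowpow t / K) `^ (kap / (p y - kap)).
have mG : measurable_fun setT G.
  by apply: measurable_fun_powR2 => //; exact: measurable_ppi_inv.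
have G0 x : 0 <= G x by exact: powR_ge0.
have GiQ : mu.-integrable Q (EFin \o G).
  apply: (bounded_integrable mQ Q_fin mG
    (b := Num.max 1 (lowpow t / K) `^ (kap / (pm - kap)))) => x _.
  rewrite G0/=; have := @powR_bounds R (lowpow t / K) (lowpow t / K)
    (lowpow t / K) _ _ lK0 _ (ppi_inv_bounds x).
  by rewrite lexx => /(_ isT)/andP[].
have pw x : Lam * t `^ (kap - 1) * F x <= H x + (Lam / 2) * G x.
  have pi0 := ppi_gt0 x; have p0 := p_gt0 pA x.
  have r1 : 1 < p x / kap by rewrite ltr_pdivlMr// mul1r -subr_gt0.
  have Y := @young_max R (F x * t `^ (kap - 1)) Lam (p x / kap)
    (mulr_ge0 (F0 x) (powR_ge0 _ _)) (ltW Lam0) r1.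
  rewrite (_ : Lam * t `^ (kap - 1) * F x = F x * t `^ (kap - 1) * Lam); last by ring.
  apply: (le_trans Y); apply: lerD.
    rewrite /H powRM ?powR_ge0// -powRrM le_eqVlt; apply/orP; left; apply/eqP.
    by congr (_ * _ `^ _); field; rewrite gt_eqF.
  rewrite -mulrA ler_wpM2l ?(ltW Lam0)// /Lam.
  rewrite (_ : (p x / kap - 1)^-1 = kap / (p x - kap)); last first.
    by field; rewrite !gt_eqF.
  rewrite powRM ?(ltW c0) ?(ltW lK0)// -/(G x) ler_wpM2r//.
  rewrite /c powRV ?powR_gt0// -powRrM lef_pV2 ?posrE ?powR_gt0//.
  apply: le1r_powR; first by rewrite ler1n.
  rewrite mulrA divfK ?gt_eqF// ler_pdivlMr// mul1r.
  by have /andP[] := ppi_bounds x.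
have ineq : ((Lam / 2 * t `^ kap)%R%:E * mu Q <= \int[mu]_(x in Q) (H x)%:E)%E.
  have LF : ((Lam * t `^ kap)%R%:E * mu Q <=
      \int[mu]_(x in Q) ((Lam * t `^ (kap - 1)) * F x)%R%:E)%E.
    have iLF : mu.-integrable Q (EFin \o (fun x => (Lam * t `^ (kap - 1)) * F x)).
      by have := integrableZl mQ (Lam * t `^ (kap - 1)) Fi; apply: eq_integrable.
    rewrite (integral_avg mQ Q_gt0 Q_fin iLF) avgZ// lee_wpmul2r//.
    rewrite lee_fin -mulrA ler_wpM2l ?(ltW Lam0)//.
    rewrite -(mulr_powRB1 (ltW t0) kap0) mulrC ler_wpM2l ?powR_ge0//.
  have LG : (\int[mu]_(x in Q) ((Lam / 2) * G x)%R%:E <=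
      (Lam / 2 * t `^ kap)%R%:E * mu Q)%E.
    have iLG : mu.-integrable Q (EFin \o (fun x => (Lam / 2) * G x)).
      by have := integrableZl mQ (Lam / 2) GiQ; apply: eq_integrable.
    rewrite (integral_avg mQ Q_gt0 Q_fin iLG) avgZ// lee_wpmul2r//.
    by rewrite lee_fin ler_wpM2l// divr_ge0// ltW.
  have tot : ((Lam * t `^ kap)%R%:E * mu Q <= \int[mu]_(x in Q) (H x)%:E +
      (Lam / 2 * t `^ kap)%R%:E * mu Q)%E.
    apply: (le_trans LF); apply: le_trans (leeD (lexx _) LG).
    have LG0 x : 0 <= Lam / 2 * G x by rewrite mulr_ge0// divr_ge0// ltW.
    rewrite -integral_addR//; last exact: measurable_funM.
    apply: le_ge0_integral => x _; last by rewrite lee_fin.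
    by rewrite lee_fin; apply: mulr_ge0 => //; apply: mulr_ge0; [exact: ltW|exact: powR_ge0].
  move: tot; rewrite -(fineQ Q_gt0 Q_fin) -!EFinM -leeBlDr// -EFinB.
  by congr (_ <= _)%E; congr (_%:E); field.
have -> : (\int[mu]_(x in Q) (t `^ p x)%R%:E =
    (good_const * (Lam / 2 * t `^ kap))%R%:E * mu Q)%E.
  transitivity (\int[mu]_(x in Q) (t `^ kap * t `^ (p x - kap))%R%:E)%E.
    apply: eq_integral => x _; rewrite -powRD; first by rewrite subrKC.
    by rewrite (gt_eqF t0) implybT.
  have ti : mu.-integrable Q (EFin \o (fun x => t `^ (p x - kap))).
    apply: (bounded_integrable mQ Q_fin (b := Num.max 1 t `^ pP)).
      by apply: measurable_fun_powR2 => //; exact: measurable_ppi.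
    move=> x _; rewrite powR_ge0/=.
    have := @powR_bounds R t t t _ _ t0 _ (ppi_bounds x).
    by rewrite lexx => /(_ isT)/andP[].
  have ti' : mu.-integrable Q (EFin \o (fun x => t `^ kap * t `^ (p x - kap))).
    by have := integrableZl mQ (t `^ kap) ti; apply: eq_integrable.
  rewrite (integral_avg mQ Q_gt0 Q_fin ti') avgZ// -/(lowpow t).
  congr (_%:E * _)%E; rewrite /good_const /Lam /c.
  by field; rewrite !gt_eqF// powR_gt0.
rewrite EFinM -muleA lee_wpmul2l// lee_fin.
by rewrite /good_const !mulr_ge0 ?powR_ge0// ltW.
Qed.

End good.

End GoodCells.
Export GoodCells.

(** * Families of bad cells *)
Module Mass.

Section bad_cells.
Context d (X : measurableType d) (R : realType).
Variable mu : {measure set X -> \bar R}.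
Variables (p : X -> R) (pm pP : R).
Hypothesis pA : bounded_exponent p pm pP.
Let mp := be_meas pA.
Let pm_gt1 := be_gt1 pA.
Let pm_le := be_ge pA.
Let p_le := be_le pA.
Variables (lab : nat -> X -> nat) (N : R).
Hypothesis labD : dyadic mu lab N.
Let labP := dy_cells labD.
Variable C : R.
Hypothesis bdd : averages_bounded mu p lab C.
Let C_ge1 := ab_ge1 bdd.
Local Notation condE := (condE mu lab).
Local Notation avg := (avg mu).
Local Notation cell := (cell lab).
Local Notation rho := (rho mu p).
Let mcell := measurable_cell labP.
Let cgt0 := cell_gt0 labP.
Let cfin := cell_fin labP.
Local Hint Resolve mcell cgt0 cfin : core.
Local Notation a := (2 * N).

Variables (kap K lam q : R) (J : nat).
Hypotheses (kap_gt1 : 1 < kap) (kap_lt : kap < pm) (K_ge1 : 1 <= K).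
Hypotheses (lam_ge1 : 1 <= lam) (lam_gap : lam `^ pP * (1 - decay_gap pP C) <= 1)
  (q01 : 0 <= q < 1) (rh_small : a `^ (kap - 1) <= lam * q).
Hypotheses (J_gt0 : (0 < J)%N)
  (J_large : 8 * C * (J%:R * C `^ pP) `^ pm^-1 <= J%:R)
  (lo_small : (a ^+ J) `^ (kap * kap - 1) <= 2).
Hypothesis K_large : (16 * C) `^ pP * rh_const pP lam q <= K `^ kap^-1.

Local Notation good := (good mu p kap K).
Local Notation lowpow := (lowpow mu p kap).

Definition mass (D : set X) (t : R) : \bar R :=
  (\int[mu]_(x in D) (t `^ p x)%R%:E)%E.

Let kap0 : 0 < kap. Proof. exact: lt_trans kap_gt1. Qed.
Let K0 : 0 < K. Proof. exact: lt_le_trans K_ge1. Qed.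
Let C0 : 0 < C. Proof. exact: lt_le_trans C_ge1. Qed.
Let a_ge2 : 2 <= a. Proof. by have := N_ge1 labD; lra. Qed.

Lemma measurable_powp t : measurable_fun setT (fun x => t `^ p x).
Proof. exact: measurable_fun_powR2. Qed.

Section test_function.
Variables (tau : X -> option nat) (t : R).
Hypotheses (tS : stopping lab tau) (t_gt0 : 0 < t)
  (tau_bad : forall x i, tau x = Some i -> ~ good (cell i x) (t `^ kap)).

Let tk_gt0 : 0 < t `^ kap. Proof. exact: powR_gt0. Qed.

(** Off the family the value is immaterial; [1] keeps the powers below positive
    and measurable. *)
Definition lowE x := if tau x is Some i then lowpow (cell i x) (t `^ kap) else 1.

(** The function whose mean of order [kap ^ 2] exceeds [t] on every member: this
    is exactly the failure of goodness at height [t ^ kap], see [height_gt]. *)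
Definition extremal x := (lowE x / K) `^ (kap * (p x - kap))^-1.

Definition height x :=
  if tau x is Some i then avg (cell i x) (fun y => extremal y `^ (kap * kap)) else 1.

(** [extremal], rescaled on each member so that its mean of order [kap ^ 2] is
    exactly [t]. *)
Definition test x := extremal x * (t / height x `^ (kap * kap)^-1) * \1_(dom tau) x.

Let lo := Num.min 1 (Num.min 1 (t `^ kap) `^ pP / K) `^ (kap * (pm - kap))^-1.
Let hi := Num.max 1 (Num.max 1 (t `^ kap) `^ pP / K) `^ (kap * (pm - kap))^-1.

Let lK_gt0 : 0 < Num.min 1 (t `^ kap) `^ pP / K.
Proof. by rewrite divr_gt0// powR_min_gt0. Qed.

Let lo_gt0 : 0 < lo. Proof. exact: powR_min_gt0. Qed.

Lemma lowE_bounds x : tau x <> None ->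
  Num.min 1 (t `^ kap) `^ pP <= lowE x <= Num.max 1 (t `^ kap) `^ pP.
Proof.
rewrite /lowE; case: (tau x) => // i _.
exact: (lowpow_bounds pA kap_gt1 kap_lt).
Qed.

Lemma lowE_gt0 x : 0 < lowE x.
Proof.
case tx : (tau x) => [i|]; last by rewrite /lowE tx.
have : tau x <> None by rewrite tx.
by move=> /lowE_bounds/andP[+ _]; apply: lt_le_trans; exact: powR_min_gt0.
Qed.

Lemma lowE_cell : cell_const lab tau lowE.
Proof. by move=> x y i tx cy; rewrite /lowE (tS tx cy) tx (eq_cell cy). Qed.

Lemma height_cell : cell_const lab tau height.
Proof. by move=> x y i tx cy; rewrite /height (tS tx cy) tx (eq_cell cy). Qed.

Let kpi_gt0 x : 0 < kap * (p x - kap).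
Proof. by rewrite mulr_gt0// (ppi_gt0 pA). Qed.

Lemma extremal_bounds x : tau x <> None -> lo <= extremal x <= hi.
Proof.
move=> Dx; have /andP[l1 l2] := lowE_bounds Dx.
have pk : 0 < pm - kap by rewrite subr_gt0.
have e2 : 0 <= (kap * (p x - kap))^-1 <= (kap * (pm - kap))^-1.
  rewrite invr_ge0 ltW//= lef_pV2 ?posrE ?mulr_gt0 ?(ppi_gt0 pA)//.
  by rewrite ler_wpM2l ?(ltW kap0)// lerB.
have lb : Num.min 1 (t `^ kap) `^ pP / K <= lowE x / K <= Num.max 1 (t `^ kap) `^ pP / K.
  by rewrite !ler_pM2r ?invr_gt0// l1 l2.
exact: powR_bounds lK_gt0 lb e2.
Qed.

Lemma extremal_ge0 x : 0 <= extremal x. Proof. exact: powR_ge0. Qed.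

Lemma measurable_extremal : measurable_fun setT extremal.
Proof.
apply: measurable_fun_powR2.
  apply: measurable_funM => //.
  rewrite (_ : lowE = fun x => (lowE x - 1) + 1); last by apply/funext => x; rewrite subrK.
  apply: measurable_funD => //; apply: (measurable_cell_const0 labP tS).
    by move=> x y i tx cy; rewrite (lowE_cell tx cy).
  by move=> x tx; rewrite /lowE tx subrr.
rewrite (_ : (fun x => _) = fun x => (kap * (p x - kap)) `^ (-1)).
  by apply: measurable_fun_powR2 => //; apply: measurable_funM => //;
    exact: measurable_funB.
by apply/funext => x; rewrite powR_inv1// ltW.
Qed.

Lemma measurable_height : measurable_fun setT height.
Proof.
rewrite (_ : height = fun x => (height x - 1) + 1); last by apply/funext => x; rewrite subrK.
apply: measurable_funD => //; apply: (measurable_cell_const0 labP tS).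
  by move=> x y i tx cy; rewrite (height_cell tx cy).
by move=> x tx; rewrite /height tx subrr.
Qed.

Let ebound x i : tau x = Some i -> forall y, cell i x y -> 0 <= extremal y <= hi.
Proof.
move=> tx y cy; rewrite extremal_ge0/=.
have ty : tau y <> None by rewrite (tS tx cy).
by have /andP[] := extremal_bounds ty.
Qed.

Let eint x i r : 0 <= r -> tau x = Some i ->
  mu.-integrable (cell i x) (EFin \o (fun y => extremal y `^ r)).
Proof.
move=> r0 tx; apply: (bounded_integrable (mcell i x) (cfin i x) (b := hi `^ r)).
  by apply: measurable_fun_powR2 => //; exact: measurable_extremal.
move=> y cy; rewrite powR_ge0/=.
by have /andP[e0 eh] := ebound tx cy; exact: ler_powRl.
Qed.

Lemma height_gt x i : tau x = Some i -> t `^ (kap * kap) < height x.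
Proof.
move=> tx; have := tau_bad tx; rewrite /GoodCells.good => /negP; rewrite -ltNge -powRrM.
move=> /lt_le_trans; apply; rewrite /height tx le_eqVlt; apply/orP; left; apply/eqP.
apply: eq_avg => y cy; rewrite /extremal -powRrM /lowE (tS tx cy) (eq_cell cy).
congr (_ `^ _); have := kpi_gt0 y; have := ppi_gt0 pA kap_lt y => h1 h2.
by field; rewrite !gt_eqF.
Qed.

Let height_gt0 x : 0 < height x.
Proof.
case tx : (tau x) => [i|]; last by rewrite /height tx.
by apply: lt_trans (height_gt tx); rewrite powR_gt0.
Qed.

Let kk0 : 0 < kap * kap. Proof. exact: mulr_gt0. Qed.

Let ratio x := t / height x `^ (kap * kap)^-1.

Let ratio_gt0 x : 0 < ratio x.
Proof. by rewrite divr_gt0// powR_gt0. Qed.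

Let ratio_le1 x i : tau x = Some i -> ratio x <= 1.
Proof.
move=> tx; rewrite /ratio ler_pdivrMr ?powR_gt0// mul1r.
rewrite -[leLHS](powRK (ltW t_gt0) (lt0r_neq0 kk0)).
by apply: ler_powRl; rewrite ?powR_ge0 ?invr_ge0 ?(ltW kk0)// ltW// (height_gt tx).
Qed.

Lemma test_ge0 x : 0 <= test x.
Proof.
rewrite /test mulr_ge0 ?indic_ge0//; apply: mulr_ge0; first exact: extremal_ge0.
exact: ltW (ratio_gt0 x).
Qed.

Lemma measurable_test : measurable_fun setT test.
Proof.
have mD := measurable_dom labP tS.
apply: measurable_funM => //; apply: measurable_funM; first exact: measurable_extremal.
rewrite (_ : (fun x => _) = fun x => t * (height x `^ (kap * kap)^-1) `^ (-1)).
  apply: measurable_funM => //; apply: measurable_fun_powR2 => //.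
  by apply: measurable_fun_powR2 => //; exact: measurable_height.
by apply/funext => x; rewrite powR_inv1// powR_ge0.
Qed.

Lemma test_in x i : tau x = Some i -> test x = extremal x * ratio x.
Proof. by move=> tx; rewrite /test indic_in ?mulr1// /dom/= tx. Qed.

Lemma test_out x : tau x = None -> test x = 0.
Proof. by move=> tx; rewrite /test indic_out ?mulr0// /dom/= tx. Qed.

Let ratio_cell x i y : tau x = Some i -> cell i x y -> ratio y = ratio x.
Proof. by move=> tx cy; rewrite /ratio (height_cell tx cy). Qed.

Lemma avg_test x i : tau x = Some i ->
  avg (cell i x) (fun y => test y `^ (kap * kap)) = t `^ (kap * kap).
Proof.
move=> tx; have hE : height x = avg (cell i x) (fun y => extremal y `^ (kap * kap)).
  by rewrite /height tx.
transitivity (avg (cell i x) (fun y => ratio x `^ (kap * kap) * extremal y `^ (kap * kap))).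
  apply: eq_avg => y cy; rewrite (test_in (tS tx cy)) (ratio_cell tx cy).
  by rewrite powRM ?extremal_ge0 ?(ltW (ratio_gt0 x))// mulrC.
rewrite avgZ//; last by apply: eint => //; exact: ltW.
rewrite -hE /ratio powRM ?invr_ge0 ?powR_ge0 ?(ltW t_gt0)//.
rewrite powRV ?powR_gt0// powRVK ?(ltW (height_gt0 x)) ?lt0r_neq0//.
by rewrite divfK// lt0r_neq0.
Qed.

(** Write [test ^ p] as [test ^ (p - kap) * test ^ kap]. The first factor is at
    most [(lowE / K) ^ (1 / kap)], by the choice of exponent in [extremal]; the
    second has average at most [t ^ kap] by Jensen's inequality. Since
    [lowE * t ^ (kap ^ 2)] is the average of [t ^ (kap p)], the product is
    controlled by the reverse Hoelder inequality, with a gain from [K]. *)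
Lemma rho_test : (mass (dom tau) t <= 2%:E)%E ->
  (rho test <= (rh_const pP lam q / K `^ kap^-1)%R%:E)%E.
Proof.
move=> m2; have mD := measurable_dom labP tS.
have kV : 0 <= kap^-1 by rewrite invr_ge0 ltW.
have pk x : 0 < p x - kap by exact: (ppi_gt0 pA).
have := reverse_hoelder pA labD bdd lam_ge1 lam_gap q01 (del := kap - 1) _ rh_small
  tS t_gt0 m2.
rewrite subr_ge0 (ltW kap_gt1) => /(_ isT) RH.
pose phi x := (lowE x / K) `^ kap^-1.
have phi0 x : 0 <= phi x by exact: powR_ge0.
have mphi : measurable_fun (dom tau) phi.
  apply: (measurable_cell_const labP tS).
  by move=> x y i tx cy; rewrite /phi (lowE_cell tx cy).
pose g x := test x `^ kap.
have mg : measurable_fun setT g.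
  by apply: measurable_fun_powR2 => //; exact: measurable_test.
have g0 x : 0 <= g x by exact: powR_ge0.
have gi : cell_integrable mu lab tau g.
  move=> x i tx; apply: (bounded_integrable (mcell i x) (cfin i x) mg (b := hi `^ kap)).
  move=> y cy; rewrite g0/=; apply: ler_powRl; rewrite ?test_ge0 ?(ltW kap0)//.
  have /andP[e0 eh] := ebound tx cy.
  rewrite (test_in (tS tx cy)); apply: le_trans eh.
  by rewrite ler_piMr// (ratio_le1 (tS tx cy)).
apply: (@le_trans _ _ (\int[mu]_(x in dom tau) (phi x * g x)%R%:E)%E).
  rewrite /Exponent.rho (@integral_cell_dom _ _ _ mu setT (dom tau) (fun x => test x `^ p x)).
    rewrite setIT; apply: le_ge0_integral => x Dx; first by rewrite lee_fin powR_ge0.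
    move: Dx; rewrite /dom/=; case tx : (tau x) => [i|//] _; rewrite lee_fin.
    rewrite {1}(_ : p x = (p x - kap) + kap); last by rewrite subrK.
    rewrite powRD; last by rewrite subrK gt_eqF// (p_gt0 pA).
    rewrite ler_wpM2r ?powR_ge0//.
    rewrite (_ : phi x = extremal x `^ (p x - kap)); last first.
      rewrite /phi /extremal -powRrM; congr (_ `^ _).
      by field; rewrite !gt_eqF.
    apply: ler_powRl; rewrite ?test_ge0 ?(ltW (pk x))//.
    by rewrite (test_in tx) ler_piMr ?extremal_ge0// (ratio_le1 tx).
  move=> x Dx; rewrite test_out; last first.
    by case tx : (tau x) => [i|//]; exfalso; apply: Dx; rewrite /dom/= tx.
  by rewrite powR0// gt_eqF// (p_gt0 pA).
rewrite -(integral_condE labP tS (phi := phi) mg g0 phi0); last 2 first.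
- by move=> x y i tx cy; rewrite /phi (lowE_cell tx cy).
- exact: gi.
rewrite (_ : (_ / _)%:E = ((K `^ kap^-1)^-1)%:E * (rh_const pP lam q)%:E)%E; last first.
  by rewrite -EFinM mulrC.
apply: le_trans (lee_wpmul2l _ RH); last by rewrite lee_fin invr_ge0 powR_ge0.
pose w x := condE tau (fun y => t `^ p y * (t `^ p y) `^ (kap - 1)) x `^ (1 + (kap - 1))^-1.
have mw : measurable_fun setT w.
  by apply: measurable_fun_powR2 => //; exact: (measurable_condE labP).
have w0 x : 0 <= w x by exact: powR_ge0.
rewrite -(integral_scaleR mu mD mw w0); last by rewrite invr_ge0 powR_ge0.
apply: le_ge0_integral => x Dx; first by rewrite lee_fin mulr_ge0 ?condE_ge0.
move: Dx; rewrite /dom/=; case tx : (tau x) => [i|//] _; rewrite lee_fin.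
(* Jensen: the mean of order [kap] is at most the mean of order [kap ^ 2] *)
have Eg : condE tau g x <= t `^ kap.
  rewrite /Cells.condE tx.
  have -> : t `^ kap = avg (cell i x) (fun y => test y `^ (kap * kap)) `^ kap^-1.
    by rewrite (avg_test tx) -powRrM mulfK// gt_eqF.
  rewrite (@eq_avg _ _ _ mu _ g (fun y => (test y `^ (kap * kap)) `^ kap^-1)); last first.
    by move=> y cy; rewrite -powRrM mulfK// gt_eqF.
  apply: (avg_jensen (mcell i x) (cgt0 i x) (cfin i x)
    (l := (lo * ratio x) `^ (kap * kap)) (h := hi `^ (kap * kap))).
  - by rewrite kV/= invf_le1// ltW.
  - by apply: measurable_fun_powR2 => //; exact: measurable_test.
  - by rewrite powR_gt0// mulr_gt0.
  - move=> y cy; have ty := tS tx cy.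
    have Dy : tau y <> None by rewrite ty.
    have /andP[el eh] := extremal_bounds Dy.
    rewrite (test_in ty) (ratio_cell tx cy); apply/andP; split; apply: ler_powRl.
    + exact: ltW.
    + exact: (mulr_ge0 (ltW lo_gt0) (ltW (ratio_gt0 x))).
    + by rewrite ler_wpM2r// ltW.
    + exact: ltW.
    + by rewrite mulr_ge0 ?extremal_ge0// ltW.
    + by apply: le_trans eh; rewrite ler_piMr ?extremal_ge0// (ratio_le1 tx).
apply: (@le_trans _ _ (phi x * t `^ kap)); first by rewrite ler_wpM2l.
rewrite /phi /w powRM ?invr_ge0 ?(ltW K0) ?(ltW (lowE_gt0 x))// powRV//.
rewrite mulrAC [leRHS]mulrC ler_wpM2r ?invr_ge0 ?powR_ge0//.
rewrite (_ : 1 + (kap - 1) = kap); last by rewrite addrC subrK.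
rewrite -{1}(powRK (powR_ge0 t kap) (lt0r_neq0 kap0)) -powRM ?powR_ge0 ?(ltW (lowE_gt0 x))//.
apply: ler_powRl; rewrite ?mulr_ge0 ?powR_ge0 ?(ltW (lowE_gt0 x))//.
rewrite /lowE /Cells.condE tx /GoodCells.lowpow mulrC -(avgZ (mcell i x)); last first.
  apply: (bounded_integrable (mcell i x) (cfin i x) (b := Num.max 1 (t `^ kap) `^ pP)).
    by apply: measurable_fun_powR2 => //; exact: (measurable_ppi pA).
  move=> y _; rewrite powR_ge0/=.
  have := @powR_bounds R (t `^ kap) (t `^ kap) (t `^ kap) _ _ tk_gt0 _
    (ppi_bounds pA kap_gt1 kap_lt y).
  by rewrite lexx => /(_ isT)/andP[].
rewrite le_eqVlt; apply/orP; left; apply/eqP; apply: eq_avg => y _.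
rewrite -!powRrM -!powRD; try by rewrite (gt_eqF t_gt0) implybT.
by congr (_ `^ _); ring.
Qed.

(** [test] is bounded above and below on the family, which is the a priori bound
    on the length of Gehring chains in [left_open]. *)
Lemma test_bound m : 0 < m -> exists2 k, (0 < k)%N & forall x, dom tau x ->
  m * test x <= (a ^+ J) ^+ k * condE tau (fun y => m * test y) x.
Proof.
move=> m0; have aJ2 : 2 <= a ^+ J.
  case: (J) J_gt0 => // j _; rewrite exprS; apply: (le_trans a_ge2).
  have a1 : 1 <= a by apply: le_trans a_ge2; rewrite ler1n.
  by rewrite ler_peMr ?(le_trans ler01)// exprn_ege1.
have [k k0 hk] := expr_unbounded (hi / lo) aJ2; exists k => // x.
rewrite /dom/=; case tx : (tau x) => [i|//] _; rewrite /Cells.condE tx.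
have Dx : tau x <> None by rewrite tx.
have r0 := ratio_gt0 x.
have lr0 : 0 <= lo * ratio x := mulr_ge0 (ltW lo_gt0) (ltW r0).
have mt0 : 0 <= m * (lo * ratio x) := mulr_ge0 (ltW m0) lr0.
have low : m * (lo * ratio x) <= avg (cell i x) (fun y => m * test y).
  rewrite -{1}(avg_cst (mcell i x) (cgt0 i x) (cfin i x) (m * (lo * ratio x))).
  apply: le_avg => //.
  - apply: (bounded_integrable (mcell i x) (cfin i x) (b := m * (lo * ratio x))) => // y _.
    by rewrite mt0/=.
  - apply: (bounded_integrable (mcell i x) (cfin i x) (b := m * hi)).
      by apply: measurable_funM => //; exact: measurable_test.
    move=> y cy; rewrite mulr_ge0 ?test_ge0 ?(ltW m0)//= ler_wpM2l ?(ltW m0)//.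
    have /andP[e0 eh] := ebound tx cy; rewrite (test_in (tS tx cy)).
    by apply: le_trans eh; rewrite ler_piMr// (ratio_le1 (tS tx cy)).
  - move=> y cy; have Dy : tau y <> None by rewrite (tS tx cy).
    have /andP[el eh] := extremal_bounds Dy.
    rewrite (test_in (tS tx cy)) (ratio_cell tx cy) ler_wpM2l ?(ltW m0)//.
    by rewrite ler_wpM2r// ltW.
apply: (@le_trans _ _ ((a ^+ J) ^+ k * (m * (lo * ratio x)))); last first.
  by rewrite ler_wpM2l// !exprn_ge0// (le_trans _ a_ge2).
rewrite (test_in tx) [leRHS]mulrCA ler_wpM2l ?(ltW m0)// [leRHS]mulrA ler_wpM2r ?(ltW r0)//.
have /andP[_ eh] := extremal_bounds Dx; apply: (le_trans eh).
by rewrite -ler_pdivrMr.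
Qed.

(** For large [K], the function [16 C test] has modular at most [1] by
    [rho_test]; but its mean of order [kap ^ 2] is [16 C t] on every member, so
    [left_open] bounds by [1] the mass at height [2 t]. *)
Lemma bad_mass : (mass (dom tau) t <= 2%:E)%E -> (mass (dom tau) t <= (2^-1)%R%:E)%E.
Proof.
move=> m2; have mD := measurable_dom labP tS.
have C16 : 0 < 16 * C by rewrite mulr_gt0.
pose F x := 16 * C * test x.
have F0 x : 0 <= F x by rewrite mulr_ge0 ?test_ge0// ltW.
have mF : measurable_fun setT F by apply: measurable_funM => //; exact: measurable_test.
have rF : (rho F <= 1)%E.
  apply: le_trans (rhoZ_ge1 mu pA _ measurable_test test_ge0) _.
    by have := C_ge1; lra.
  apply: le_trans (lee_wpmul2l _ (rho_test m2)) _; first by rewrite lee_fin powR_ge0.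
  by rewrite -EFinM lee_fin mulrA ler_pdivrMr ?powR_gt0// mul1r.
have Fb x : 0 <= F x <= 16 * C * hi.
  rewrite F0/= ler_wpM2l ?(ltW C16)//.
  case tx : (tau x) => [i|]; last first.
    by rewrite test_out// powR_ge0.
  have /andP[e0 eh] := ebound tx (cell_refl lab i x).
  by rewrite (test_in tx); apply: le_trans eh; rewrite ler_piMr// (ratio_le1 tx).
have [k k0 Fk] := test_bound C16.
have del0 : 0 <= kap * kap - 1 by rewrite subr_ge0 mulr_ege1 ?ltW.
have := left_open pA labD bdd J_gt0 J_large del0 lo_small tS mF Fb rF k0 Fk => LO.
have m2t : (mass (dom tau) (2 * t) <= 1)%E.
  rewrite /mass -(rho_indic mu pA (fun=> 2 * t) mD).
  apply: le_trans LO; apply: (le_rho mu pA) => x.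
    by rewrite mulr_ge0 ?indic_ge0// mulr_ge0// ltW.
  have [Dx|Dx] := pselect (dom tau x); last first.
    by rewrite indic_out// mul0r divr_ge0 ?powR_ge0// mulr_ge0// ltW.
  move: (Dx); rewrite /dom/=; case tx : (tau x) => [i|//] _.
  rewrite indic_in// mul1r subrKC /Cells.condE tx.
  have -> : avg (cell i x) (fun y => F y * F y `^ (kap * kap - 1)) =
      (16 * C * t) `^ (kap * kap).
    rewrite (powRM _ (ltW C16) (ltW t_gt0)) -(avg_test tx) -(avgZ (mcell i x)); last first.
      apply: (bounded_integrable (mcell i x) (cfin i x) (b := hi `^ (kap * kap))).
        by apply: measurable_fun_powR2 => //; exact: measurable_test.
      move=> y cy; rewrite powR_ge0/=; apply: ler_powRl; rewrite ?test_ge0 ?(ltW kk0)//.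
      have /andP[e0 eh] := ebound tx cy; rewrite (test_in (tS tx cy)).
      by apply: le_trans eh; rewrite ler_piMr// (ratio_le1 (tS tx cy)).
    by apply: eq_avg => y _; rewrite (mulr_powRB1 (F0 y) kk0) (powRM _ (ltW C16) (test_ge0 y)).
  rewrite powRK ?lt0r_neq0// ?mulr_ge0 ?(ltW C0) ?(ltW t_gt0)//.
  by rewrite le_eqVlt; apply/orP; left; apply/eqP; field; rewrite gt_eqF.
apply: (@le_trans _ _ (2^-1%:E * mass (dom tau) (2 * t))%E).
  rewrite /mass -(integral_scaleR mu mD (measurable_powp _)) ?invr_ge0//; last first.
    by move=> x; exact: powR_ge0.
  apply: le_ge0_integral => x _; first by rewrite lee_fin powR_ge0.
  rewrite lee_fin {1}(_ : t = 2^-1 * (2 * t)); last by field.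
  apply: le_trans (le1_powRM (q := 1) _ _ _ _) _.
  - by rewrite invr_ge0 ler0n invf_le1 ?ler1n.
  - by rewrite mulr_ge0// ltW.
  - exact: ltr01.
  - exact/ltW/(p_gt1 pA).
  - by rewrite powRr1// invr_ge0.
by rewrite -[leRHS]mule1; apply: lee_wpmul2l => //; rewrite lee_fin invr_ge0.
Qed.

End test_function.

Definition single i x (y : X) : option nat := if lab i y == lab i x then Some i else None.

Lemma single_stop i x : stopping lab (single i x).
Proof.
move=> y z j; rewrite /single; case: eqP => // yx [<-] cz.
by rewrite (_ : lab i z == lab i x)//; apply/eqP; rewrite -yx.
Qed.

Lemma dom_single i x : dom (single i x) = cell i x.
Proof.
apply/seteqP; split => y; rewrite /dom/single/Cells.cell/=; first by case: eqP.
by move=> ->; rewrite eqxx.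
Qed.

(** A bad cell of mass at most [2] would have mass at most [1/2] by
    [bad_mass]. *)
Lemma good_of_mass i x t : 0 < t -> (1 < mass (cell i x) t <= 2%:E)%E ->
  good (cell i x) (t `^ kap).
Proof.
move=> t0 /andP[m1 m2]; apply: contrapT => ng.
have : (mass (dom (single i x)) t <= (2^-1)%R%:E)%E.
  apply: (bad_mass (@single_stop i x) t0); last (rewrite dom_single; exact: m2).
  move=> y j; rewrite /single; case: eqP => [yx [<-]|_ h]; last discriminate h.
  rewrite (eq_cell (x := x) (y := y) yx); exact: ng.
rewrite dom_single => /(lt_le_trans m1); rewrite lte_fin ltNge invf_le1//.
by rewrite ler1n.
Qed.

(** The members are added one at a time: one more member brings the total from
    at most [1/2] to at most [3/2], and [bad_mass] brings it back to at most
    [1/2]. So the smallness assumption of [bad_mass] costs nothing. *)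
Lemma bad_total tau t : stopping lab tau -> 0 < t ->
  (forall x i, tau x = Some i -> (mass (cell i x) t <= 1)%E /\
     ~ good (cell i x) (t `^ kap)) ->
  (mass (dom tau) t <= (2^-1)%R%:E)%E.
Proof.
move=> tS t0 bad; have mpc := measurable_piece labP tS.
apply: (@integral_bigcup_le _ _ _ mu _ (piece lab tau)).
- exact: mpc.
- exact: trivIset_piece.
- exact: bigcup_piece.
- by apply: measurable_funTS; apply/measurable_EFinP; exact: measurable_powp.
- by move=> x _; rewrite lee_fin powR_ge0.
pose U m := \big[setU/set0]_(0 <= k < m) piece lab tau k.
have UE m x : U m x <-> exists2 k, (k < m)%N & piece lab tau k x.
  by rewrite /U big_mkord -bigcup_mkord; split => -[k km pk]; exists k => //.
(* the family formed by the first [m] members *)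
pose sub m x := if pselect (U m x) then tau x else None.
have sS m : stopping lab (sub m).
  move=> x y i; rewrite /sub; case: (pselect (U m x)) => [Ux|//] /= tx cy.
  case: (pselect (U m y)) => [Uy|nUy] /=; first exact: (tS _ _ _ tx cy).
  suff Uy : U m y by case: (nUy Uy).
  have [k km pk] := (UE m x).1 Ux; apply: (UE m y).2; exists k => //.
  by have [j tj pE] := pieceP tS pk; rewrite pE; move: tj; rewrite tx => -[<-].
have sD m : dom (sub m) = U m.
  apply/seteqP; split => x; rewrite /dom/sub/=; first by case: pselect.
  move=> Ux; case: (pselect (U m x)) => [_|//] /=; have [k _ pk] := (UE m x).1 Ux.
  by have [j -> _] := pieceP tS pk.
have mU m : measurable (U m) by rewrite -sD; exact: (measurable_dom labP).
have sbad m x i : sub m x = Some i -> ~ good (cell i x) (t `^ kap).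
  by rewrite /sub; case: (pselect (U m x)) => [Ux|//] /= tx; have [] := bad x i tx.
elim => [|m IH].
  by rewrite big_geq// integral_set0 lee_fin invr_ge0.
rewrite -/(U m.+1) -sD; apply: (bad_mass (sS _) t0 (sbad m.+1)).
rewrite sD /U big_nat_recr//= -/(U m).
have disj : [disjoint U m & piece lab tau m].
  rewrite disj_set2E; apply/eqP; rewrite -subset0 => x [Ux pm'].
  have [k km pk] := (UE m x).1 Ux.
  have := @trivIset_piece _ _ lab tau k m I I (ex_intro _ x (conj pk pm')).
  by move=> kE; move: km; rewrite kE ltnn.
rewrite /mass ge0_integral_setU//.
- apply: (@le_trans _ _ ((2^-1)%R%:E + 1)%E).
    apply: leeD; first exact: IH.
    have [->|/set0P[z pz]] := eqVneq (piece lab tau m) set0.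
      by rewrite integral_set0.
    by have [i tz ->] := pieceP tS pz; have [] := bad z i tz.
  by rewrite -EFinD lee_fin; lra.
- by apply: measurable_funTS; apply/measurable_EFinP; exact: measurable_powp.
- by move=> x _; rewrite lee_fin powR_ge0.
Qed.

End bad_cells.

End Mass.
Export Mass.

(** * Summation over dyadic levels *)

Section real_levels.
Context {R : realType}.
Implicit Types (b t u y : R).

Lemma powR_interpolate u t : 0 < u -> 0 < t -> u != 1 -> u `^ (ln t / ln u) = t.
Proof.
move=> u0 t0 u1; have lu : ln u != 0 by rewrite ln_eq0.
by rewrite /powR gt_eqF// divfK// lnK.
Qed.

Lemma powR_gt1 y b : 1 < y -> 0 < b -> 1 < y `^ b.
Proof.
move=> y1 b0; have := @gt0_ltr_powR R b b0 1 y.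
by rewrite powR1 !nnegrE ler01 (le_trans ler01 (ltW y1)); apply.
Qed.

Lemma interpolate_gt1 u t : 1 < u -> 1 <= t <= u -> exists2 th, 0 <= th <= 1 & u `^ th = t.
Proof.
move=> u1 /andP[t1 tu]; have t0 : 0 < t by exact: lt_le_trans t1.
have u0 : 0 < u by exact: lt_trans u1.
have lu : 0 < ln u by rewrite ln_gt0.
exists (ln t / ln u); last by rewrite powR_interpolate// gt_eqF.
apply/andP; split; first by apply: divr_ge0; [exact: ln_ge0|exact: ltW].
by rewrite ler_pdivrMr// mul1r ler_ln// posrE.
Qed.

Lemma interpolate_lt1 u t : 0 < u -> u < 1 -> u <= t <= 1 ->
  exists2 th, 0 <= th <= 1 & u `^ th = t.
Proof.
move=> u0 u1 /andP[ut t1]; have t0 : 0 < t by exact: lt_le_trans ut.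
have lu : ln u < 0 by rewrite ln_lt0// u0.
exists (ln t / ln u); last by rewrite powR_interpolate// lt_eqF.
have lt0 : ln t <= 0 by rewrite ln_le0.
apply/andP; split; first by rewrite -mulrNN -invrN divr_ge0// oppr_ge0// ltW.
by rewrite ler_ndivrMr// mul1r ler_ln// posrE.
Qed.

Definition level_weight b t y : R := if t < y then (t / y) `^ b else 0.

Definition geo_bound b : R := (1 - 2 `^ (- b))^-1.

Lemma geo_ratio b : 0 < b -> 0 < 2 `^ (- b) < 1.
Proof.
move=> b0; rewrite powR_gt0//= powRN invf_lt1 ?powR_gt0//.
by apply: powR_gt1; rewrite ?ltr1n.
Qed.

(** A geometric series, read from its largest term [t < y] downwards. *)
Lemma sum_level_weight b t0 y n : 0 < b -> 0 < t0 -> 0 < y ->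
  \sum_(j < n) level_weight b (t0 * 2 ^+ j) y <= geo_bound b.
Proof.
move=> b0 t00 y0; have /andP[r0 r1] := geo_ratio b0.
set r := 2 `^ (- b) in r0 r1 *.
have g0 : 0 < geo_bound b by rewrite invr_gt0 subr_gt0.
pose z k := (t0 * 2 ^+ k / y) `^ b.
have z0 k : 0 < z k by rewrite powR_gt0// divr_gt0// mulr_gt0// exprn_gt0.
have zS k : r * z k.+1 = z k.
  rewrite /z exprS (_ : t0 * (2 * 2 ^+ k) / y = 2 * (t0 * 2 ^+ k / y)); last by ring.
  rewrite powRM//; last by rewrite ltW// divr_gt0// mulr_gt0// exprn_gt0.
  by rewrite mulrA /r powRN mulVf ?mul1r// gt_eqF// powR_gt0.
suff h : \sum_(j < n) level_weight b (t0 * 2 ^+ j) y <= geo_bound b /\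
    \sum_(j < n) level_weight b (t0 * 2 ^+ j) y <= geo_bound b * (r * z n) by case: h.
elim: n => [|n [IH1 IH2]].
  by rewrite big_ord0; split; rewrite ?ltW// mulr_gt0// mulr_gt0.
rewrite big_ord_recr/=.
have gE : geo_bound b = 1 + geo_bound b * r.
  by rewrite /geo_bound -/r; field; rewrite subr_eq0 gt_eqF.
have [ty|ty] := ltP (t0 * 2 ^+ n) y; last first.
  rewrite (_ : level_weight b (t0 * 2 ^+ n) y = 0); last by rewrite /level_weight ltNge ty.
  rewrite addr0; split => //; apply: (le_trans IH2); rewrite ler_wpM2l ?(ltW g0)//.
  by rewrite zS ler_piMl// ltW.
rewrite (_ : level_weight b (t0 * 2 ^+ n) y = z n); last by rewrite /level_weight ty.
have h : \sum_(i < n) level_weight b (t0 * 2 ^+ i) y + z n <= geo_bound b * z n.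
  rewrite [in leRHS]gE mulrDl mul1r addrC lerD2l -mulrA; exact: IH2.
split; last by rewrite zS.
apply: (le_trans h); rewrite ler_piMr ?(ltW g0)// /z.
apply: (@le_trans _ _ (1 `^ b)); last by rewrite powR1.
apply: ler_powRl; rewrite ?(ltW b0)//.
  by rewrite ltW// divr_gt0// mulr_gt0// exprn_gt0.
by rewrite ler_pdivrMr// mul1r ltW.
Qed.

End real_levels.

Section levels.
Context d (X : measurableType d) (R : realType).
Variable mu : {measure set X -> \bar R}.
Variables (p : X -> R) (pm pP : R).
Hypothesis pA : bounded_exponent p pm pP.
Let mp := be_meas pA.
Let p_le := be_le pA.
Variables (lab : nat -> X -> nat) (N : R).
Hypothesis labD : dyadic mu lab N.
Let labP := dy_cells labD.
Local Notation condE := (condE mu lab).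
Local Notation avg := (avg mu).
Local Notation cell := (cell lab).
Local Notation rho := (rho mu p).
Let mcell := measurable_cell labP.
Let cgt0 := cell_gt0 labP.
Let cfin := cell_fin labP.
Local Hint Resolve mcell cgt0 cfin : core.
Variables (kap K : R).
Hypotheses (kap_gt1 : 1 < kap) (kap_lt : kap < pm) (K_ge1 : 1 <= K).
Local Notation good := (good mu p kap K).
Local Notation mass := (mass mu p).
Implicit Types (t s : R).

Hypothesis good_of_mass : forall i x t, 0 < t -> (1 < mass (cell i x) t <= 2%:E)%E ->
  good (cell i x) (t `^ kap).
Hypothesis bad_total : forall tau t, stopping lab tau -> 0 < t ->
  (forall x i, tau x = Some i -> (mass (cell i x) t <= 1)%E /\
     ~ good (cell i x) (t `^ kap)) ->
  (mass (dom tau) t <= (2^-1)%R%:E)%E.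

Let kap0 : 0 < kap. Proof. exact: lt_trans kap_gt1. Qed.
Let K0 : 0 < K. Proof. exact: lt_le_trans K_ge1. Qed.

Lemma mass_le D s t : 0 <= s -> s <= t -> (mass D s <= mass D t)%E.
Proof.
move=> s0 st; apply: le_ge0_integral => x _; first by rewrite lee_fin powR_ge0.
by rewrite lee_fin; apply: ler_powRl => //; exact: ltW (p_gt0 pA x).
Qed.

Lemma mass_scale D c t : measurable D -> 1 <= c -> 0 <= t ->
  (mass D (c * t) <= (c `^ pP)%R%:E * mass D t)%E.
Proof.
move=> mD c1 t0.
rewrite -(integral_scaleR mu mD (measurable_powp pA t) (fun x => powR_ge0 _ _)
  (powR_ge0 _ _)).
apply: le_ge0_integral => x _; first by rewrite lee_fin powR_ge0.
by rewrite lee_fin ge1_powRM.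
Qed.

(** The steps of the height are so small, [2 ^ (1/pP)], that they at most double
    the mass, which therefore cannot jump over the interval from [1] to [2]. *)
Lemma intermediate_mass i x s t : 0 < t -> t <= s ->
  (mass (cell i x) t <= 1)%E -> (1 < mass (cell i x) s)%E ->
  exists2 u, t <= u <= s & (1 < mass (cell i x) u <= 2%:E)%E.
Proof.
move=> t0 ts mt ms; have pP0 : 0 < pP by apply: lt_trans (pP_gt1 pA point).
pose c : R := 2 `^ pP^-1.
have c1 : 1 < c.
  by apply: powR_gt1; rewrite ?ltr1n ?invr_gt0.
have c0 : 0 < c by exact: lt_trans c1.
pose u k := Num.min (t * c ^+ k) s.
have uS k : u k.+1 <= c * u k.
  rewrite /u exprS mulrCA minr_pMr ?(ltW c0)// le_min; apply/andP; split.
    by rewrite ge_min lexx.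
  by rewrite ge_min; apply/orP; right; rewrite ler_peMl ?(ltW c1)// (le_trans (ltW t0)).
have ut k : t <= u k.
  by rewrite le_min ts andbT ler_peMr ?(ltW t0)// exprn_ege1// ltW.
have us k : u k <= s by rewrite ge_min lexx orbT.
have ex : exists k, (1 < mass (cell i x) (u k))%E.
  have [k hk] : exists k, s / t <= c ^+ k.
    have lc : 0 < ln c by rewrite ln_gt0.
    have st0 : 0 < s / t by rewrite divr_gt0// (lt_le_trans t0).
    exists (Num.truncn (ln (s / t) / ln c)).+1.
    rewrite -ler_ln ?posrE ?exprn_gt0// lnXn// -mulr_natl -ler_pdivrMr//.
    exact/ltW/truncnS_gt.
  exists k; rewrite /u (_ : Num.min _ _ = s)//; apply/min_idPr.
  by move: hk; rewrite ler_pdivrMr// mulrC.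
case: (ex_minnP ex) => -[|k] hk hmin.
  move: hk; rewrite /u expr0 mulr1 (_ : Num.min t s = t); last exact/min_idPl.
  by move=> /(le_lt_trans mt); rewrite ltxx.
exists (u k.+1); first by rewrite ut us.
rewrite hk/=; have uk1 : (mass (cell i x) (u k) <= 1)%E.
  by rewrite leNgt; apply/negP => /hmin; rewrite ltnn.
have u0 j : 0 <= u j by rewrite (le_trans (ltW t0)).
apply: (le_trans (mass_le _ (u0 _) (uS k))).
apply: (le_trans (mass_scale (mcell i x) (ltW c1) (u0 k))).
rewrite /c powRVK ?lt0r_neq0//.
by rewrite -[leRHS]mule1; apply: lee_wpmul2l => //; rewrite lee_fin.
Qed.

(** Raise the height until the mass is between [1] and [2]. The cell is good at
    the power [kap] of the raised height, by [good_of_mass], and goodness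
    interpolates down to [t]. *)
Lemma good_ge1 i x t : 1 <= t -> (mass (cell i x) t <= 1)%E -> good (cell i x) t.
Proof.
move=> t1 mt; have t0 : 0 < t by exact: lt_le_trans t1.
have m0 : 0 < fine (mu (cell i x)) by exact: fine_gt0Q.
pose s := Num.max t (2 / fine (mu (cell i x))).
have ts : t <= s by rewrite le_max lexx.
have s1 : 1 <= s by exact: le_trans ts.
have ms : (1 < mass (cell i x) s)%E.
  apply: (@lt_le_trans _ _ (\int[mu]_(y in cell i x) s%:E)%E).
    rewrite integral_cst// -(fineQ (cgt0 i x) (cfin i x)) -EFinM lte_fin.
    apply: (@lt_le_trans _ _ 2); first by rewrite ltr1n.
    by rewrite -ler_pdivrMr// le_max lexx orbT.
  apply: le_ge0_integral => y _; first by rewrite lee_fin (le_trans ler01).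
  by rewrite lee_fin; apply: le1r_powR => //; exact: ltW (p_gt1 pA y).
have [u /andP[tu us] mu12] := intermediate_mass t0 ts mt ms.
have u0 : 0 < u by exact: lt_le_trans tu.
have u1 : 1 < u.
  rewrite lt_neqAle (le_trans t1 tu) andbT; apply/eqP => u1.
  have tE : t = u by apply/eqP; rewrite eq_le tu -u1 t1.
  by have /andP[+ _] := mu12; rewrite -tE ltNge mt.
have gu := good_of_mass u0 mu12.
have uk : u <= u `^ kap by apply: le1r_powR; exact: ltW.
have [th th01 <-] := interpolate_gt1 (lt_le_trans u1 uk) (t := t)
  (andb_true_intro (conj t1 (le_trans tu uk))).
by apply: (good_powR pA) => //; rewrite powR_gt0.
Qed.

(** If the mass at height [t ^ (1/kap)] exceeded [1], then at some intermediate
    height [u] the cell would be good at [u ^ kap <= t < 1], and goodness would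
    interpolate up to [t]. *)
Lemma bad_lt1 i x t : 0 < t -> (mass (cell i x) t <= 1)%E -> ~ good (cell i x) t ->
  t < 1 /\ (mass (cell i x) (t `^ kap^-1) <= 1)%E.
Proof.
move=> t0 mt ng; have t1 : t < 1.
  by rewrite ltNge; apply/negP => t1; apply: ng; exact: good_ge1.
split; first exact: t1.
rewrite leNgt; apply/negP => ms; apply: ng.
have kV : kap^-1 <= 1 by rewrite invf_le1// ltW.
have ts : t <= t `^ kap^-1 by apply: ger1_powR => //; rewrite t0 ltW.
have [u /andP[tu us] mu12] := intermediate_mass t0 ts mt ms.
have u0 : 0 < u by exact: lt_le_trans tu.
have gu := good_of_mass u0 mu12.
have uk0 : 0 < u `^ kap by rewrite powR_gt0.
have uk : u `^ kap <= t.
  rewrite -[leRHS](powRVK (ltW t0) (lt0r_neq0 kap0)).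
  by apply: ler_powRl; rewrite ?(ltW kap0) ?(ltW u0).
have [th th01 <-] := interpolate_lt1 uk0 (le_lt_trans uk t1) (t := t)
  (andb_true_intro (conj uk (ltW t1))).
exact: (good_powR pA).
Qed.

Variable g : X -> R.
Hypotheses (mg : measurable_fun setT g) (g0 : forall x, 0 <= g x)
  (rg : (rho g <= 1)%E)
  (rEg : forall tau, stopping lab tau -> (rho (condE tau g) <= 1)%E).

Definition above t x := first (fun i => t < avg (cell i x) g).

Lemma above_stop t : stopping lab (above t).
Proof.
apply: (stopping_first labD (P := fun i x => t < avg (cell i x) g)) => i x y cy.
by rewrite (eq_cell cy).
Qed.

(** The weak-type inequality: the averaging operator of this family exceeds [t]
    on all its members. *)
Lemma above_mass t x i : 0 < t -> above t x = Some i -> (mass (cell i x) t <= 1)%E.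
Proof.
move=> t0 ax; apply: le_trans (rEg (@above_stop t)).
rewrite /Exponent.rho (@integral_cell_dom _ _ _ mu setT (dom (above t))
  (fun y => condE (above t) g y `^ p y)); last first.
  by move=> y Dy; rewrite condE_out// powR0// gt_eqF// (p_gt0 pA).
rewrite setIT.
apply: (@le_trans _ _ (\int[mu]_(y in cell i x) (condE (above t) g y `^ p y)%R%:E)%E).
  apply: le_ge0_integral => y cy; first by rewrite lee_fin powR_ge0.
  have ay := @above_stop t _ _ _ ax cy.
  rewrite lee_fin; apply: ler_powRl; rewrite ?(ltW t0) ?(ltW (p_gt0 pA y))//.
  by rewrite /Cells.condE ay ltW//; have [] := first_some ay.
apply: ge0_subset_integral => //.
- exact: (measurable_dom labP (@above_stop t)).
- apply: measurable_funTS; apply: (measurable_rho pA).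
  by apply: (measurable_condE labP); exact: (@above_stop t).
- by move=> y _; rewrite lee_fin powR_ge0.
- by move=> y cy; rewrite /dom/= (@above_stop t _ _ _ ax cy).
Qed.

Definition restrict (tau : X -> option nat) (P : nat -> X -> Prop) x : option nat :=
  if tau x is Some i then if pselect (P i x) then Some i else None else None.

Lemma restrict_stop tau P : stopping lab tau ->
  (forall i x y, cell i x y -> P i x -> P i y) -> stopping lab (restrict tau P).
Proof.
move=> tS PP x y i; rewrite /restrict; case tx : (tau x) => [j|//].
case: (pselect (P j x)) => [Px|//] /= [<-] cy; rewrite (tS _ _ _ tx cy).
by case: (pselect (P j y)) => //= nPy; case: nPy; exact: PP Px.
Qed.

Lemma restrict_some tau P x i : restrict tau P x = Some i -> tau x = Some i /\ P i x.
Proof.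
rewrite /restrict; case tx : (tau x) => [j|//].
by case: (pselect (P j x)) => [Px|//] /= [<-].
Qed.

Definition good_part t := restrict (above t) (fun i x => good (cell i x) t).
Definition bad_part t := restrict (above t) (fun i x => ~ good (cell i x) t).

Lemma good_part_stop t : stopping lab (good_part t).
Proof.
by apply: restrict_stop; [exact: above_stop|move=> i x y cy; rewrite (eq_cell cy)].
Qed.

Lemma bad_part_stop t : stopping lab (bad_part t).
Proof.
by apply: restrict_stop; [exact: above_stop|move=> i x y cy; rewrite (eq_cell cy)].
Qed.

Lemma dom_parts t : dom (above t) = dom (good_part t) `|` dom (bad_part t).
Proof.
apply/seteqP; split => x; rewrite /dom/= /good_part /bad_part /restrict.
  case ax : (above t x) => [i|//] _; have [gx|gx] := pselect (good (cell i x) t).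
    by left; case: pselect.
  by right; case: pselect.
by case: (above t x) => [i|] //= -[].
Qed.

(** The integrand produced by [good_mass] for [2 g] cut off below [t]; the weight
    is what makes the sum over dyadic heights converge. *)
Definition overlap t x := level_weight (1 - kap^-1) t (2 * g x) * (2 * g x) `^ p x.

Lemma exponent_gain_gt0 : 0 < 1 - kap^-1.
Proof. by rewrite subr_gt0 invf_lt1. Qed.

Lemma overlap_ge0 t x : 0 <= overlap t x.
Proof.
by rewrite mulr_ge0 ?powR_ge0// /level_weight; case: ifP => // _; exact: powR_ge0.
Qed.

Lemma measurable_overlap t : measurable_fun setT (overlap t).
Proof.
have m2 : measurable_fun setT (fun x => 2 * g x) by exact: measurable_funM.
apply: measurable_funM; last exact: measurable_fun_powR2.
apply: measurable_fun_ifT => //; first exact: measurable_fun_ltr.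
apply: measurable_fun_powR2 => //; apply: measurable_funM => //.
rewrite (_ : (fun x => _) = fun x => (2 * g x) `^ (-1)).
  by apply: measurable_fun_powR2.
by apply/funext => x; rewrite powR_inv1// mulr_ge0.
Qed.

Lemma good_part_mass t : 0 < t -> (mass (dom (good_part t)) t <=
  (good_const pP kap K)%:E * \int[mu]_x (overlap t x)%:E)%E.
Proof.
move=> t0; have gS := @good_part_stop t; have mD := measurable_dom labP gS.
(* the cut-off costs at most [t] in the average of [2 g], which exceeds [2 t] *)
pose F x := 2 * (g x * \1_[set y | t < 2 * g y] x).
have mset : measurable [set y | t < 2 * g y].
  have : measurable_fun setT (fun y => t < 2 * g y).
    by apply: measurable_fun_ltr => //; exact: measurable_funM.
  by move=> /(_ measurableT [set true]); rewrite setTI; apply.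
have mF : measurable_fun setT F.
  by apply: measurable_funM => //; apply: measurable_mul_indic.
have F0 x : 0 <= F x by rewrite !mulr_ge0// indic_ge0.
pose H x := F x `^ (p x / kap) * t `^ (p x - p x / kap).
have H0 x : 0 <= H x by rewrite mulr_ge0 ?powR_ge0.
have mH : measurable_fun setT H.
  have mpk : measurable_fun setT (fun x => p x / kap) by exact: measurable_funM.
  apply: measurable_funM; first exact: measurable_fun_powR2.
  by apply: measurable_fun_powR2 => //; exact: measurable_funB.
have gc0 : 0 <= good_const pP kap K.
  by rewrite /good_const !mulr_ge0 ?powR_ge0 ?(ltW K0).
apply: (@le_trans _ _ (\int[mu]_(x in dom (good_part t)) (good_const pP kap K * H x)%R%:E)%E).
  apply: (le_integral_cells labP gS).
  - exact: (measurable_powp pA).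
  - exact: measurable_funM.
  - by move=> x; exact: powR_ge0.
  - by move=> x; rewrite mulr_ge0.
  - move=> x i /restrict_some[ax gx].
    rewrite (integral_scaleR mu (mcell i x) mH H0 gc0).
    have gi : mu.-integrable (cell i x) (EFin \o g).
      exact: (rho_cell_integrable1 pA labP i x mg g0 (fin_le1 rg)).
    have Fi : mu.-integrable (cell i x) (EFin \o F).
      apply: (le_integrable (mcell i x) _ _ (integrableZl (mcell i x) 2 gi)).
        by apply: measurable_funTS; exact/measurable_EFinP.
      move=> y _; rewrite /= lee_fin !ger0_norm ?mulr_ge0//.
      by rewrite /F ler_wpM2l// ler_piMr// indic_le1.
    apply: (good_mass pA kap_gt1 kap_lt K_ge1 (mcell i x) (cgt0 i x) (cfin i x) t0 gx mF F0 Fi).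
    have [tg _] := first_some ax.
    have ct : mu.-integrable (cell i x) (EFin \o (fun=> t)).
      apply: (bounded_integrable (mcell i x) (cfin i x) (b := t)) => // y _.
      by rewrite lexx (ltW t0).
    have : avg (cell i x) (fun y => 2 * g y) <= avg (cell i x) (fun y => F y + t).
      apply: le_avg => //.
      + by have := integrableZl (mcell i x) 2 gi; apply: eq_integrable.
      + by have := integrableD (mcell i x) Fi ct; apply: eq_integrable.
      + move=> y _; rewrite /F; have [h|h] := ltP t (2 * g y).
          by rewrite indic_in// mulr1 lerDl ltW.
        by rewrite indic_out ?mulr0 ?mulr0 ?add0r//= => h'; move: h; rewrite leNgt h'.
    rewrite (avgZ (mcell i x))// (avgD (mcell i x))// avg_cst//.
    by move: tg; lra.
rewrite (integral_scaleR mu mD mH H0 gc0); apply: lee_wpmul2l => //.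
apply: (@le_trans _ _ (\int[mu]_(x in dom (good_part t)) (overlap t x)%:E)%E).
  apply: le_ge0_integral => x _; rewrite lee_fin//.
  have p0 := p_gt0 pA x.
  rewrite /H /F /overlap /level_weight; case: ifPn => h; last first.
    have pk0 : p x / kap != 0 by apply: lt0r_neq0; exact: divr_gt0.
    rewrite indic_out; last by move=> /= h'; move: h; rewrite h'.
    by rewrite !mulr0 (powR0 pk0) !mul0r.
  rewrite indic_in// mulr1; set y := 2 * g x in h *.
  have y0 : 0 < y by exact: lt_trans h.
  have -> : y `^ (p x / kap) * t `^ (p x - p x / kap) = ((t / y) `^ (1 - kap^-1)) `^ p x * y `^ p x.
    rewrite -!powRrM (powRM _ (ltW t0)) ?invr_ge0 ?(ltW y0)// powRV// -powRN.
    rewrite mulrAC -mulrA -powRD; last by rewrite (gt_eqF y0) implybT.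
    rewrite mulrC; congr (_ `^ _ * _ `^ _); by field; rewrite gt_eqF.
  rewrite ler_wpM2r ?powR_ge0//; apply: ge1r_powR; last exact: ltW (p_gt1 pA x).
  have ty0 : 0 < t / y by rewrite divr_gt0.
  rewrite powR_gt0//=.
  apply: (@le_trans _ _ (1 `^ (1 - kap^-1))); last by rewrite powR1.
  apply: ler_powRl.
  - exact: ltW exponent_gain_gt0.
  - exact: ltW.
  - by rewrite ler_pdivrMr// mul1r ltW.
apply: ge0_subset_integral => //.
- by apply/measurable_EFinP; exact: measurable_overlap.
- by move=> x _; rewrite lee_fin; exact: overlap_ge0.
Qed.

(** Bad members occur only for [t < 1]. By [bad_lt1] they have mass at most [1]
    even at the larger height [t ^ (1/kap)], so their total mass there is bounded
    by [bad_total], and coming back to height [t] gains a power of [t]. *)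
Lemma bad_part_mass t : 0 < t ->
  (mass (dom (bad_part t)) t <= (level_weight (1 - kap^-1) t 1)%:E)%E.
Proof.
move=> t0; have bS := @bad_part_stop t; have mD := measurable_dom labP bS.
have [[x Dx]|none] := pselect (dom (bad_part t) !=set0); last first.
  rewrite (_ : dom _ = set0) /Mass.mass ?integral_set0; last first.
    by rewrite -subset0 => x Dx; apply: none; exists x.
  by rewrite lee_fin /level_weight; case: ifP => // _; exact: powR_ge0.
have t1 : t < 1.
  move: Dx; rewrite /dom/=; case bx : (bad_part t x) => [i|//] _.
  have [ax ng] := restrict_some bx.
  by have [] := bad_lt1 t0 (above_mass t0 ax) ng.
pose s := t `^ kap^-1; have s0 : 0 < s by rewrite powR_gt0.
have sk : s `^ kap = t by rewrite powRVK ?(ltW t0) ?lt0r_neq0.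
have s1 : s <= 1.
  apply: (@le_trans _ _ (1 `^ kap^-1)); last by rewrite powR1.
  by apply: ler_powRl; rewrite ?invr_ge0 ?(ltW kap0) ?(ltW t0) ?(ltW t1).
have half : (mass (dom (bad_part t)) s <= (2^-1)%R%:E)%E.
  apply: (bad_total bS s0) => y i /restrict_some[ay ng].
  by have [_ ms] := bad_lt1 t0 (above_mass t0 ay) ng; split => //; rewrite sk.
rewrite /level_weight t1 divr1.
have -> : t `^ (1 - kap^-1) = s `^ (kap - 1).
  by rewrite /s -powRrM; congr (_ `^ _); field; rewrite gt_eqF.
apply: (@le_trans _ _ ((s `^ (kap - 1))%R%:E * mass (dom (bad_part t)) s)%E).
  rewrite /Mass.mass.
  rewrite -(integral_scaleR mu mD (measurable_powp pA s) (fun x => powR_ge0 _ _) (powR_ge0 _ _)).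
  apply: le_ge0_integral => y _; first by rewrite lee_fin powR_ge0.
  rewrite lee_fin -{1}sk -powRrM.
  have p1 := p_gt1 pA y.
  rewrite -powRD; last by rewrite (gt_eqF s0) implybT.
  apply: ger_powR; first by rewrite s0 s1.
  have := kap_gt1; nra.
rewrite -[leRHS]mule1; apply: lee_wpmul2l; first by rewrite lee_fin powR_ge0.
by apply: (le_trans half); rewrite lee_fin invf_le1// ler1n.
Qed.

(** Comparable to the power [p] of the maximal function of [g], truncated to
    the heights from [t0] to [t0 * 2 ^ n]. *)
Definition level_sum t0 n x : R :=
  \sum_(j < n) \1_(dom (above (t0 * 2 ^+ j))) x * (t0 * 2 ^+ j) `^ p x.

Definition level_const :=
  (good_const pP kap K * 2 `^ pP + 1) * geo_bound (1 - kap^-1).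

Lemma level_sum_bound t0 n : 0 < t0 ->
  (\int[mu]_x (level_sum t0 n x)%:E <= level_const%:E)%E.
Proof.
move=> t00; pose t j := t0 * 2 ^+ j; have tj0 j : 0 < t j by rewrite mulr_gt0// exprn_gt0.
have mdA j : measurable (dom (above (t j))) := measurable_dom labP (@above_stop (t j)).
have gc0 : 0 <= good_const pP kap K.
  by rewrite /good_const !mulr_ge0 ?powR_ge0 ?(ltW K0).
have b0 := exponent_gain_gt0; set b := 1 - kap^-1 in b0.
have gb0 : 0 < geo_bound b by rewrite invr_gt0 subr_gt0; have /andP[] := geo_ratio b0.
have massE j : mass (dom (above (t j))) (t j) =
    (\int[mu]_x (\1_(dom (above (t j))) x * (t j) `^ p x)%R%:E)%E.
  by rewrite integral_mul_indic setTI.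
apply: (@le_trans _ _ (\sum_(j < n) mass (dom (above (t j))) (t j))%E).
  under eq_bigr do rewrite massE.
  rewrite -ge0_integral_sum//.
  - by under eq_integral do rewrite /level_sum -sumEFin.
  - move=> j; apply/measurable_EFinP; apply: measurable_funM; first exact: measurable_indic.
    exact: (measurable_powp pA).
  - by move=> j x _; rewrite lee_fin mulr_ge0 ?indic_ge0 ?powR_ge0.
apply: (@le_trans _ _ (\sum_(j < n) ((good_const pP kap K)%:E *
   \int[mu]_x (overlap (t j) x)%:E + (level_weight b (t j) 1)%:E))%E).
  apply: lee_sum => j _; rewrite dom_parts.
  have mG := measurable_dom labP (@good_part_stop (t j)).
  have mB := measurable_dom labP (@bad_part_stop (t j)).
  have mm := measurable_powp pA (t j).
  apply: (@le_trans _ _ (mass (dom (good_part (t j))) (t j) +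
      mass (dom (bad_part (t j))) (t j))%E).
    rewrite /Mass.mass ge0_integral_setU//.
    - by apply: measurable_funTS; exact/measurable_EFinP.
    - by move=> x _; rewrite lee_fin powR_ge0.
    - rewrite disj_set2E; apply/eqP; rewrite -subset0 => x [].
      rewrite /dom/=; case gx : (good_part _ x) => [i|//] _.
      case bx : (bad_part _ x) => [k|//] _.
      have [ax g1] := restrict_some gx; have [ax' g2] := restrict_some bx.
      by move: ax' g2; rewrite ax => -[<-].
  by apply: leeD; [exact: good_part_mass|exact: bad_part_mass].
rewrite big_split/= sumEFin.
rewrite /level_const mulrDl mul1r EFinD; apply: leeD; last first.
  by rewrite lee_fin; exact: sum_level_weight.
have mo j : measurable_fun setT (overlap (t j)) by exact: measurable_overlap.
have o0 j x : 0 <= overlap (t j) x by exact: overlap_ge0.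
rewrite -ge0_sume_distrr; last by move=> j _; apply: integral_ge0 => x _; rewrite lee_fin.
rewrite -(mulrA (good_const pP kap K)) (EFinM (good_const pP kap K)).
apply: lee_wpmul2l; first by rewrite lee_fin.
rewrite -ge0_integral_sum//; last 2 first.
- by move=> j; exact/measurable_EFinP.
- by move=> j x _; rewrite lee_fin.
apply: (@le_trans _ _ (\int[mu]_x (2 `^ pP * geo_bound b * g x `^ p x)%R%:E)%E).
  apply: le_ge0_integral => x _; first by rewrite sume_ge0// => j _; rewrite lee_fin.
  rewrite sumEFin lee_fin /overlap -mulr_suml.
  have p0 := p_gt0 pA x.
  have [gx0|gx0] := leP (g x) 0.
    have -> : g x = 0 by apply/eqP; rewrite eq_le gx0 g0.
    by rewrite mulr0 powR0 ?mulr0// gt_eqF.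
  rewrite mulrAC; apply: (@le_trans _ _ (geo_bound b * (2 * g x) `^ p x)).
    rewrite ler_wpM2r ?powR_ge0//; apply: sum_level_weight => //.
    by rewrite mulr_gt0.
  rewrite mulrC ler_wpM2r ?(ltW gb0)//.
  by apply: ge1_powRM => //; rewrite ler1n.
have c0 : 0 <= 2 `^ pP * geo_bound b by rewrite mulr_ge0 ?powR_ge0// ltW.
rewrite integral_scaleR//; last 2 first.
- exact: measurable_fun_powR2.
- by move=> x; exact: powR_ge0.
by rewrite -[leRHS]mule1; apply: lee_wpmul2l.
Qed.

End levels.

(** * Uniform constants *)

Section constants.
Context {R : realType}.
Implicit Types (pm pP C N x y e : R).

Lemma powR_small_exponent x y : 1 < x -> 1 < y ->
  exists2 e0 : R, 0 < e0 & forall e, 0 <= e <= e0 -> x `^ e <= y.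
Proof.
move=> x1 y1; have lx : 0 < ln x by rewrite ln_gt0.
have ly : 0 < ln y by rewrite ln_gt0.
have x0 : 0 < x by exact: lt_trans x1.
have y0 : 0 < y by exact: lt_trans y1.
exists (ln y / ln x); first exact: divr_gt0.
move=> e /andP[e0 he]; rewrite /powR gt_eqF// -[leRHS]lnK ?posrE// ler_expR.
by rewrite -ler_pdivlMr.
Qed.

(** [J] outgrows [J ^ (1/pm)]. *)
Lemma chain_length pm pP C : 1 < pm -> 1 <= C -> exists2 J : nat, (0 < J)%N &
  8 * C * (J%:R * C `^ pP) `^ pm^-1 <= J%:R.
Proof.
move=> pm1 C1; have pm0 : 0 < pm by exact: lt_trans pm1.
have C0 : 0 < C by exact: lt_le_trans C1.
pose B := 8 * C * (C `^ pP) `^ pm^-1; have B0 : 0 < B by rewrite !mulr_gt0 ?powR_gt0.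
have e0 : 0 < 1 - pm^-1 by rewrite subr_gt0 invf_lt1.
pose J := (Num.truncn (B `^ (1 - pm^-1)^-1)).+1.
have J0 : 0 < J%:R :> R by rewrite ltr0n.
exists J => //; rewrite powRM ?powR_ge0 ?ler0n//.
rewrite mulrCA -/B -ler_pdivlMl ?powR_gt0// mulrC -powRN.
rewrite -[X in X * _ `^ _](powRr1 (ltW J0)) -powRD; last by rewrite (gt_eqF J0) implybT.
rewrite -[leLHS](powRVK (ltW B0) (lt0r_neq0 e0)).
apply: ler_powRl; rewrite ?powR_ge0 ?(ltW e0)//.
exact/ltW/truncnS_gt.
Qed.

Lemma decay_rate pP C : 1 < pP -> 1 <= C ->
  exists2 lam : R, 1 < lam & lam `^ pP * (1 - decay_gap pP C) <= 1.
Proof.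
move=> pP1 C1; have pP0 : 0 < pP by exact: lt_trans pP1.
have C4 : 1 < (4 * C) `^ pP by apply: powR_gt1 => //; lra.
have gap0 : 0 < decay_gap pP C by rewrite invr_gt0 (lt_trans ltr01).
have gap1 : decay_gap pP C < 1 by rewrite invf_lt1// (lt_trans ltr01).
have g0 : 0 < 1 - decay_gap pP C by rewrite subr_gt0.
exists ((1 - decay_gap pP C)^-1 `^ pP^-1).
  by apply: powR_gt1; rewrite ?invr_gt0// invf_gt1//; lra.
by rewrite powRVK ?invr_ge0 ?(ltW g0) ?lt0r_neq0// mulVf ?lt0r_neq0.
Qed.

End constants.

(** The constants are chosen in this order: [lam] and [J] from [C], [pm] and
    [pP], then [kap] close to [1] so that the layers of both Gehring chains grow slowly
    enough, then [K]. None of them depends on the space or on its labels. *)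
Theorem dyadic_level_bound (R : realType) (pm pP C N : R) :
  1 < pm -> pm <= pP -> 1 <= C -> 1 <= N ->
  exists2 L : R, 0 <= L &
  forall d (X : measurableType d) (mu : {measure set X -> \bar R}) (p : X -> R)
    (lab : nat -> X -> nat) (f : X -> R) (t0 : R) n,
  bounded_exponent p pm pP -> dyadic mu lab N -> averages_bounded mu p lab C ->
  measurable_fun setT f -> (forall x, 0 <= f x) -> (rho mu p f <= 1)%E -> 0 < t0 ->
  (\int[mu]_x (level_sum mu p lab (fun x => f x / C) t0 n x)%:E <= L%:E)%E.
Proof.
move=> pm1 pmP C1 N1; have pP1 : 1 < pP by exact: lt_le_trans pmP.
have C0 : 0 < C by exact: lt_le_trans C1.
have [lam lam1 lam_gap] := decay_rate pP1 C1.
have [J J0 J_large] := chain_length pP pm1 C1.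
(* half of the decay rate [lam] is spent on the layers, half on summability *)
pose q := (lam `^ 2^-1)^-1; have lam0 : 0 < lam by exact: lt_trans lam1.
have sl1 : 1 < lam `^ 2^-1 by apply: powR_gt1; rewrite ?invr_gt0.
have sl0 : 0 < lam `^ 2^-1 by exact: lt_trans sl1.
have q01 : 0 <= q < 1 by rewrite invr_ge0 (ltW sl0) invf_lt1.
have lq : lam * q = lam `^ 2^-1.
  have ss : lam = lam `^ 2^-1 * lam `^ 2^-1.
    rewrite -powRD; last by rewrite (gt_eqF lam0) implybT.
    by rewrite (_ : 2^-1 + 2^-1 = 1) ?powRr1 ?(ltW lam0)//; lra.
  by rewrite {1}ss /q mulfK// gt_eqF.
have a1 : 1 < 2 * N by lra.
have [e1 e10 he1] := powR_small_exponent a1 sl1.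
have aJ1 : 1 < (2 * N) ^+ J by rewrite exprn_egt1// -lt0n.
have [e2 e20 he2] := powR_small_exponent aJ1 (ltr1n R 2).
pose e := Num.min (Num.min e1 (e2 / 3)) (Num.min 1 ((pm - 1) / 2)).
have e0 : 0 < e by rewrite !lt_min e10 ltr01 !divr_gt0// subr_gt0.
have ee1 : e <= e1 by rewrite /e !ge_min lexx.
have ee2 : e <= e2 / 3 by rewrite /e !ge_min lexx orbT.
have ee3 : e <= 1 by rewrite /e !ge_min lexx !orbT.
have ee4 : e <= (pm - 1) / 2 by rewrite /e !ge_min lexx !orbT.
pose kap := 1 + e; have kap1 : 1 < kap by rewrite ltrDl.
have kap_lt : kap < pm by rewrite /kap; lra.
have rh_small : (2 * N) `^ (kap - 1) <= lam * q.
  by rewrite lq; apply: he1; rewrite /kap addrAC subrr add0r (ltW e0).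
have lo_small : ((2 * N) ^+ J) `^ (kap * kap - 1) <= 2.
  apply: he2; rewrite /kap; apply/andP; split; nra.
pose B := (16 * C) `^ pP * rh_const pP lam q.
pose K := Num.max 1 (Num.max 0 B `^ kap).
have K1 : 1 <= K by rewrite le_max lexx.
have kap0 : 0 < kap by exact: lt_trans kap1.
have K_large : B <= K `^ kap^-1.
  apply: (@le_trans _ _ (Num.max 0 B)); first by rewrite le_max lexx orbT.
  rewrite -[leLHS](powRK (p := kap)) ?lt0r_neq0//; last by rewrite le_max lexx.
  by apply: ler_powRl; rewrite ?invr_ge0 ?(ltW kap0) ?powR_ge0// le_max lexx orbT.
have b0 : 0 < 1 - kap^-1 by rewrite subr_gt0 invf_lt1.
exists (level_const pP kap K).
  rewrite /level_const mulr_ge0//; last first.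
    by rewrite invr_ge0 subr_ge0 ltW//; have /andP[] := geo_ratio b0.
  rewrite addr_ge0// mulr_ge0 ?powR_ge0// /good_const !mulr_ge0 ?powR_ge0//.
  exact: le_trans K1.
move=> d X mu p lab f t0 n pA labD bdd mf f0 rf t00.
have labP := dy_cells labD.
have mg : measurable_fun setT (fun x => f x / C) by exact: measurable_funM.
have g0 x : 0 <= f x / C by rewrite divr_ge0// ltW.
have rg : (rho mu p (fun x => f x / C)%R <= 1)%E.
  apply: le_trans rf; apply: (le_rho mu pA) => // x.
  by rewrite ler_pdivrMr// ler_peMr.
apply: (level_sum_bound pA labD kap1 kap_lt K1 _ _ mg g0 rg _ _ t00).
- move=> i x t; exact: (good_of_mass pA labD bdd kap1 kap_lt K1 (ltW lam1) lam_gap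
    q01 rh_small J0 J_large lo_small K_large).
- move=> tau t; exact: (bad_total pA labD bdd kap1 kap_lt K1 (ltW lam1) lam_gap
    q01 rh_small J0 J_large lo_small K_large).
- move=> tau tS; have := ab_le1 bdd tS mf f0 rf.
  rewrite (_ : (fun x => condE mu lab tau f x / C) =
    condE mu lab tau (fun x => f x / C))//.
  apply/funext => x; rewrite (_ : (fun x => f x / C) = fun x => C^-1 * f x).
    rewrite (condEZ labP); first by rewrite mulrC.
    exact: (rho_cell_integrable pA labP mf f0 (fin_le1 rf)).
  by apply/funext => y; rewrite mulrC.
Qed.

(** * Differentiation along cells *)

Section differentiation.
Context d (X : measurableType d) (R : realType).
Variable mu : {measure set X -> \bar R}.
Variable lab : nat -> X -> nat.
Hypothesis labP : cell_partition mu lab.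
Hypothesis refine : forall i x y, lab i.+1 x = lab i.+1 y -> lab i x = lab i y.
Local Notation condE := (condE mu lab).
Local Notation avg := (avg mu).
Local Notation cell := (cell lab).
Let mcell := measurable_cell labP.
Let cgt0 := cell_gt0 labP.
Let cfin := cell_fin labP.
Local Hint Resolve mcell cgt0 cfin : core.

Lemma refine_cell i j x : (i <= j)%N -> cell j x `<=` cell i x.
Proof.
elim: j => [|j IH]; first by rewrite leqn0 => /eqP->.
rewrite leq_eqVlt => /predU1P[->//|]; rewrite ltnS => ij y cy.
by apply: (IH ij); apply: refine; exact: cy.
Qed.

(** Open in the topology generated by the cells. *)
Definition cell_open (V : set X) := forall x, V x -> exists i, cell i x `<=` V.

Definition cover (i0 : nat) (V : set X) x : option nat :=
  first (fun i => (i0 <= i)%N /\ cell i x `<=` V).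

Lemma cover_stop i0 V : stopping lab (cover i0 V).
Proof.
move=> x y i /first_some[[ii iV] imin] cy; apply: first_eqP.
  by split => //; rewrite (eq_cell cy).
move=> m mi [im mV]; apply: (imin m mi); split => //.
by rewrite -(eq_cell (refine_cell (ltnW mi) cy)).
Qed.

Lemma dom_cover i0 V : cell_open V -> dom (cover i0 V) = V.
Proof.
move=> oV; apply/seteqP; split => x; rewrite /dom/=.
  by case cx : (cover i0 V x) => [i|//] _; have [[_ iV] _] := first_some cx; exact: iV.
move=> Vx; have [i iV] := oV x Vx.
have h : (i0 <= maxn i0 i)%N /\ cell (maxn i0 i) x `<=` V.
  split; first exact: leq_maxl.
  by apply: subset_trans iV; apply: refine_cell; exact: leq_maxr.
have [m e _] := first_le (P := fun i => (i0 <= i)%N /\ cell i x `<=` V) h.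
by rewrite /cover e.
Qed.

Lemma measurable_cell_open V : cell_open V -> measurable V.
Proof.
by move=> oV; rewrite -(dom_cover 0 oV); apply: (measurable_dom labP); exact: cover_stop.
Qed.

Lemma cell_openI V W : cell_open V -> cell_open W -> cell_open (V `&` W).
Proof.
move=> oV oW x [Vx Wx]; have [i iV] := oV x Vx; have [j jW] := oW x Wx.
exists (maxn i j) => y cy; split.
  by apply: iV; apply: refine_cell cy; exact: leq_maxl.
by apply: jW; apply: refine_cell cy; exact: leq_maxr.
Qed.

Lemma cell_open_bigcup (V : (set X)^nat) : (forall k, cell_open (V k)) ->
  cell_open (\bigcup_k V k).
Proof.
move=> oV x [k _ Vx]; have [i iV] := oV k x Vx.
by exists i => y cy; exists k => //; exact: iV.
Qed.

Lemma cell_open_cell i x : cell_open (cell i x).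
Proof. by move=> y cy; exists i; rewrite (eq_cell cy). Qed.

Section approximable.
Variable Q : set X.
Hypotheses (mQ : measurable Q) (Qfin : (mu Q < +oo)%E).

(** [B] is regular on [Q]: an open set around [B] and an open set around its
    complement overlap by little. *)
Definition approximable (B : set X) := forall e : R, 0 < e -> exists V W,
  [/\ cell_open V, cell_open W, B `<=` V, ~` B `<=` W &
      (mu (V `&` W `&` Q) <= e%:E)%E].

Lemma approximableC B : approximable B -> approximable (~` B).
Proof.
move=> aB e e0; have [V [W [oV oW BV BW h]]] := aB e e0.
by exists W, V; split => //; [rewrite setCK|rewrite [W `&` V]setIC].
Qed.

(** Finitely many of the open sets around the [B k] exhaust their union up to
    small measure, and for those the open sets around the complements can be
    intersected. *)
Lemma approximable_bigcup (B : (set X)^nat) : (forall k, approximable (B k)) ->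
  approximable (\bigcup_k B k).
Proof.
move=> aB e e0.
have ek0 k : 0 < e / 2 / (2 ^+ k.+1) by rewrite !divr_gt0// exprn_gt0.
have /choice[V hV] : forall k, exists V, exists W,
    [/\ cell_open V, cell_open W, B k `<=` V, ~` (B k) `<=` W &
      (mu (V `&` W `&` Q) <= (e / 2 / (2 ^+ k.+1))%:E)%E].
  by move=> k; exact: aB (ek0 k).
have {hV}/choice[W hVW] := hV.
have oV k : cell_open (V k) by have [] := hVW k.
have oW k : cell_open (W k) by have [] := hVW k.
have mV k := measurable_cell_open (oV k).
have mW k := measurable_cell_open (oW k).
pose VV := \bigcup_k V k; pose U m := \big[setU/set0]_(0 <= k < m) V k.
have mVV : measurable VV by exact: bigcup_measurable.
have UE m x : U m x <-> exists2 k, (k < m)%N & V k x.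
  by rewrite /U big_mkord -bigcup_mkord; split => -[k km pk]; exists k.
have mU m : measurable (U m) by apply: bigsetU_measurable => k _.
have oVV : cell_open VV by exact: cell_open_bigcup.
have [m hm] : exists m, (mu (VV `&` Q) <= mu (U m `&` Q) + (e / 2)%:E)%E.
  have cvg : (fun m => mu (U m `&` Q)) @ \oo --> mu (\bigcup_m (U m `&` Q)).
    apply: nondecreasing_cvg_mu.
    - by move=> m; exact: measurableI.
    - by apply: bigcup_measurable => m _; exact: measurableI.
    - apply/nondecreasing_seqP => m; apply/subsetPset => x [Um Qx]; split => //.
      by move/UE : Um => [k km Vk]; apply/UE; exists k => //; exact: ltnW.
  have UVV : \bigcup_m (U m `&` Q) = VV `&` Q.
    apply/seteqP; split => x.
      by move=> [m _ [/UE[k km Vk] Qx]]; split => //; exists k.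
    by move=> [[k _ Vk] Qx]; exists k.+1 => //; split => //; apply/UE; exists k.
  rewrite UVV in cvg.
  have fin : mu (VV `&` Q) \is a fin_num.
    rewrite ge0_fin_numE//; apply: le_lt_trans Qfin.
    by apply: le_measure; rewrite ?inE//; exact: measurableI.
  have e20 : 0 < e / 2 by rewrite divr_gt0.
  apply: contrapT => /forallNP h.
  have : (mu (VV `&` Q) <= mu (VV `&` Q) - (e / 2)%:E)%E.
    apply: cvge_le cvg; apply: nearW => m; rewrite leNgt; apply/negP => lt; apply: (h m).
    by move: lt; rewrite lteBlDr// => /ltW.
  by rewrite -(fineK fin) -EFinB lee_fin; lra.
have cW k : cell_open (\bigcap_(j in `I_k) W j).
  elim: k => [|k IH]; first by rewrite II0 bigcap_set0 => x _; exists 0%N.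
  rewrite IIS bigcap_setU bigcap_set1; exact: cell_openI.
exists VV, (\bigcap_(j in `I_m) W j); split => //.
- by move=> x [k _ Bx]; exists k => //; have [_ _ BV _ _] := hVW k; exact: BV.
- by move=> x nB k km; have [_ _ _ BW _] := hVW k; apply: BW => Bx; apply: nB; exists k.
pose D := VV `&` Q `\` (U m `&` Q).
pose E k := V k `&` W k `&` Q.
have mE k : measurable (E k) by do !apply: measurableI.
have mD : measurable D by apply: measurableD; exact: measurableI.
apply: (@le_trans _ _ (mu (D `|` \big[setU/set0]_(0 <= k < m) E k))%E).
  apply: le_measure; rewrite ?inE.
  - apply: measurableI => //; apply: measurableI => //.
    by apply: measurable_cell_open; exact: cW.
  - by apply: measurableU => //; apply: bigsetU_measurable.
  - move=> x [[Vx Wx] Qx]; have [[k km Vk]|nU] := pselect (exists2 k, (k < m)%N & V k x).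
      right; rewrite big_mkord -bigcup_mkord; exists k => //; split => //; split => //.
      exact: Wx.
    by left; split => // -[/UE].
have muD : (mu D <= (e / 2)%:E)%E.
  have mVQ : measurable (VV `&` Q) by exact: measurableI.
  have mUQ : measurable (U m `&` Q) by exact: measurableI.
  have VQfin : (mu (VV `&` Q) < +oo)%E.
    by apply: le_lt_trans Qfin; apply: le_measure; rewrite ?inE.
  rewrite /D measureD//.
  rewrite (_ : VV `&` Q `&` (U m `&` Q) = U m `&` Q); last first.
    apply/seteqP; split => x; first by move=> [].
    by move=> [Ux Qx]; split => //; split => //; move/UE : Ux => [k _ Vk]; exists k.
  rewrite leeBlDr; first by rewrite addeC; exact: hm.
  rewrite ge0_fin_numE//; apply: le_lt_trans Qfin.
  by apply: le_measure; rewrite ?inE//; exact: measurableI.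
have muE : (mu (\big[setU/set0]_(0 <= k < m) E k) <= (e / 2)%:E)%E.
  apply: (@le_trans _ _ (\sum_(0 <= k < m) mu (E k))%E).
    rewrite !big_mkord; apply: content_subadditive => //.
    by apply: bigsetU_measurable.
  apply: (@le_trans _ _ (\sum_(0 <= k < m) (e / 2 / 2 ^+ k.+1)%R%:E)%E).
    by apply: lee_sum => k _; have [] := hVW k.
  rewrite sumEFin lee_fin.
  suff -> : \sum_(0 <= k < m) e / 2 / 2 ^+ k.+1 = e / 2 * (1 - (2 ^+ m)^-1).
    by rewrite ler_piMr ?divr_ge0 ?(ltW e0)// gerBl invr_ge0 exprn_ge0.
  elim: (m) => [|k IH]; first by rewrite big_geq// expr0 invr1 subrr mulr0.
  rewrite big_nat_recr//= IH exprS; field.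
  by rewrite expf_neq0.
have mS : measurable (\big[setU/set0]_(0 <= k < m) E k) by apply: bigsetU_measurable.
apply: (le_trans (measureU2 mu mD mS)).
by apply: (le_trans (leeD muD muE)); rewrite -EFinD lee_fin -splitr.
Qed.

Lemma approximable0 : approximable set0.
Proof.
move=> e e0; exists set0, setT; split => //.
- by move=> x _; exists 0%N.
- by rewrite set0I set0I measure0 lee_fin ltW.
Qed.

Lemma approximable_lab i (P : set nat) : approximable (lab i @^-1` P).
Proof.
move=> e e0; exists (lab i @^-1` P), (~` (lab i @^-1` P)); split => //.
- by move=> x Px; exists i => y; rewrite /Cells.cell/= => ->.
- by move=> x Px; exists i => y; rewrite /Cells.cell/= => ->.
- by rewrite setICr set0I measure0 lee_fin ltW.
Qed.

End approximable.

Definition cell_sigma : set (set X) :=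
  <<s [set B | exists i P, B = lab i @^-1` P] >>.

Lemma approximable_sigma Q B : measurable Q -> (mu Q < +oo)%E -> cell_sigma B ->
  approximable Q B.
Proof.
move=> mQ Qfin; apply: smallest_sub.
  split.
  - exact: approximable0.
  - by move=> A aA; rewrite setTD; exact: approximableC.
  - exact: approximable_bigcup.
by move=> _ [i [P ->]]; exact: approximable_lab.
Qed.

Hypothesis sigma_regular : forall E (e : R), measurable E -> (mu E < +oo)%E -> 0 < e ->
  exists B, [/\ cell_sigma B, measurable B, E `<=` B & (mu B <= mu E + e%:E)%E].

Lemma outer_cells E z (e : R) : measurable E -> E `<=` cell 0 z -> 0 < e ->
  exists V, [/\ cell_open V, E `<=` V & (mu V <= mu E + e%:E)%E].
Proof.
move=> mE Ez e0; have e20 : 0 < e / 2 by rewrite divr_gt0.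
have Efin : (mu E < +oo)%E.
  by apply: le_lt_trans (cfin 0 z); apply: le_measure; rewrite ?inE.
have [B [sB mB EB muB]] := sigma_regular mE Efin e20.
have [V [W [oV oW BV BW h]]] := approximable_sigma (mcell 0 z) (cfin 0 z) sB e20.
have mV := measurable_cell_open oV; have mW := measurable_cell_open oW.
exists (V `&` cell 0 z); split.
- by apply: cell_openI => //; exact: cell_open_cell.
- by move=> x Ex; split; [apply: BV; exact: EB|exact: Ez].
apply: (@le_trans _ _ (mu (B `|` (V `&` W `&` cell 0 z)))).
  apply: le_measure; rewrite ?inE//.
  - exact: measurableI.
  - by apply: measurableU => //; do 2 apply: measurableI => //.
  - move=> x [Vx cx]; have [Bx|Bx] := pselect (B x); first by left.
    by right; split => //; split => //; exact: BW.
have mVW : measurable (V `&` W `&` cell 0 z) by do 2 apply: measurableI => //.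
apply: (le_trans (measureU2 mu mB mVW)).
apply: (le_trans (leeD muB h)); rewrite -addeA -EFinD.
by rewrite -(splitr e).
Qed.

(** Cover [E] by an open set of nearly the same measure and split this into its
    largest cells of generation at least [i0]; [E] fills at most the fraction
    [r] of each. *)
Lemma low_density_null (E : set X) z i0 (r : R) : measurable E -> E `<=` cell 0 z ->
  0 <= r < 1 ->
  (forall x i, (i0 <= i)%N -> E x -> avg (cell i x) \1_E <= r) -> mu E = 0%E.
Proof.
move=> mE Ez /andP[r0 r1] dens.
have Efin : (mu E < +oo)%E.
  by apply: le_lt_trans (cfin 0 z); apply: le_measure; rewrite ?inE.
have EfinN : mu E \is a fin_num by rewrite ge0_fin_numE.
have key e : 0 < e -> (mu E <= r%:E * (mu E + e%:E))%E.
  move=> e0; have [V [oV EV muV]] := outer_cells mE Ez e0.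
  have mV := measurable_cell_open oV.
  apply: le_trans (lee_wpmul2l _ muV); last by rewrite lee_fin.
  have cS := @cover_stop i0 V; have dV := dom_cover i0 oV.
  have -> : mu E = (\int[mu]_(x in dom (cover i0 V)) (\1_E x)%:E)%E.
    by rewrite integral_indic ?dV// (setIidl EV).
  have iE : cell_integrable mu lab (cover i0 V) (\1_E : X -> R).
    by move=> x i _; exact: indic_integrable.
  have mIE : measurable_fun setT (\1_E : X -> R) by exact: measurable_indic.
  rewrite -(integral_condE1 labP cS mIE (fun x => indic_ge0 R E x) iE).
  have -> : (r%:E * mu V = \int[mu]_(x in dom (cover i0 V)) r%:E)%E.
    by rewrite dV integral_cst.
  apply: le_ge0_integral => x Dx.
    by rewrite lee_fin; apply: condE_ge0 => y; exact: indic_ge0.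
  rewrite lee_fin /Cells.condE; case cx : (cover i0 V x) => [i|//].
  have [[ii _] _] := first_some cx.
  have [[y [cy Ey]]|none] := pselect (exists y, cell i x y /\ E y).
    by rewrite -(eq_cell cy); exact: dens.
  rewrite (@eq_avg _ _ _ mu _ _ (fun=> 0)) ?avg_cst//.
  by move=> y cy; apply: indic_out => Ey; apply: none; exists y.
apply/eqP; rewrite eq_le measure_ge0 andbT.
set m := fine (mu E); have mE' : mu E = m%:E by rewrite fineK.
rewrite mE' lee_fin leNgt; apply/negP => m0.
have e0 : 0 < m * (1 - r) / 2 by rewrite divr_gt0// mulr_gt0// subr_gt0.
have := key _ e0; rewrite mE' -EFinD -EFinM lee_fin; nra.
Qed.

(** If [f x > c], separate the two by rationals. The set of points with a given
    choice of rationals has density less than [1] in its small cells, by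
    Chebyshev's inequality, and is null by [low_density_null]. *)
Theorem cell_differentiation (f : X -> R) b : measurable_fun setT f ->
  (forall x, 0 <= f x <= b) ->
  {ae mu, forall x, forall i0 c,
    (forall i, (i0 <= i)%N -> avg (cell i x) f <= c) -> f x <= c}.
Proof.
move=> mf fb.
have fi i x : mu.-integrable (cell i x) (EFin \o f).
  by apply: (bounded_integrable (mcell i x) (cfin i x) mf) => y _; exact: fb.
(* [lab 0 x = k] keeps the set inside one cell, hence of finite measure *)
pose F k i0 (c e : rat) := [set x | [/\ lab 0 x = k, ratr e <= f x &
  forall i, (i0 <= i)%N -> avg (cell i x) f <= ratr c]].
have nF k i0 c e : (c < e)%R -> mu.-negligible (F k i0 c e).
  move=> ce.
  have mF : measurable (F k i0 c e).
    rewrite (_ : F k i0 c e = lab 0 @^-1` [set k] `&` [set x | ratr e <= f x] `&`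
      \bigcap_(i in [set i | (i0 <= i)%N]) [set x | condE (fun=> Some i) f x <= ratr c]).
      apply: measurableI; first apply: measurableI.
      - exact: (cell_meas labP).
      - have : measurable_fun setT (fun x => ratr e <= f x) by exact: measurable_fun_ler.
        by move=> /(_ measurableT [set true]); rewrite setTI; apply.
      - apply: bigcap_measurable => [|i _]; first by exists i0; exact: leqnn.
        have mC : measurable_fun setT (condE (fun=> Some i) f).
          by apply: (measurable_condE labP) => x y j [->].
        have : measurable_fun setT (fun x => condE (fun=> Some i) f x <= ratr c).
          exact: measurable_fun_ler.
        by move=> /(_ measurableT [set true]); rewrite setTI; apply.
    apply/seteqP; split => x; first by move=> [? ? h]; split => // i ii; exact: h.
    by move=> [[? ?] h]; split => // i ii; exact: (h i ii).
  exists (F k i0 c e); split => //.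
  have [[z [zk _ _]]|none] := pselect (F k i0 c e !=set0); last first.
    rewrite (_ : F k i0 c e = set0) ?measure0//.
    by rewrite -subset0 => x Fx; apply: none; exists x.
  have [c0|c0] := ltP (ratr c : R) 0.
    rewrite (_ : F k i0 c e = set0) ?measure0// -subset0 => x [_ _ h].
    have := h i0 (leqnn _); rewrite leNgt => /negP; apply.
    by apply: (lt_le_trans c0); apply: avg_ge0 => y _; case/andP: (fb y).
  have ce' : (ratr c : R) < ratr e by rewrite ltr_rat.
  have e0 : 0 < (ratr e : R) by exact: le_lt_trans ce'.
  apply: (low_density_null (z := z) (i0 := i0) (r := ratr c / ratr e)) => //.
  - by move=> x [xk _ _]; rewrite /Cells.cell/= xk zk.
  - by rewrite divr_ge0 ?(ltW e0)//= ltr_pdivrMr// mul1r.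
  move=> x i ii Fx; rewrite ler_pdivlMr// mulrC -avgZ//; last exact: indic_integrable.
  have [_ _ h] := Fx; apply: le_trans (h i ii).
  apply: le_avg => //.
    have := integrableZl (mcell i x) (ratr e) (indic_integrable (mcell i x) (cfin i x) mF).
    by apply: eq_integrable.
  move=> y _; have [Fy|Fy] := pselect (F k i0 c e y).
    by rewrite indic_in// mulr1; case: Fy.
  by rewrite indic_out// mulr0; case/andP: (fb y).
pose G (u : nat * nat * rat * rat) : set X :=
  if (u.1.2 < u.2)%R then F u.1.1.1 u.1.1.2 u.1.2 u.2 else set0.
have nG u : mu.-negligible (G u).
  by rewrite /G; case: ifPn => [/nF//|_]; exact: negligible_set0.
have nU : mu.-negligible (\bigcup_n (if unpickle n is Some u then G u else set0)).
  by apply: negligible_bigcup => n; case: unpickle => // *; exact: negligible_set0.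
apply: negligibleS nU => x /= /existsNP[i0 /existsNP[c /not_implyP[h /negP]]].
rewrite -ltNge => cf.
have [c' /itvP c'E] := rat_in_itvoo cf.
have c'f : ratr c' < f x by rewrite c'E.
have [e /itvP eE] := rat_in_itvoo c'f.
exists (pickle (lab 0 x, i0, c', e)); [exact: I|rewrite pickleK /G/=].
have -> : (c' < e)%R by rewrite -(ltr_rat R) eE.
split => //; first by rewrite eE.
by move=> i ii; apply: (le_trans (h i ii)); rewrite c'E.
Qed.

End differentiation.

(** * Lebesgue measure of boxes *)

Section volume_box.
Context {R : realType}.

Definition box n (a : 'rV[R]_n) (l : R) : set 'rV[R]_n :=
  [set x | forall i, a 0 i <= x 0 i < a 0 i + l].

Lemma measurable_box n (a : 'rV[R]_n) l : @measurable _ (borelV R n) (box a l).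
Proof.
rewrite (_ : box a l = \bigcap_(i in [set: 'I_n])
    (@coordV R n i @^-1` `[a 0 i, a 0 i + l[%classic)).
  apply: fin_bigcap_measurable => [|i _]; first exact: finite_finset.
  have := @measurable_coordV R n i measurableT `[a 0 i, a 0 i + l[%classic.
  by rewrite setTI; apply; exact: measurable_itv.
apply/seteqP; split => x /= h.
  by move=> i _ /=; rewrite in_itv/=; exact: h.
by move=> i; have := h i I; rewrite /= in_itv.
Qed.

Lemma consV_ord0 n (u : R) (v : borelV R n) :
  (consV (u, v) : 'rV[R]_n.+1) 0 ord0 = u.
Proof. by have := consVK (u, v); rewrite /unconsV /coordV => -[]. Qed.

Lemma consV_lift n (u : R) (v : borelV R n) (j : 'I_n) :
  (consV (u, v) : 'rV[R]_n.+1) 0 (lift ord0 j) = (v : 'rV[R]_n) 0 j.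
Proof.
have -> : lift ord0 j = rshift 1 j by exact: val_inj.
by rewrite /consV (row_mxEr (u%:M : 'rV[R]_1)).
Qed.

Lemma borel_volume_box n (a : 'rV[R]_n) l : 0 <= l ->
  borel_volume R n (box a l) = (l ^+ n)%:E.
Proof.
move=> l0; elim: n a => [|n IH] a.
  by rewrite /= diracE mem_set// => -[].
rewrite /= /consV_measure /pushforward.
pose a' : 'rV[R]_n := \row_j a 0 (lift ord0 j).
have -> : @consV R n @^-1` box a l = `[a 0 ord0, a 0 ord0 + l[%classic `*` box a' l.
  apply/seteqP; split => -[u v].
    move=> h; split => [|j].
      by have := h ord0; rewrite consV_ord0 /= in_itv.
    by have := h (lift ord0 j); rewrite consV_lift mxE.
  move=> [/= + h] i; rewrite in_itv/= => hu.
  have [j ->|->] := unliftP ord0 i; first by rewrite consV_lift; have := h j; rewrite mxE.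
  by rewrite consV_ord0.
rewrite product_measure1E; last 2 first.
- exact: measurable_itv.
- exact: measurable_box.
rewrite IH exprS EFinM; congr (_ * _)%E.
apply: (etrans (lebesgue_measure_itv _)); rewrite /= lte_fin ltrDl.
case: ifPn => [l1|]; first by rewrite -EFinD addrAC subrr add0r.
by rewrite -leNgt => l1; congr (_%:E); apply/eqP; rewrite eq_le l0.
Qed.

End volume_box.

Section lebesgue.
Context {R : realType} {n : nat}.
Local Notation X := (lebesgueV R n).
Local Notation vol := (volume R n).

Lemma borel_lebesgue (A : set 'rV[R]_n) : @measurable _ (borelV R n) A ->
  @measurable _ X A.
Proof. by move=> mA; exact: caratheodory_measurable_mu_ext mA. Qed.

Lemma volume_borel (A : set 'rV[R]_n) : @measurable _ (borelV R n) A ->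
  vol A = borel_volume R n A.
Proof. by move=> mA; rewrite /volume /completed_measure_extension measurable_mu_extE. Qed.

Lemma volume_box (a : 'rV[R]_n) l : 0 <= l -> vol (box a l) = (l ^+ n)%:E.
Proof. by move=> l0; rewrite volume_borel ?borel_volume_box//; exact: measurable_box. Qed.

(** The volume of a set is an infimum over its countable Borel covers. *)
Lemma borel_hull (E : set X) (e : R) : measurable E -> (vol E < +oo)%E -> 0 < e ->
  exists B, [/\ @measurable _ (borelV R n) B, E `<=` B & (vol B <= vol E + e%:E)%E].
Proof.
move=> mE Efin e0.
have EfinN : mu_ext (borel_volume R n) E \is a fin_num.
  by rewrite ge0_fin_numE//; exact: mu_ext_ge0.
have [x [F [mF EF] <-] xE] := lb_ereal_inf_adherent e0 EfinN.
exists (\bigcup_k F k); split => //.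
- exact: bigcup_measurable.
- apply: le_trans (ltW xE).
  have mF' k : @measurable _ X (F k) by apply: borel_lebesgue.
  apply: (le_trans (measure_sigma_subadditive _ mF' _ (@subset_refl _ _))).
    exact: bigcup_measurable.
  by apply: lee_nneseries => [k _ _|k _]; [exact: measure_ge0|rewrite -(volume_borel (mF k))].
Qed.

End lebesgue.

(** * Dyadic grids as systems of cells *)

Section grids.
Context {R : realType} {n : nat}.
Local Notation X := (lebesgueV R n).
Local Notation vol := (volume R n).
Implicit Types (x y t : 'rV[R]_n) (k : int).

Definition shift_sign k : R := (-1) ^ k.

Lemma shift_signS k : shift_sign (k + 1) = - shift_sign k.
Proof. by rewrite /shift_sign expfzDr ?oppr_eq0 ?oner_eq0// expr1z mulrN1. Qed.

Definition cube_index t k x : 'rV[int]_n :=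
  \row_j Num.floor (2 ^ k * x 0 j - shift_sign k * t 0 j).

Lemma pow2_gt0 k : (0 : R) < 2 ^ k. Proof. exact: exprz_gt0. Qed.

Lemma pow2NK k : (2 : R) ^ (- k) * 2 ^ k = 1.
Proof. by rewrite -expfzDr// addNr expr0z. Qed.

Lemma pow2S k : (2 : R) ^ (k + 1) = 2 * 2 ^ k.
Proof. by rewrite expfzDr// expr1z mulrC. Qed.

Lemma pow2_add1N k : (2 : R) ^ (- k) = 2 * 2 ^ (- (k + 1)).
Proof. by rewrite opprD addrC -[in LHS](addrNK 1 (- k)) pow2S addrC. Qed.

Lemma dyadic_cube_box t k (m : 'rV[int]_n) : dyadic_cube t k m =
  box (2 ^ (- k) *: (map_mx intr m + shift_sign k *: t)) (2 ^ (- k)).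
Proof.
have h := pow2_gt0 (- k).
apply/seteqP; split => [_ [u hu <-] i|x hx].
  rewrite !mxE -/(shift_sign k); have /andP[u0 u1] := hu i.
  have u0' := mulr_ge0 (ltW h) u0.
  have u1' : 2 ^ (- k) * u 0 i < 2 ^ (- k) by rewrite gtr_pMr.
  by rewrite !mulrDr; apply/andP; split; lra.
exists (2 ^ k *: x - shift_sign k *: t - map_mx intr m); last first.
  by rewrite -/(shift_sign k) subrK subrK scalerA pow2NK scale1r.
move=> i; have := hx i; rewrite !mxE -/(shift_sign k).
set s := shift_sign k; set v := (m 0 i)%:~R.
move=> /andP[x0 x1]; have e := pow2NK k; have h' := pow2_gt0 k.
have xe : x 0 i = 2 ^ (- k) * (2 ^ k * x 0 i) by rewrite mulrA e mul1r.
move: (2 ^ k * x 0 i) xe => w xe; rewrite xe in x0 x1; apply/andP; split.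
  by move: x0; rewrite ler_pM2l//; lra.
by move: x1; rewrite -[X in _ + X]mulr1 -mulrDr ltr_pM2l//; lra.
Qed.

Lemma cube_indexP t k (m : 'rV[int]_n) x :
  cube_index t k x = m <-> dyadic_cube t k m x.
Proof.
rewrite dyadic_cube_box; have h := pow2_gt0 (- k).
have e := pow2NK k; have h' := pow2_gt0 k.
have E i : (Num.floor (2 ^ k * x 0 i - shift_sign k * t 0 i) = m 0 i) <->
   2 ^ (- k) * ((m 0 i)%:~R + shift_sign k * t 0 i) <= x 0 i <
   2 ^ (- k) * ((m 0 i)%:~R + shift_sign k * t 0 i) + 2 ^ (- k).
  have xe : x 0 i = 2 ^ (- k) * (2 ^ k * x 0 i) by rewrite mulrA e mul1r.
  rewrite [X in _ <= X < _]xe; move: (2 ^ k * x 0 i) => w.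
  rewrite -[X in _ <= _ < _ + X]mulr1 -mulrDr ler_pM2l// ltr_pM2l//.
  split => [/eqP|]; rewrite ?floor_eq ?intrD /=; first lra.
  by move=> H; apply/eqP; rewrite floor_eq intrD /=; lra.
split => [xm i|hx].
  by have := congr1 (fun v : 'rV[int]_n => v 0 i) xm; rewrite !mxE => /E.
by apply/rowP => i; rewrite mxE; apply/E; have := hx i; rewrite !mxE.
Qed.

(** Passing to the next generation doubles the argument of the floor and adds
    [3 * shift_sign k * t], which is an integer vector. *)
Lemma cube_index_refine t k x y : (forall i, t 0 i \in [:: 0; 1 / 3; 2 / 3]) ->
  cube_index t (k + 1) x = cube_index t (k + 1) y ->
  cube_index t k x = cube_index t k y.
Proof.
move=> tT xy; apply/rowP => i; have /rowP/(_ i) := xy; rewrite !mxE shift_signS pow2S.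
have [c ce] : exists c : int, 3 * shift_sign k * t 0 i = c%:~R.
  have [s ->] : exists s : int, shift_sign k = s%:~R.
    by exists ((-1) ^ k); rewrite /shift_sign rmorphXz ?rmorphN1.
  have := tT i; rewrite !inE => /or3P[]/eqP->.
  - by exists 0; rewrite mulr0.
  - by exists s; field.
  - by exists (s * 2); rewrite intrM; field.
have key (z z' : R) : Num.floor (2 * z + c%:~R) = Num.floor (2 * z' + c%:~R) ->
    Num.floor z = Num.floor z'.
  move=> e; apply/eqP; rewrite floor_eq.
  have := floor_le (2 * z + c%:~R); have := floorD1_gt (2 * z + c%:~R).
  rewrite e => a1 a2.
  have := floor_le z'; have := floorD1_gt z'.
  have : (2 * Num.floor z' + c <= Num.floor (2 * z' + c%:~R)).
    by rewrite floor_ge_int intrD intrM; have := floor_le z'; lra.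
  have : (Num.floor (2 * z' + c%:~R) < 2 * Num.floor z' + c + 2).
    rewrite floor_lt_int !intrD intrM; have := floorD1_gt z'; rewrite intrD; lra.
  rewrite -lezD1 -!(ler_int R); move: a1; rewrite !intrD !intrM.
  by move=> a1 h1 h2 h3 h4; apply/andP; split; lra.
move=> e; apply: key; move: e.
rewrite -!ce.
set s := shift_sign k.
have -> : 2 * 2 ^ k * x 0 i - - s * t 0 i = 2 * (2 ^ k * x 0 i - s * t 0 i) + 3 * s * t 0 i by ring.
by have -> : 2 * 2 ^ k * y 0 i - - s * t 0 i = 2 * (2 ^ k * y 0 i - s * t 0 i) + 3 * s * t 0 i by ring.
Qed.

Definition cube_label t (N0 : nat) (i : nat) (x : X) : nat :=
  pickle (cube_index t (i%:Z - N0%:Z) x).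

Lemma cube_label_inj t N0 i x y : cube_label t N0 i x = cube_label t N0 i y <->
  cube_index t (i%:Z - N0%:Z) x = cube_index t (i%:Z - N0%:Z) y.
Proof.
by split => [/(pcan_inj pickleK)//|]; rewrite /cube_label => ->.
Qed.

Lemma cell_cube t N0 i x : cell (cube_label t N0) i x =
  dyadic_cube t (i%:Z - N0%:Z) (cube_index t (i%:Z - N0%:Z) x).
Proof.
apply/seteqP; split => y.
  by move=> /cube_label_inj /cube_indexP.
by move=> /cube_indexP yx; apply/cube_label_inj.
Qed.

Lemma measurable_cube t k m : @measurable _ X (dyadic_cube t k m).
Proof. by rewrite dyadic_cube_box; apply: borel_lebesgue; exact: measurable_box. Qed.

Lemma volume_cube t k m : vol (dyadic_cube t k m) = ((2 ^ (- k)) ^+ n)%:E.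
Proof. by rewrite dyadic_cube_box volume_box// ltW// pow2_gt0. Qed.

Lemma cell_volume t N0 i x :
  (vol : {measure set X -> \bar R}) (cell (cube_label t N0) i x) =
  ((2 ^ (- (i%:Z - N0%:Z))) ^+ n)%:E.
Proof. by rewrite cell_cube; exact: volume_cube. Qed.

Lemma cube_partition t N0 : cell_partition vol (cube_label t N0).
Proof.
split => i x; last 2 first.
- by rewrite cell_volume lte_fin exprn_gt0// pow2_gt0.
- by rewrite cell_volume ltry.
have [[z zx]|none] := pselect (exists z, cube_label t N0 i z = x).
  rewrite (_ : _ @^-1` _ = cell (cube_label t N0) i z).
    by rewrite cell_cube; exact: measurable_cube.
  by apply/seteqP; split => y /=; rewrite /cell /= zx.
rewrite (_ : _ @^-1` _ = set0) //; apply/seteqP; split => y //= yx.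
by apply: none; exists y.
Qed.

End grids.

Section dyadic_grid_instance.
Context {R : realType} {n : nat}.
Local Notation X := (lebesgueV R n).
Local Notation vol := (volume R n).
Variables (t : 'rV[R]_n) (N0 : nat).
Local Notation lab := (cube_label t N0).

(** A point in the open half-space has a small cube of the grid inside the
    half-space; whether the cube is inside depends only on its index. *)
Lemma half_space_cells (j : 'I_n) (a : R) :
  cell_sigma lab [set x | a < (x : 'rV[R]_n) 0 j].
Proof.
rewrite (_ : [set _ | _] = \bigcup_i [set x |
    2 ^ (i%:Z - N0%:Z) * a - shift_sign (i%:Z - N0%:Z) * t 0 j <
    (cube_index t (i%:Z - N0%:Z) x 0 j)%:~R]); last first.
  apply/seteqP; split => x /=.
    move=> ax; have d0 : 0 < x 0 j - a by rewrite subr_gt0.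
    (* at generation [i] the cubes are smaller than the distance to the boundary *)
    pose i := (N0 + Num.truncn ((x 0 j - a)^-1)%R)%N; exists i => //=.
    set u := Num.truncn _ in i *; rewrite mxE.
    rewrite (_ : i%:Z - N0%:Z = u%:Z); last by rewrite /i PoszD; ring.
    have := floorD1_gt (2 ^ u%:Z * x 0 j - shift_sign u%:Z * t 0 j).
    rewrite intrD; set F := (Num.floor _)%:~R.
    have h : 1 <= 2 ^ u%:Z * (x 0 j - a).
      rewrite -ler_pdivrMr// mul1r; apply: (le_trans (ltW (truncnS_gt _))).
      rewrite -/u -exprnP -natrX ler_nat; exact: ltn_expl.
    lra.
  move=> [i _ /=]; rewrite mxE => h.
  have := le_trans (ltW h) (floor_le _); have := lt_le_trans h (floor_le _).
  by rewrite ltrD2r ltr_pM2l// pow2_gt0.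
apply: sigma_algebra_bigcup => i; apply: sub_sigma_algebra.
exists i, [set u | exists2 m : 'rV[int]_n, pickle m = u &
  2 ^ (i%:Z - N0%:Z) * a - shift_sign (i%:Z - N0%:Z) * t 0 j < (m 0 j)%:~R].
apply/seteqP; split => x /=; first by exists (cube_index t (i%:Z - N0%:Z) x).
by move=> [m /(pcan_inj pickleK) ->].
Qed.

Lemma borel_cells (B : set X) : @measurable _ (borelV R n) B -> cell_sigma lab B.
Proof.
apply: smallest_sub; first exact: smallest_sigma_algebra.
rewrite -bigcup_seq => A [j _ [Y mY <-]]; rewrite setTI.
suff : @measurable _ (measurableTypeR R) `<=`
    [set Y | cell_sigma lab (@coordV R n j @^-1` Y)] by apply.
rewrite [X in X `<=` _]RGenOInfty.measurableE; apply: smallest_sub.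
  split.
  - rewrite /= preimage_set0; exact: sigma_algebra0.
  - by move=> C /= hC; rewrite setTD preimage_setC; exact: sigma_algebraC.
  - by move=> F hF /=; rewrite preimage_bigcup; exact: sigma_algebra_bigcup.
move=> _ [a ->] /=; have := half_space_cells j a; congr cell_sigma.
by apply/seteqP; split => x /=; rewrite in_itv/= andbT.
Qed.

Theorem dyadic_cubes : (forall i, t 0 i \in [:: 0; 1 / 3; 2 / 3]) ->
  dyadic vol lab (2 ^+ n).
Proof.
move=> tT; have ref i (x y : X) : lab i.+1 x = lab i.+1 y -> lab i x = lab i y.
  move=> /cube_label_inj e; apply/cube_label_inj; apply: cube_index_refine => //.
  by rewrite (_ : _ + 1 = i.+1%:Z - N0%:Z)// -addn1 PoszD; ring.
split => //; first exact: cube_partition.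
- move=> i x; rewrite !cell_volume -EFinM lee_fin -exprMn.
  have -> : i.+1%:Z - N0%:Z = i%:Z - N0%:Z + 1 by rewrite -addn1 PoszD; ring.
  by rewrite (pow2_add1N (i%:Z - N0%:Z)) lexx.
- move=> f b mf fb; apply: (cell_differentiation (cube_partition t N0) ref _ mf fb).
  move=> E e mE Efin e0; have [B [mB EB vB]] := borel_hull mE Efin e0.
  by exists B; split => //; [exact: borel_cells|exact: borel_lebesgue].
Qed.

End dyadic_grid_instance.

(** * Variable Lebesgue norms *)

Section ae_monotone.
Import HBNNSimple.
Context d (X : measurableType d) (R : realType).
Variable mu : {measure set X -> \bar R}.

(** Simple functions below [f] may be cut off on a null set, so again no
    measurability of [f] or [g] is needed. *)
Lemma ae_le_ge0_integral (f g : X -> \bar R) :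
  (forall x, (0 <= f x)%E) -> (forall x, (0 <= g x)%E) ->
  {ae mu, forall x, (f x <= g x)%E} ->
  (\int[mu]_x f x <= \int[mu]_x g x)%E.
Proof.
move=> f0 g0 [N [mN N0 fgN]].
rewrite [leLHS]ge0_integralE//; apply: ub_ereal_sup => _ [h /= hf <-].
have mh : measurable_fun [set: X] (fun x : X => (h x)%:E) by exact/measurable_EFinP.
have -> : sintegral mu h = (\int[mu]_x (h x)%:E)%E by rewrite integral_nnsfun// patch_setT.
rewrite (ge0_negligible_integral mN measurableT mh _ N0); last first.
  by move=> x _; rewrite lee_fin.
rewrite integral_mkcond; apply: le_ge0_integral => x _; rewrite patchE.
  by case: ifP => // _; rewrite lee_fin.
case: ifPn => [/set_mem[_ Nx]|_]; last exact: g0.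
apply: (@le_trans _ _ (f x)); first by have := hf x; rewrite patchE mem_set.
by apply: contrapT => nfg; apply: Nx; exact: fgN.
Qed.

End ae_monotone.

Section variable_norm.
Context {R : realType}.
Implicit Types t u q : \bar R.

Lemma lpower_ge0 t q : (0 <= lpower t q)%E.
Proof. by case: q => [r| |] //=; [exact: poweR_ge0|case: ifP]. Qed.

Lemma lpower_le t u q : (1 <= q)%E -> (0 <= t)%E -> (t <= u)%E ->
  (lpower t q <= lpower u q)%E.
Proof.
case: q => [r| |] //=.
  rewrite lee_fin => r1 t0 tu; apply: gt0_ler_poweR => //.
  - exact: le_trans r1.
  - by rewrite in_itv/= t0 leey.
  - by rewrite in_itv/= (le_trans t0 tu) leey.
move=> _ t0 tu; case: ifP => t1; case: ifP => u1 //.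
by rewrite (le_trans tu u1) in t1.
Qed.

Context {n : nat}.
Variable p : 'rV[R]_n -> \bar R.
Hypothesis p_ge1 : forall x, (1 <= p x)%E.
Implicit Types g h : 'rV[R]_n -> \bar R.

Lemma le_modular g h : (forall x, (0 <= g x)%E) -> (forall x, (g x <= h x)%E) ->
  (modular p g <= modular p h)%E.
Proof.
move=> g0 gh; apply: le_ge0_integral => x _; first exact: lpower_ge0.
by apply: lpower_le.
Qed.

Lemma le_vlnorm (K : R) g h : 0 < K ->
  (forall l : R, 0 < l -> (modular p (fun x => g x / l%:E) <= 1)%E ->
    (modular p (fun x => h x / (K * l)%:E) <= 1)%E) ->
  (vlnorm p h <= K%:E * vlnorm p g)%E.
Proof.
move=> K0 gh; rewrite -lee_pdivrMl//; apply: le_ereal_inf_tmp => _ [l /= [l0 gl] <-].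
rewrite lee_pdivrMl// -EFinM; apply: ereal_inf_lbound; exists (K * l) => //=.
by split; [exact: mulr_gt0|exact: gh].
Qed.

Lemma lee_vdiv (a b : \bar R) (l : R) : 0 < l -> (a <= b)%E -> (a / l%:E <= b / l%:E)%E.
Proof. by move=> l0 ab; rewrite lee_pmul2r// inver gt_eqF// lte_fin invr_gt0. Qed.

Lemma le_vlnormM (K : R) g h : 0 < K -> (forall x, (0 <= h x)%E) ->
  (forall x, (h x <= K%:E * g x)%E) -> (vlnorm p h <= K%:E * vlnorm p g)%E.
Proof.
move=> K0 h0 hg; apply: le_vlnorm => // l l0; apply: le_trans.
have Kl0 : 0 < K * l by exact: mulr_gt0.
apply: le_modular => x.
  by rewrite mule_ge0// inver gt_eqF// lee_fin invr_ge0 ltW.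
apply: (le_trans (lee_vdiv Kl0 (hg x))).
rewrite !inver !gt_eqF// invfM EFinM muleACA -EFinM divff ?gt_eqF// mul1e.
by [].
Qed.

End variable_norm.

(** * Balls and cubes *)

Section balls.
Context {R : realType} {n : nat}.
Local Notation X := (lebesgueV R n).
Local Notation vol := (volume R n).
Implicit Types (x y c t : 'rV[R]_n) (r : R) (k : int).

Lemma dyadic_scale (a : R) : 0 < a -> exists e : int, 2 ^ e <= a < 2 * 2 ^ e.
Proof.
move=> a0.
have big (b : R) : b < 2 ^ (Num.truncn b).+1%:Z.
  rewrite -exprnP -natrX; apply: (lt_le_trans (truncnS_gt _)).
  by rewrite ler_nat ltnW// ltn_expl.
pose N := (Num.truncn a^-1).+1.
have aN : 2 ^ (- N%:Z) <= a.
  by rewrite -invr_expz invf_ple ?posrE// ?pow2_gt0// ltW// big.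
have ex : exists j : nat, a < 2 ^ (j%:Z - N%:Z).
  exists (N + (Num.truncn a).+1)%N; rewrite (_ : _ - _ = (Num.truncn a).+1%:Z); first exact: big.
  by rewrite PoszD; ring.
case: (ex_minnP ex) => -[|j] aj jmin.
  by move: aj; rewrite sub0r ltNge aN.
exists (j%:Z - N%:Z); apply/andP; split; last first.
  by rewrite -pow2S; move: aj; rewrite (_ : _ - _ = j%:Z - N%:Z + 1)// -addn1 PoszD; ring.
by rewrite leNgt; apply/negP => /jmin; rewrite ltnn.
Qed.

Lemma eball_coord c r y : eball c r y -> forall i, c 0 i - r < y 0 i < c 0 i + r.
Proof.
move=> cy i; have r0 : 0 < r by exact: le_lt_trans (sqrtr_ge0 _) cy.
suff : `|y 0 i - c 0 i| < r by rewrite ltr_norml; lra.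
apply: le_lt_trans cy; rewrite -sqrtr_sqr ler_wsqrtr// (bigD1 i)//= lerDl.
by apply: sumr_ge0 => j _; exact: sqr_ge0.
Qed.

Lemma coord_eball c r y (a : R) : 0 < r -> 0 <= a -> n%:R * a ^+ 2 < r ^+ 2 ->
  (forall i, c 0 i - a <= y 0 i <= c 0 i + a) -> eball c r y.
Proof.
move=> r0 a0 ar cy; rewrite /eball /= -(gtr0_norm r0) -sqrtr_sqr ltr_sqrt ?exprn_gt0//.
apply: le_lt_trans ar; rewrite mulr_natl -[in leRHS](card_ord n) -sumr_const.
apply: ler_sum => i _; have := cy i => /andP[c1 c2]; nra.
Qed.

Lemma le_volume (A B : set 'rV[R]_n) : A `<=` B -> (vol A <= vol B)%E.
Proof. by move=> AB; exact: le_outer_measure. Qed.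

Lemma volume_eball_ge c r : 0 < r ->
  (((2 * r / n.+1%:R) ^+ n)%:E <= vol (eball c r))%E.
Proof.
move=> r0; pose a := r / n.+1%:R; have a0 : 0 < a by exact: divr_gt0.
have ra : r = a * (n%:R + 1) by rewrite natr1 /a divfK.
rewrite -mulrA -/a; pose b : 'rV[R]_n := \row_i (c 0 i - a).
rewrite -(volume_box b (mulr_ge0 (ler0n _ 2) (ltW a0))).
apply: le_volume => y yb.
have n0 : (0 : R) <= n%:R by [].
apply: (coord_eball r0 (ltW a0)); first by rewrite ra; nra.
by move=> i; have := yb i; rewrite mxE => /andP[]; lra.
Qed.

Lemma volume_eball_le c r : 0 < r -> (vol (eball c r) <= ((2 * r) ^+ n)%:E)%E.
Proof.
move=> r0; pose b : 'rV[R]_n := \row_i (c 0 i - r).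
rewrite -(volume_box b (mulr_ge0 (ler0n _ 2) (ltW r0))); apply: le_volume => y yb i.
by have := eball_coord yb i; rewrite mxE => /andP[]; lra.
Qed.

Definition third_shift (b : {ffun 'I_n -> bool}) : 'rV[R]_n :=
  \row_i if b i then 1 / 3 else 0.

Lemma third_shift_in b i : third_shift b 0 i \in [:: 0; 1 / 3; 2 / 3].
Proof. by rewrite mxE; case: ifP; rewrite !inE eqxx ?orbT. Qed.

Lemma shift_signP k : shift_sign k = 1 :> R \/ shift_sign k = -1 :> R.
Proof.
have : (shift_sign k : R) ^+ 2 == 1.
  by rewrite /shift_sign expr2 -expfzMl mulrNN mulr1 exp1rz.
by rewrite sqrf_eq1 => /orP[]/eqP; [left|right].
Qed.

(** The one-third trick. In each coordinate, the grid with shift [0] and the grid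
    with shift [1/3] have no points closer than a third of the side; so an
    interval of at most that length avoids one of the two. *)
Lemma ball_in_cube c r k : 6 * r <= 2 ^ (- k) ->
  exists b, forall x y, eball c r x -> eball c r y ->
    cube_index (third_shift b) k y = cube_index (third_shift b) k x.
Proof.
move=> rk; have k0 := pow2_gt0 (R := R) k; have kk := pow2NK (R := R) k.
have rho6 : 6 * (2 ^ k * r) <= 1.
  have := ler_wpM2l (ltW k0) rk; rewrite [X in _ <= X]mulrC kk; lra.
pose lo i := 2 ^ k * c 0 i - 2 ^ k * r.
(* a point of the unshifted grid lies inside the [i]-th projection of the ball *)
pose bad i := (Num.floor (lo i))%:~R + 1 < lo i + 2 * (2 ^ k * r).
exists [ffun i => bad i] => x y cx cy; apply/rowP => i; rewrite !mxE ffunE.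
suff [v hv] : exists v, forall z, eball c r z ->
    Num.floor (2 ^ k * z 0 i - shift_sign k * (if bad i then 1 / 3 else 0)) = v.
  by rewrite !hv.
have f1 := floor_le (lo i); have f2 := floorD1_gt (lo i); rewrite intrD in f2.
have zlo z : eball c r z -> lo i < 2 ^ k * z 0 i < lo i + 2 * (2 ^ k * r).
  move=> /eball_coord /(_ i) /andP[z1 z2].
  rewrite -(ltr_pM2l k0) in z1; rewrite -(ltr_pM2l k0) in z2.
  by rewrite /lo; apply/andP; split; lra.
rewrite /bad; case: ifPn => [gap|]; last first.
  rewrite -leNgt => gap; exists (Num.floor (lo i)) => z /zlo /andP[z1 z2].
  by apply/eqP; rewrite floor_eq intrD; apply/andP; split; lra.
have [->|->] := shift_signP k.
  exists (Num.floor (lo i)) => z /zlo /andP[z1 z2].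
  by apply/eqP; rewrite floor_eq intrD; apply/andP; split; lra.
exists (Num.floor (lo i) + 1) => z /zlo /andP[z1 z2].
by apply/eqP; rewrite floor_eq !intrD; apply/andP; split; lra.
Qed.

End balls.

(** * Averages over balls and cubes *)

Section averages.
Context {R : realType} {n : nat}.
Local Notation X := (lebesgueV R n).
Local Notation vol := (volume R n).
Implicit Types (x y c t : 'rV[R]_n) (r : R) (k : int) (f : 'rV[R]_n -> R[i])
  (A B Q : set 'rV[R]_n).

Lemma cmodulus_ge0 f x : (0 <= cmodulus f x)%E.
Proof. by rewrite lee_fin /Normc.normc; case: (f x) => a b; exact: sqrtr_ge0. Qed.

Lemma volume_ge0 A : (0 <= vol A)%E.
Proof. exact: measure_ge0. Qed.

Lemma average_ge0 f A : (0 <= average f A)%E.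
Proof.
apply: mule_ge0; first by rewrite inve_ge0 volume_ge0.
by apply: integral_ge0 => x _; exact: cmodulus_ge0.
Qed.

Lemma le_integral_set (g : 'rV[R]_n -> \bar R) A B : (forall x, (0 <= g x)%E) ->
  A `<=` B -> (\int[vol]_(x in A) g x <= \int[vol]_(x in B) g x)%E.
Proof.
move=> g0 AB; rewrite integral_mkcond [leRHS]integral_mkcond.
apply: le_ge0_integral => x _; rewrite !patchE; first by case: ifP.
by case: ifPn => [/set_mem/AB Bx|_]; [rewrite mem_set|case: ifP].
Qed.

Lemma average_le f A B (v : R) : 0 < v -> (v%:E <= vol A)%E -> A `<=` B ->
  (average f A <= v^-1%:E * \int[vol]_(x in B) cmodulus f x)%E.
Proof.
move=> v0 vA AB; have cf := cmodulus_ge0 f; apply: lee_pmul.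
- by rewrite inve_ge0 volume_ge0.
- by apply: integral_ge0.
- have -> : (v^-1)%:E = (v%:E)^-1%E by rewrite inver gt_eqF.
  by rewrite lee_pV2// inE ?volume_ge0// lee_fin ltW.
- exact: le_integral_set.
Qed.

Lemma average_volume f A (v : R) : 0 < v -> vol A = v%:E ->
  average f A = (v^-1%:E * \int[vol]_(x in A) cmodulus f x)%E.
Proof. by move=> v0 vA; rewrite /average vA inver gt_eqF. Qed.

Lemma averaging_in (QQ : set (set 'rV[R]_n)) f Q x : trivIset QQ id -> QQ Q -> Q x ->
  averaging QQ f x = average f Q.
Proof.
move=> tQ QQQ Qx; rewrite /averaging (esumID [set Q]); last first.
  by move=> A _; rewrite mule_ge0 ?average_ge0// lee_fin.
rewrite (_ : QQ `&` _ = [set Q]); last by apply/seteqP; split => [A []//|A ->].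
rewrite esum_set1; last by rewrite mule_ge0 ?average_ge0// lee_fin.
rewrite esum1 ?adde0 ?indicE ?mem_set ?mule1//.
move=> A [QA /= AQ]; rewrite indicE memNset ?mule0// => Ax.
by apply: AQ; apply: tQ => //; exists x.
Qed.

Lemma averaging_out (QQ : set (set 'rV[R]_n)) f x : (forall Q, QQ Q -> ~ Q x) ->
  averaging QQ f x = 0%E.
Proof. by move=> nQ; apply: esum1 => A /nQ Ax; rewrite indicE memNset ?mule0. Qed.

Lemma averaging_ge0 (QQ : set (set 'rV[R]_n)) f x : (0 <= averaging QQ f x)%E.
Proof. by apply: esum_ge0 => A _; rewrite mule_ge0 ?average_ge0// lee_fin. Qed.

Lemma eball_center x r : 0 < r -> eball x r x.
Proof.
move=> r0; apply: (coord_eball r0 (lexx 0)); first by rewrite expr0n/= mulr0 exprn_gt0.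
by move=> i; rewrite subr0 addr0 lexx.
Qed.

Lemma maximal_ge0 f x : (0 <= maximal f x)%E.
Proof.
apply: (@le_trans _ _ (average f (eball x 1))); first exact: average_ge0.
by apply: ereal_sup_ubound; exists (x, 1) => //=; split => //; exact: eball_center.
Qed.

(** The cube lies in the ball around [x] of radius [n + 1] times its side. *)
Lemma average_cube_le_maximal f t k m x : dyadic_cube t k m x ->
  (average f (dyadic_cube t k m) <= ((2 * n.+1%:R) ^+ n)%:E * maximal f x)%E.
Proof.
move=> Qx; set l : R := 2 ^ (- k); have l0 : 0 < l by exact: pow2_gt0.
pose r := l * n.+1%:R; have r0 : 0 < r by rewrite mulr_gt0.
have Qball : dyadic_cube t k m `<=` eball x r.
  move=> y; move: Qx; rewrite dyadic_cube_box -/l => Qx Qy.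
  apply: (coord_eball r0 (ltW l0)).
    have n0 : (0 : R) <= n%:R by []; have l20 : 0 < l ^+ 2 by rewrite exprn_gt0.
    by rewrite /r -natr1 exprMn; nra.
  by move=> i; have /andP[] := Qx i; have /andP[] := Qy i; lra.
have vQ : vol (dyadic_cube t k m) = (l ^+ n)%:E by exact: volume_cube.
have vge := volume_eball_ge x r0; have vle := volume_eball_le x r0.
have vfin : vol (eball x r) \is a fin_num.
  by rewrite ge0_fin_numE ?volume_ge0// (le_lt_trans vle) ?ltry.
set v := fine (vol (eball x r)); have vE : vol (eball x r) = v%:E by rewrite fineK.
have v0 : 0 < v.
  by rewrite -lte_fin -vE (lt_le_trans _ vge)// lte_fin exprn_gt0// divr_gt0// mulr_gt0.
have ln0 : 0 < l ^+ n by rewrite exprn_gt0.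
apply: (@le_trans _ _ (((2 * n.+1%:R) ^+ n)%:E * average f (eball x r))%E); last first.
  rewrite lee_wpmul2l ?lee_fin ?exprn_ge0//; apply: ereal_sup_ubound.
  by exists (x, r) => //=; split => //; exact: eball_center.
rewrite (average_volume f v0 vE) muleA -EFinM.
have cf := cmodulus_ge0 f.
have Qself := @subset_refl _ (dyadic_cube t k m).
apply: (le_trans (average_le f ln0 _ Qball)); first by rewrite vQ.
rewrite lee_wpmul2r ?integral_ge0// lee_fin ler_pdivlMr// ler_pdivrMl//.
move: vle; rewrite vE lee_fin /r => vle; apply: (le_trans vle).
by rewrite -exprMn (_ : 2 * (l * _) = l * (2 * n.+1%:R))//; ring.
Qed.

Lemma averaging_le_maximal (QQ : set (set 'rV[R]_n)) f x :
  QQ `<=` adjacent_cubes R n -> trivIset QQ id ->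
  (averaging QQ f x <= ((2 * n.+1%:R) ^+ n)%:E * maximal f x)%E.
Proof.
move=> adj tQ; have [[Q [QQQ Qx]]|none] := pselect (exists Q, QQ Q /\ Q x).
  rewrite (averaging_in f tQ QQQ Qx); have [t _ [[k m] _ /= QE]] := adj _ QQQ.
  by rewrite -QE in Qx *; exact: average_cube_le_maximal.
rewrite averaging_out => [|Q QQQ Qx]; last by apply: none; exists Q.
by rewrite mule_ge0 ?lee_fin ?exprn_ge0// maximal_ge0.
Qed.

End averages.

(** * From averaging operators to stopping times *)

Section limn_einf_bounds.
Context {R : realType}.
Implicit Types (u : (\bar R)^nat) (c : \bar R).

Lemma limn_einf_ge u c n0 : (forall k, (n0 <= k)%N -> (c <= u k)%E) ->
  (c <= limn_einf u)%E.
Proof.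
move=> cu; rewrite limn_einf_lim; apply: lime_ge; first exact: is_cvg_einfs.
exists n0 => // m /= n0m; apply: le_ereal_inf_tmp => _ [k /= mk <-].
by apply: cu; exact: leq_trans mk.
Qed.

Lemma limn_einf_le u c : (forall k, (u k <= c)%E) -> (limn_einf u <= c)%E.
Proof.
move=> uc; rewrite limn_einf_lim; apply: lime_le; first exact: is_cvg_einfs.
by apply: nearW => m; apply: le_trans (uc m); apply: ereal_inf_lbound; exists m => /=.
Qed.

End limn_einf_bounds.

(** Truncate the exponent at its essential bounds. *)
Lemma real_exponent d (X : measurableType d) (R : realType)
    (mu : {measure set X -> \bar R}) (p : X -> \bar R) :
  measurable_fun setT p ->
  [/\ (1 < ess_inf mu p)%E, (ess_inf mu p <= ess_sup mu p)%E
    & (ess_sup mu p < +oo)%E] ->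
  exists q pm pP, [/\ bounded_exponent q pm pP, pm <= pP
    & {ae mu, forall x, p x = (q x)%:E}].
Proof.
move=> mp []; set m := ess_inf mu p; set M := ess_sup mu p => m1 mM Moo.
have mE : m = (fine m)%:E.
  by rewrite fineK// fin_numElt (lt_trans _ m1) ?ltNyr// (le_lt_trans mM).
have ME : M = (fine M)%:E.
  by rewrite fineK// fin_numElt Moo andbT (lt_le_trans _ mM)// (lt_trans _ m1) ?ltNyr.
pose y x := maxe m (mine M (p x)).
have my x : (m <= y x)%E by rewrite le_max lexx.
have yM x : (y x <= M)%E by rewrite ge_max mM ge_min lexx.
have yE x : y x = (fine (y x))%:E.
  rewrite fineK// fin_numElt (le_lt_trans (yM x) Moo) andbT.
  by rewrite (lt_le_trans _ (my x))// mE ltNyr.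
exists (fine \o y), (fine m), (fine M); split.
- split.
  + apply: measurableT_comp; first exact: fine_measurable.
    apply: measurable_maxe; first exact: measurable_cst.
    by apply: measurable_mine => //; exact: measurable_cst.
  + by rewrite -lte_fin -mE.
  + by move=> x /=; rewrite -lee_fin -mE -yE.
  + by move=> x /=; rewrite -lee_fin -ME -yE.
- by rewrite -lee_fin -mE -ME.
- apply: filterS2 (ess_inf_le mu p) (ess_sup_ge mu p) => x mx xM /=.
  by rewrite -yE /y min_r// max_r.
Qed.

Lemma ae_impl d (X : measurableType d) (R : realType)
    (mu : {measure set X -> \bar R}) (P Q : X -> Prop) :
  {ae mu, forall x, P x} -> (forall x, P x -> Q x) -> {ae mu, forall x, Q x}.
Proof. by move=> aeP PQ; apply: filterS aeP. Qed.

Section averaging_to_maximal.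
Context {R : realType} {n : nat}.
Local Notation X := (lebesgueV R n).
Local Notation vol := (volume R n).
Variables (p : 'rV[R]_n -> \bar R) (q : X -> R) (pm pP : R).
Hypothesis p_ge1 : forall x, (1 <= p x)%E.
Hypothesis qA : bounded_exponent q pm pP.
Hypothesis pq : {ae (vol : {measure set X -> \bar R}), forall x, p x = (q x)%:E}.
Implicit Types (x y t : 'rV[R]_n) (f : 'rV[R]_n -> R[i]) (g h : X -> R).

Lemma lpower_real h x : p x = (q x)%:E -> lpower (h x)%:E (p x) = (h x `^ q x)%:E.
Proof. by move=> ->. Qed.

Lemma modular_le_rho h : (modular p (EFin \o h) <= rho vol q h)%E.
Proof.
apply: ae_le_ge0_integral => [x|x|]; [exact: lpower_ge0|by rewrite lee_fin powR_ge0|].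
by apply: (ae_impl pq) => x px; rewrite /= lpower_real.
Qed.

Lemma rho_le_modular h : (rho vol q h <= modular p (EFin \o h))%E.
Proof.
apply: ae_le_ge0_integral => [x|x|]; [by rewrite lee_fin powR_ge0|exact: lpower_ge0|].
by apply: (ae_impl pq) => x px; rewrite /= lpower_real.
Qed.

Definition averaging_bounded (C : R) := forall f (QQ : set (set 'rV[R]_n)),
  vlspace p f -> QQ `<=` adjacent_cubes R n -> trivIset QQ id ->
  (vlnorm p (averaging QQ f) <= C%:E * vlnorm p (cmodulus f))%E.

Definition complexf (h : X -> R) : 'rV[R]_n -> R[i] := fun x => (h x)%:C%C.

Lemma cmodulus_complexf h x : 0 <= h x -> cmodulus (complexf h) x = (h x)%:E.
Proof.
move=> h0; rewrite /cmodulus /complexf /= expr0n/= addr0 sqrtr_sqr.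
by rewrite ger0_norm.
Qed.

Lemma averaging_condE t N0 tau h : (forall i, t 0 i \in [:: 0; 1 / 3; 2 / 3]) ->
  stopping (cube_label t N0) tau -> measurable_fun setT h -> (forall x, 0 <= h x) ->
  (rho vol q h < +oo)%E ->
  exists QQ, [/\ QQ `<=` adjacent_cubes R n, trivIset QQ id &
    forall x, averaging QQ (complexf h) x = (condE vol (cube_label t N0) tau h x)%:E].
Proof.
move=> tT tS mh h0 rh; set lab := cube_label t N0; have labP := cube_partition t N0.
pose QQ := [set Q | exists i x, tau x = Some i /\ Q = cell lab i x].
have tQ : trivIset QQ id.
  move=> _ _ [i [x [tx ->]]] [j [y [ty ->]]] [z [cx cy]].
  have := tS _ _ _ ty cy; rewrite (tS _ _ _ tx cx) => -[ij]; subst j.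
  by rewrite -(eq_cell cx) -(eq_cell cy).
exists QQ; split => //.
  move=> _ [i [x [tx ->]]]; exists t => //; rewrite cell_cube.
  by exists (i%:Z - N0%:Z, cube_index t (i%:Z - N0%:Z) x).
move=> x; rewrite /condE; case tx : (tau x) => [i|]; last first.
  apply: averaging_out => Q [i [y [ty ->]]] cx.
  by have := tS _ _ _ ty cx; rewrite tx.
rewrite (@averaging_in _ _ QQ (complexf h) (cell lab i x)) //; last by exists i, x.
have v0 : (0 : R) < (2 ^ (- (i%:Z - N0%:Z))) ^+ n by rewrite exprn_gt0// pow2_gt0.
have hi := rho_cell_integrable1 qA labP i x mh h0 rh.
rewrite (average_volume _ v0 (cell_volume t N0 i x)) /avg cell_volume /= EFinM.
congr (_ * _)%E; rewrite fineK; last exact: (integrable_fin_num (measurable_cell labP i x) hi).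
by apply: eq_integral => y _; rewrite cmodulus_complexf.
Qed.

(** The norm is an infimum; [C + 1 > C] ensures that some admissible scaling
    lies below it. *)
Lemma averages_bounded_cubes C t N0 : 0 < C -> averaging_bounded C ->
  (forall i, t 0 i \in [:: 0; 1 / 3; 2 / 3]) ->
  averages_bounded vol q (cube_label t N0) (C + 1).
Proof.
move=> C0 bdd tT; split; first by rewrite lerDr ltW.
move=> tau h tS mh h0 rh.
have [QQ [adj tQ QE]] := averaging_condE tT tS mh h0 (le_lt_trans rh (ltry 1)).
have ch : cmodulus (complexf h) = EFin \o h.
  by apply/funext => x; rewrite cmodulus_complexf.
have n1 : (vlnorm p (cmodulus (complexf h)) <= 1)%E.
  apply: ereal_inf_lbound; exists 1 => //=; split => //.
  apply: le_trans rh; rewrite ch; apply: le_trans (modular_le_rho h).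
  by apply: le_modular => // x; rewrite /= inve1 mule1// lee_fin.
have hV : vlspace p (complexf h).
  by split; [split => //; exact: measurable_cst|exact: le_lt_trans n1 (ltry 1)].
have : (vlnorm p (averaging QQ (complexf h)) < (C + 1)%:E)%E.
  apply: (le_lt_trans (bdd _ _ hV adj tQ)).
  apply: (@le_lt_trans _ _ (C%:E * 1)%E); first by apply: lee_wpmul2l => //; rewrite lee_fin ltW.
  by rewrite mule1 lte_fin ltrDl.
move=> /ereal_inf_lt[_ [l [l0 ml] <-]]; rewrite lte_fin => lC.
apply: (le_trans (rho_le_modular _)); apply: le_trans ml.
have labP := cube_partition t N0.
have c0 x : 0 <= condE vol (cube_label t N0) tau h x by exact: condE_ge0.
apply: le_modular => // x /=; first by rewrite lee_fin divr_ge0// addr_ge0// ltW.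
rewrite QE inver gt_eqF// -EFinM lee_fin ler_wpM2l//.
by rewrite lef_pV2 ?posrE ?addr_gt0// ltW.
Qed.

End averaging_to_maximal.

(** * Level sums over the adjacent grids *)

Lemma nat_offset (z : int) (k : nat) : (`|z| < k)%N ->
  exists2 i : nat, i%:Z - k%:Z = z & (i < k + k)%N.
Proof. by move=> zk; exists `|(z + k%:Z)%R|%N; lia. Qed.

Lemma absz_pred_lt (e : int) (a k : nat) : (a + `|e| + 2 <= k)%N ->
  (`|(e - 1)%R| < k)%N.
Proof. lia. Qed.

Section maximal_bound.
Context {R : realType} {n : nat}.
Local Notation X := (lebesgueV R n).
Local Notation vol := (volume R n).
Local Notation T := {ffun 'I_n -> bool}.
Variables (q : X -> R) (pm pP : R).
Hypothesis qA : bounded_exponent q pm pP.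
Local Notation lab b k := (cube_label (third_shift b : 'rV[R]_n) k).

Lemma measurable_normc (f : 'rV[R]_n -> R[i]) : cmeasurable f ->
  measurable_fun [set: X] (fun x => Normc.normc (f x)).
Proof.
move=> [mr mi]; rewrite (_ : (fun _ => _) =
    Num.sqrt \o (fun x => complex.Re (f x) ^+ 2 + complex.Im (f x) ^+ 2)); last first.
  by apply/funext => x /=; case: (f x).
apply: measurableT_comp; first by apply: continuous_measurable_fun; exact: sqrt_continuous.
by apply: measurable_funD; apply: measurable_funX.
Qed.

Variables (C s : R) (g : X -> R).
Hypotheses (C0 : 0 < C) (s1 : 1 <= s) (mg : measurable_fun setT g)
  (g0 : forall x, 0 <= g x) (rg : (rho vol q g <= 1)%E).
Let s0 : 0 < s. Proof. exact: lt_le_trans s1. Qed.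
Let C_neq0 : C != 0. Proof. by rewrite gt_eqF. Qed.

(** The grid is started in generation [- k] and the heights in [2 ^ - k], so that
    for large [k] every cube and every height takes part. *)
Definition level b k x : R :=
  level_sum vol q (lab b k) (fun y => g y / C) (2 ^ (- k%:Z)) (k + k) x.

Definition levels k x : R := s^-1 * \sum_(b : T) level b k x.

Lemma measurable_level b k : measurable_fun setT (level b k).
Proof.
have labD := dyadic_cubes k (third_shift_in (R := R) b).
apply: measurable_sum => j; apply: measurable_funM.
  apply: measurable_indic.
  apply: (measurable_dom (cube_partition (third_shift b) k)).
  exact: (@above_stop _ _ _ _ _ _ labD).
apply: measurable_fun_powR2; first exact: measurable_cst.
exact: (be_meas qA).
Qed.

Lemma level_ge0 b k x : 0 <= level b k x.
Proof. by apply: sumr_ge0 => j _; rewrite mulr_ge0// powR_ge0. Qed.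

Lemma levels_ge0 k x : 0 <= levels k x.
Proof. by rewrite mulr_ge0 ?invr_ge0 ?(ltW s0)// sumr_ge0// => b _; exact: level_ge0. Qed.

Lemma measurable_levels k : measurable_fun setT (levels k).
Proof.
apply: measurable_funM; first exact: measurable_cst.
by apply: measurable_sum => b; exact: measurable_level.
Qed.

(** Fatou's lemma. *)
Lemma levels_bound (L : R) : 0 <= L -> #|T|%:R * L <= s ->
  (forall b k, (\int[vol]_x (level b k x)%:E <= L%:E)%E) ->
  (\int[vol]_x limn_einf (fun k => (levels k x)%:E) <= 1)%E.
Proof.
move=> L0 Ls Lb.
have mL k : @measurable_fun _ _ X _ setT (fun x => (levels k x)%:E).
  by apply/measurable_EFinP; exact: measurable_levels.
have := fatou (volume R n : {measure set X -> \bar R}) measurableT mL _.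
move=> /(_ (fun k x _ => levels_ge0 k x)); move/le_trans; apply.
apply: limn_einf_le => k.
rewrite (integral_scaleR _ measurableT); last 3 first.
- by apply: measurable_sum => b; exact: measurable_level.
- by move=> x; apply: sumr_ge0 => b _; exact: level_ge0.
- by rewrite invr_ge0 ltW.
rewrite lee_pdivrMl// mule1; under eq_integral do rewrite -sumEFin.
rewrite (ge0_integral_sum _ measurableT); last 2 first.
- by move=> b; apply/measurable_EFinP; exact: measurable_level.
- by move=> b x _; rewrite lee_fin level_ge0.
apply: (@le_trans _ _ (\sum_(b : T) L%:E)%E); first by apply: lee_sum => b _; exact: Lb.
by rewrite sumEFin lee_fin sumr_const -mulr_natl.
Qed.

(** For all large [k], the given cube and the dyadic height just below its
    average both take part in the level sum. *)
Lemma levels_ge b (kap : int) x (A : R) :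
  A = avg vol (dyadic_cube (third_shift b) kap (cube_index (third_shift b) kap x)) g ->
  ((s^-1 * (A / (4 * C)) `^ q x)%:E <= limn_einf (fun k => (levels k x)%:E))%E.
Proof.
move=> AE; have q0 : 0 < q x by exact: (p_gt0 qA).
have A0 : 0 <= A by rewrite AE; apply: avg_ge0.
have [->|An0] := eqVneq A 0.
  rewrite mul0r powR0 ?gt_eqF// mulr0; apply: (limn_einf_ge (n0 := 0)) => k _.
  by rewrite lee_fin levels_ge0.
have Agt0 : 0 < A by rewrite lt_def An0.
have [e /andP[e1 e2]] := dyadic_scale (divr_gt0 Agt0 C0).
apply: (limn_einf_ge (n0 := (`|kap| + `|e| + 2)%N)) => k kbig.
rewrite lee_fin; apply: ler_wpM2l; first by rewrite invr_ge0 ltW.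
rewrite (bigD1 b)//= -[leLHS]addr0; apply: lerD; last first.
  by apply: sumr_ge0 => b' _; exact: level_ge0.
have [i iE _] : exists2 i : nat, i%:Z - k%:Z = kap & (i < k + k)%N.
  by apply: nat_offset; apply: leq_trans kbig; rewrite addn2 ltnS -addnS leq_addr.
have [j jE jk] := nat_offset (absz_pred_lt kbig).
have lvl : 2 ^ (- k%:Z) * 2 ^+ j = 2 ^ e / 2 :> R.
  rewrite exprnP -expfzDr// (_ : - k%:Z + j%:Z = e - 1); last by rewrite -jE; ring.
  by rewrite expfzDr.
have lt_avg : 2 ^ (- k%:Z) * 2 ^+ j < avg vol (cell (lab b k) i x) (fun y => g y / C).
  have labP := cube_partition (third_shift b : 'rV[R]_n) k.
  have gi := rho_cell_integrable1 qA labP i x mg g0 (le_lt_trans rg (ltry 1)).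
  rewrite (_ : (fun y => g y / C) = (fun y => C^-1 * g y)); last first.
    by apply/funext => y; rewrite mulrC.
  rewrite (avgZ (measurable_cell labP i x) _ gi) cell_cube iE -AE lvl [C^-1 * A]mulrC.
  have e0 : (0 : R) < 2 ^ e by exact: pow2_gt0.
  by apply: lt_le_trans e1; lra.
rewrite /level /level_sum (bigD1 (Ordinal jk))//= -[leLHS]addr0; apply: lerD; last first.
  by apply: sumr_ge0 => j' _; rewrite mulr_ge0// powR_ge0.
rewrite indicE mem_set ?mul1r; last first.
  have [m am _] := first_le (P := fun i => 2 ^ (- k%:Z) * 2 ^+ j <
    avg vol (cell (lab b k) i x) (fun y => g y / C)) lt_avg.
  by rewrite /dom /= /above am.
apply: ler_powRl; first exact: ltW.
  by rewrite divr_ge0// mulr_ge0// ltW.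
rewrite lvl (_ : A / (4 * C) = A / C / 4); last by field.
by move: e2; move: (A / C) => a e2; lra.
Qed.

End maximal_bound.

(** * The maximal operator *)

Section maximal_modular.
Context {R : realType} {n : nat}.
Local Notation X := (lebesgueV R n).
Local Notation vol := (volume R n).
Local Notation T := {ffun 'I_n -> bool}.
Variables (p : 'rV[R]_n -> \bar R) (q : X -> R) (pm pP : R).
Hypothesis p_ge1 : forall x, (1 <= p x)%E.
Hypothesis qA : bounded_exponent q pm pP.
Hypothesis pq : {ae (vol : {measure set X -> \bar R}), forall x, p x = (q x)%:E}.

Definition ball_const : R := (6 * n.+1%:R) ^+ n.

Lemma ball_const_gt0 : 0 < ball_const.
Proof. by rewrite exprn_gt0// mulr_gt0. Qed.

Variables (f : 'rV[R]_n -> R[i]) (l C s : R).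
Hypotheses (mf : cmeasurable f) (l0 : 0 < l) (C0 : 0 < C) (s1 : 1 <= s).
Let g (x : X) : R := Normc.normc (f x) / l.
Hypothesis rg : (rho vol q g <= 1)%E.
Let s0 : 0 < s. Proof. exact: lt_le_trans s1. Qed.

Let mg : measurable_fun setT g.
Proof. by apply: measurable_funM; [exact: measurable_normc|exact: measurable_cst]. Qed.

Let g0 x : 0 <= g x.
Proof. by rewrite divr_ge0 ?(ltW l0)//; have := cmodulus_ge0 f x; rewrite lee_fin. Qed.

Let cube_avg b kap (x : 'rV[R]_n) : R :=
  avg vol (dyadic_cube (third_shift b) kap (cube_index (third_shift b) kap x)) g.

(** The ball fills a fixed fraction of the cube provided by [ball_in_cube]. *)
Lemma ball_average_le c r x : 0 < r -> eball c r x -> exists b kap,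
  (average f (eball c r) <= (ball_const * l * cube_avg b kap x)%:E)%E.
Proof.
move=> r0 cx; have [e /andP[e1 e2]] := dyadic_scale (mulr_gt0 (ltr0n R 12) r0).
have re : 6 * r <= 2 ^ (- - e) by rewrite opprK; lra.
have [b hb] := ball_in_cube c re; exists b, (- e).
set t := third_shift b in hb *; set m := cube_index t (- e) x.
have sub : eball c r `<=` dyadic_cube t (- e) m.
  by move=> y cy; apply/cube_indexP; exact: hb.
pose v : R := (2 * r / n.+1%:R) ^+ n.
have v0 : 0 < v by rewrite exprn_gt0// divr_gt0// mulr_gt0.
apply: (le_trans (average_le f v0 (volume_eball_ge c r0) sub)).
pose W : R := (2 ^ (- - e)) ^+ n; have W0 : 0 < W by rewrite exprn_gt0// pow2_gt0.
have WE : vol (dyadic_cube t (- e) m) = W%:E by exact: volume_cube.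
have mQ := measurable_cube t (- e) m.
have gi : (vol : {measure set X -> \bar R}).-integrable (dyadic_cube t (- e) m) (EFin \o g).
  apply: (rho_integrable qA mQ _ mg g0 (le_lt_trans rg (ltry 1))).
  by rewrite [X in (X < _)%E]WE ltry.
have IE : (\int[vol]_(y in dyadic_cube t (- e) m) cmodulus f y =
    (l * (W * cube_avg b (- e) x))%:E)%E.
  rewrite /cube_avg /avg -/t -/m (_ : fine _ = W); last by rewrite [X in fine X]WE.
  rewrite mulVKf ?gt_eqF// EFinM fineK; last exact: (integrable_fin_num mQ gi).
  rewrite -(integral_scaleR _ mQ mg g0 (ltW l0)); apply: eq_integral => y _.
  by rewrite /cmodulus /g mulrC divfK// gt_eqF.
rewrite IE -EFinM lee_fin.
have A0 : 0 <= cube_avg b (- e) x by apply: avg_ge0.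
rewrite ler_pdivrMl// (_ : v * _ = l * (ball_const * v * cube_avg b (- e) x)); last by ring.
rewrite ler_pM2l//; apply: ler_wpM2r => //.
rewrite /W /ball_const /v -exprMn lerXn2r// ?nnegrE ?(ltW (pow2_gt0 _))//.
- by rewrite mulr_ge0// divr_ge0// mulr_ge0// ltW.
- rewrite (_ : 6 * _ * _ = 12 * r); last by field; rewrite addrC natr1 pnatr_eq0.
  by rewrite opprK.
Qed.

Local Notation G x := (limn_einf (fun k => (levels q C s g k x)%:E)).

(** [levels_ge] bounds the average over every ball around [x] by the same
    multiple of a root of the limit. *)
Lemma maximal_pointwise x : p x = (q x)%:E ->
  (lpower (maximal f x / (4 * ball_const * C * s * l)%:E) (p x) <= G x)%E.
Proof.
move=> px; have q0 : 0 < q x by exact: (p_gt0 qA).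
have q1 : 1 <= q x by rewrite -lee_fin -px.
have bc0 := ball_const_gt0.
have G0 : (0 <= G x)%E.
  by apply: (limn_einf_ge (n0 := 0)) => k _; rewrite lee_fin levels_ge0.
case GE: (G x) G0 => [gam| |] // gam0; last by rewrite leey.
  rewrite lee_fin in gam0.
  pose M := (s * gam) `^ (q x)^-1.
  have M0 : 0 <= M by exact: powR_ge0.
  have K0 : 0 < 4 * ball_const * C * s * l by rewrite !mulr_gt0.
  have maxM : (maximal f x <= (4 * ball_const * C * l * M)%:E)%E.
    apply: ge_ereal_sup => _ [[c r] /= [r0 cx] <-].
    have [b [kap h]] := ball_average_le r0 cx; apply: (le_trans h).
    have A0 : 0 <= cube_avg b kap x by apply: avg_ge0.
    have hb := levels_ge qA C0 s1 mg g0 rg (erefl (cube_avg b kap x)).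
    rewrite GE in hb.
    have C4 : 0 < 4 * C by exact: mulr_gt0.
    have A40 := divr_ge0 A0 (ltW C4).
    have AM : cube_avg b kap x / (4 * C) <= M.
      rewrite -[leLHS](powRK A40 (lt0r_neq0 q0)).
      apply: ler_powRl; rewrite ?invr_ge0 ?(ltW q0) ?powR_ge0//.
      by move: hb; rewrite lee_fin ler_pdivrMl.
    rewrite lee_fin; move: AM; rewrite (ler_pdivrMr _ _ C4) => AM.
    have -> : 4 * ball_const * C * l * M = ball_const * l * (M * (4 * C)) by ring.
    by rewrite (ler_pM2l (mulr_gt0 bc0 l0)).
  apply: (@le_trans _ _ (lpower (M / s)%:E (p x))).
    apply: lpower_le => //.
      by rewrite mule_ge0 ?maximal_ge0// inver gt_eqF// lee_fin invr_ge0 ltW.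
    apply: (le_trans (lee_vdiv K0 maxM)).
    rewrite inver gt_eqF// -EFinM lee_fin le_eqVlt; apply/orP; left; apply/eqP.
    by field; rewrite !gt_eqF.
  rewrite px /= lee_fin powRM ?invr_ge0 ?(ltW s0)// powRVK ?mulr_ge0 ?gt_eqF ?(ltW s0)//.
  rewrite powRV// ler_pdivrMr ?powR_gt0// mulrC ler_wpM2l//.
  by rewrite -[leLHS](powRr1 (ltW s0)) ler_powR.
Qed.

Theorem maximal_modular (L : R) : 0 <= L -> #|T|%:R * L <= s ->
  (forall b k, (\int[vol]_x (level q C g b k x)%:E <= L%:E)%E) ->
  (modular p (fun x => maximal f x / (4 * ball_const * C * s * l)%:E) <= 1)%E.
Proof.
move=> L0 Ls Lb; apply: le_trans (levels_bound qA s1 L0 Ls Lb).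
apply: ae_le_ge0_integral => [x|x|]; first exact: lpower_ge0.
  by apply: (limn_einf_ge (n0 := 0)) => k _; rewrite lee_fin levels_ge0.
by apply: (ae_impl pq) => x; exact: maximal_pointwise.
Qed.

End maximal_modular.

(** * The characterization *)

(** The finitely many grids of shifts [0] and [1/3] suffice, and on each of them
    the level sums are bounded by [dyadic_level_bound]. *)
Theorem averaging_maximal_bounded (R : realType) (n : nat)
    (p : 'rV[R]_n -> \bar R) (C : R) :
  measurable_fun [set: lebesgueV R n] p -> (forall x, (1 <= p x)%E) ->
  [/\ (1 < ess_inf (volume R n) p)%E,
    (ess_inf (volume R n) p <= ess_sup (volume R n) p)%E
    & (ess_sup (volume R n) p < +oo)%E] ->
  0 < C -> averaging_bounded p C -> maximal_bounded p.
Proof.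
move=> mp p1 pb C0 bdd.
have [q [pm [pP [qA pmP pq]]]] := real_exponent mp pb.
have C1 : 1 <= C + 1 by rewrite lerDr ltW.
have [L L0 Lb] := dyadic_level_bound (be_gt1 qA) pmP C1 (exprn_ege1 n (ler1n R 2)).
pose s := 1 + #|{ffun 'I_n -> bool}|%:R * L.
have s1 : 1 <= s by rewrite lerDl mulr_ge0.
have s0 : 0 < s by exact: lt_le_trans s1.
have C10 : 0 < C + 1 by exact: lt_le_trans C1.
pose K := 4 * ball_const (R := R) (n := n) * (C + 1) * s.
have K0 : 0 < K by rewrite !mulr_gt0 ?ball_const_gt0.
exists K; split => // f [mf _]; apply: le_vlnorm => // l l0 fl.
pose g (x : lebesgueV R n) : R := Normc.normc (f x) / l.
have mg : measurable_fun setT g.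
  by apply: measurable_funM; [exact: measurable_normc|exact: measurable_cst].
have g0 x : 0 <= g x.
  by rewrite divr_ge0 ?(ltW l0)//; have := cmodulus_ge0 f x; rewrite lee_fin.
have rg : (rho (volume R n) q g <= 1)%E.
  apply: (le_trans (rho_le_modular pq g)); apply: le_trans fl.
  apply: (le_modular p1) => x; first by rewrite /= lee_fin; exact: g0.
  by rewrite /cmodulus inver gt_eqF// -EFinM.
apply: (maximal_modular p1 qA pq mf l0 C10 s1 rg L0); first by rewrite lerDr.
move=> b k; have tT := third_shift_in (R := R) b.
apply: (Lb _ _ _ _ _ _ _ _ qA (dyadic_cubes k tT) _ mg g0 rg).
  exact: (averages_bounded_cubes p1 qA pq k C0 bdd tT).
exact: pow2_gt0.
Qed.

Local Open Scope ereal_scope.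

Theorem corollary8p2 (R : realType) (n : nat) (n_gt0 : (0 < n)%N)
  (p : 'rV[R]_n -> \bar R)
  (p_meas : measurable_fun [set: lebesgueV R n] p)
  (p_ge1 : forall x, 1 <= p x)
  (p_bounds : [/\ 1 < ess_inf (volume R n) p,
    ess_inf (volume R n) p <= ess_sup (volume R n) p
    & ess_sup (volume R n) p < +oo]) :
  maximal_bounded p <->
  exists C : R, (0 < C)%R /\
    forall (f : 'rV[R]_n -> R[i]) (QQ : set (set 'rV[R]_n)),
      vlspace p f -> QQ `<=` adjacent_cubes R n -> trivIset QQ id ->
      vlnorm p (averaging QQ f) <= C%:E * vlnorm p (cmodulus f).
Proof.
split => [[C [C0 bdd]]|[C [C0 bdd]]]; last first.
  exact: (averaging_maximal_bounded p_meas p_ge1 p_bounds C0 bdd).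
pose K : R := ((2 * n.+1%:R) ^+ n)%R.
have K0 : (0 < K)%R by rewrite exprn_gt0// mulr_gt0.
exists (K * C)%R; split; first exact: mulr_gt0.
move=> f QQ fV adj tQ; rewrite EFinM -muleA.
apply: (@le_trans _ _ (K%:E * vlnorm p (maximal f))).
  apply: le_vlnormM => // x; first exact: averaging_ge0.
  exact: averaging_le_maximal.
by rewrite lee_pmul2l// bdd.
Qed.
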